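(* Let $X,U,Y$ be complex Banach spaces, $1\le p<\infty$, let $\mathcal U=\{U(t,\tau)\}_{t\ge\tau}$ be an exponentially stable evolution family on $X$ and let $\Gamma$ denote the generator of the corresponding evolution semigroup on $L^p(\mathbb R_+,X)$. If $B(\cdot)\in L^\infty(\mathbb R_+,\mathcal L_s(U,X))$ and $C(\cdot)\in L^\infty(\mathbb R_+,\mathcal L_s(X,Y))$, then the input-output operator $\mathbb L$ is a bounded operator from $L^p(\mathbb R_+,U)$ to $L^p(\mathbb R_+,Y)$, the formula $$\mathbb L=\mathcal C\mathbb G\mathcal B=-\mathcal C\Gamma^{-1}\mathcal B$$ holds, and $$\frac1{\|\mathbb L\|}\le r_{stab}(\mathcal U,B,C).$$ In the ''unstructured'' case, where $U=Y=X$ and $B=C=I$, one has $\mathbb L=-\Gamma^{-1}$ and $$\frac1{\|\Gamma^{-1}\|}\le r_{stab}(\mathcal U,I,I)\le\frac1{r(\Gamma^{-1})},$$ where $r(\cdot)$ denotes the spectral radius.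
   Context: $\mathbb R_+=[0,\infty)$; $1/0:=\infty$. For Banach spaces $V,W$, $L^\infty(\mathbb R_+,\mathcal L_s(V,W))$ is the set of (essentially) bounded functions $D:\mathbb R_+\to\mathcal L(V,W)$ such that $t\mapsto D(t)v$ is strongly measurable for each $v\in V$; $\|D(\cdot)\|_\infty=\operatorname{ess\,sup}_t\|D(t)\|$. An evolution family on $X$ is a family $\{U(t,\tau)\}_{t\ge\tau\ge0}$ of bounded linear operators on $X$ such that $U(t,\tau)=U(t,s)U(s,\tau)$ and $U(t,t)=I$ for $t\ge s\ge\tau$, and for each $x\in X$ the map $(t,\tau)\mapsto U(t,\tau)x$ is continuous for $t\ge\tau$. It is exponentially stable if there are $M\ge1$, $\omega<0$ with $\|U(t,\tau)\|\le Me^{\omega(t-\tau)}$ for all $t\ge\tau$. The evolution semigroup on $L^p(\mathbb R_+,X)$ is $(E^tf)(\tau)=U(\tau,\tau-t)f(\tau-t)$ for $0\le t\le\tau$ and $(E^tf)(\tau)=0$ for $0\le\tau<t$. Further, $(\mathbb Gf)(t)=\int_0^tU(t,\tau)f(\tau)\,d\tau$; $\mathcal B:L^p(\mathbb R_+,U)\to L^p(\mathbb R_+,X)$ and $\mathcal C:L^p(\mathbb R_+,X)\to L^p(\mathbb R_+,Y)$ are the multiplication operators $(\mathcal Bu)(t)=B(t)u(t)$, $(\mathcal Cf)(t)=C(t)f(t)$; and $(\mathbb Lu)(t)=C(t)\int_0^tU(t,\tau)B(\tau)u(\tau)\,d\tau$. For $\Delta(\cdot)\in L^\infty(\mathbb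 R_+,\mathcal L_s(Y,U))$, $\mathcal U_\Delta=\{U_\Delta(t,s)\}_{t\ge s}$ is the unique evolution family with $U_\Delta(t,s)x=U(t,s)x+\int_s^tU(t,\tau)B(\tau)\Delta(\tau)C(\tau)U_\Delta(\tau,s)x\,d\tau$ for $x\in X$, $t\ge s\ge 0$. The stability radius is $$r_{stab}(\mathcal U,B,C)=\sup\{r\ge0:\ \|\Delta(\cdot)\|_\infty\le r\Rightarrow\mathcal U_\Delta\text{ is exponentially stable}\},$$ $\Delta$ ranging over $L^\infty(\mathbb R_+,\mathcal L_s(Y,U))$. *)

(* Defs.v *)
From HB Require Import structures.
From mathcomp Require Import all_boot all_order all_algebra.
From mathcomp Require Import all_classical all_reals all_analysis.
From mathcomp Require Import ess_sup_inf.
From mathcomp.real_closed Require Import complex.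
Set Implicit Arguments.
Unset Strict Implicit.
Unset Printing Implicit Defensive.
Import Order.TTheory GRing.Theory Num.Theory.
Import numFieldNormedType.Exports.
Local Open Scope classical_set_scope.
Local Open Scope ring_scope.

(* A complex Banach space is a [completeNormedModType R[i]].  Its norm takes
   its values in [R[i]]; [nrm] is the same norm with values in [R]. *)
Definition nrm {R : realType} {V : normedModType R[i]} (x : V) : R :=
  complex.Re `|x|.

Definition Rplus {R : realType} : set R := [set t | 0 <= t].

Section BochnerIntegral.
Context {R : realType} {V : normedModType R[i]}.
Local Notation mu := (@lebesgue_measure R).

Definition simple (s : {fimfun R >-> V}) : Prop :=
  forall v, measurable (s @^-1` [set v]).

Definition strongly_measurable (D : set R) (f : R -> V) : Prop :=
  exists s : nat -> {fimfun R >-> V}, (forall n, simple (s n)) /\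
    {ae mu, forall t, D t -> s n t @[n --> \oo] --> f t}.

Definition simple_integral (a b : R) (s : {fimfun R >-> V}) : V :=
  \sum_(v \in range s) (fine (mu (`[a, b] `&` s @^-1` [set v])))%:C%C *: v.

Definition has_bochner_integral (a b : R) (f : R -> V) (v : V) : Prop :=
  exists s : nat -> {fimfun R >-> V},
    [/\ forall n, simple (s n),
        {ae mu, forall t, t \in `[a, b] -> s n t @[n --> \oo] --> f t},
        (\int[mu]_(t in `[a, b]) (nrm (f t - s n t))%:E)%E
          @[n --> \oo] --> 0%E
      & simple_integral a b (s n) @[n --> \oo] --> v].

(* The value is 0 when [f] is not Bochner integrable over [a, b]. *)
Definition bochner (a b : R) (f : R -> V) : V :=
  xget 0 [set v | has_bochner_integral a b f v].

End BochnerIntegral.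

Section BoundedOperators.
Context {R : realType} {V W : normedModType R[i]}.
Local Notation mu := (@lebesgue_measure R).

Definition opnorm (A : V -> W) : \bar R :=
  ereal_sup [set (nrm (A x))%:E | x in [set x | nrm x <= 1]].

Definition bounded_linear (A : V -> W) : Prop :=
  (forall (a : R[i]) (x y : V), A (a *: x + y) = a *: A x + A y) /\
  (opnorm A < +oo)%E.

Definition Linf_norm (D : R -> V -> W) : \bar R :=
  ess_sup mu ((fun t => opnorm (D t)) \_ Rplus).

(* D belongs to L^oo(R_+, L_s(V, W)); values at negative times are ignored. *)
Definition Linf_s (D : R -> V -> W) : Prop :=
  [/\ forall t, 0 <= t -> bounded_linear (D t),
      forall v, strongly_measurable Rplus (fun t => D t v)
    & (Linf_norm D < +oo)%E].

End BoundedOperators.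

(* L^p(R_+, V) is handled through representatives: functions R -> V, considered
   on R_+ only and up to equality almost everywhere ([Lp_eq]). *)
Section LpSpace.
Context {R : realType} {V : normedModType R[i]}.
Local Notation mu := (@lebesgue_measure R).

Definition Lp_norm (p : R) (f : R -> V) : \bar R :=
  ((\int[mu]_(t in Rplus) ((nrm (f t)) `^ p)%:E) `^ p^-1)%E.

Definition Lp (p : R) (f : R -> V) : Prop :=
  strongly_measurable Rplus f /\ (Lp_norm p f < +oo)%E.

Definition Lp_eq (f g : R -> V) : Prop :=
  {ae mu, forall t, Rplus t -> f t = g t}.

End LpSpace.

Section LpOperators.
Context {R : realType} {V W : normedModType R[i]}.

Definition Lp_opnorm (p : R) (T : (R -> V) -> R -> W) : \bar R :=
  ereal_sup [set Lp_norm p (T f) | f in [set f | Lp p f /\ (Lp_norm p f <= 1)%E]].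

(* T induces a bounded linear operator from L^p(R_+, V) to L^p(R_+, W). *)
Definition Lp_bounded (p : R) (T : (R -> V) -> R -> W) : Prop :=
  [/\ forall f, Lp p f -> Lp p (T f),
      forall f g, Lp p f -> Lp p g -> Lp_eq f g -> Lp_eq (T f) (T g),
      forall (a : R[i]) f g, Lp p f -> Lp p g ->
        Lp_eq (T (a *: f + g)) (a *: T f + T g)
    & (Lp_opnorm p T < +oo)%E].

End LpOperators.

Section Spectrum.
Context {R : realType} {V : normedModType R[i]}.

Definition Lp_resolvent_set (p : R) (T : (R -> V) -> R -> V) : set R[i] :=
  [set l | exists2 S : (R -> V) -> R -> V, Lp_bounded p S &
     forall f, Lp p f ->
       Lp_eq (l *: S f - T (S f)) f /\ Lp_eq (S (l *: f - T f)) f].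

Definition Lp_spectrum (p : R) (T : (R -> V) -> R -> V) : set R[i] :=
  ~` Lp_resolvent_set p T.

(* The element 0 only matters for the empty spectrum, i.e. on the zero space. *)
Definition Lp_spectral_radius (p : R) (T : (R -> V) -> R -> V) : \bar R :=
  ereal_sup (0%E |` [set (complex.Re `|l|)%:E | l in Lp_spectrum p T]).

End Spectrum.

Section Evolution.
Context {R : realType} {X : normedModType R[i]}.

Definition evolution_family (U : R -> R -> X -> X) : Prop :=
  [/\ forall t tau, 0 <= tau <= t -> bounded_linear (U t tau),
      forall t s tau, 0 <= tau -> tau <= s -> s <= t ->
        forall x, U t tau x = U t s (U s tau x),
      forall t, 0 <= t -> forall x, U t t x = x
    & forall x, {within [set z : R * R | 0 <= z.2 <= z.1],
        continuous (fun z : R * R => U z.1 z.2 x)}].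

Definition exponentially_stable (U : R -> R -> X -> X) : Prop :=
  exists M omega : R, [/\ 1 <= M, omega < 0 &
    forall t tau, 0 <= tau <= t ->
      (opnorm (U t tau) <= (M * expR (omega * (t - tau)))%:E)%E].

Definition evolution_semigroup (U : R -> R -> X -> X) (t : R) (f : R -> X) :
    R -> X :=
  fun tau => if t <= tau then U tau (tau - t) (f (tau - t)) else 0.

(* The graph of the generator in L^p(R_+, X) of a semigroup E: f belongs to the
   domain and is mapped to g. *)
Definition generator (p : R) (E : R -> (R -> X) -> R -> X) (f g : R -> X) :
    Prop :=
  [/\ Lp p f, Lp p g &
    Lp_norm p ((h^-1)%:C%C *: (E h f - f) - g) @[h --> (0 : R)^'+] --> 0%E].

(* S is the bounded inverse, defined on all of L^p(R_+, X), of the operator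
   with graph A. *)
Definition bounded_inverse (p : R) (A : (R -> X) -> (R -> X) -> Prop)
    (S : (R -> X) -> R -> X) : Prop :=
  [/\ Lp_bounded p S,
      forall g, Lp p g -> A (S g) g
    & forall f g, A f g -> Lp_eq (S g) f].

Definition GG (U : R -> R -> X -> X) (f : R -> X) : R -> X :=
  fun t => bochner 0 t (fun tau => U t tau (f tau)).

End Evolution.

Definition mult_op {R : realType} {V W : normedModType R[i]} (D : R -> V -> W)
  (f : R -> V) : R -> W := fun t => D t (f t).

Section StabilityRadius.
Context {R : realType} {X V Y : normedModType R[i]}.

Definition input_output (U : R -> R -> X -> X) (B : R -> V -> X)
    (C : R -> X -> Y) (u : R -> V) : R -> Y :=
  fun t => C t (bochner 0 t (fun tau => U t tau (B tau (u tau)))).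

(* UD is the evolution family U_Delta (which is unique on t >= s >= 0). *)
Definition perturbed_family (U : R -> R -> X -> X) (B : R -> V -> X)
    (C : R -> X -> Y) (Delta : R -> Y -> V) (UD : R -> R -> X -> X) : Prop :=
  evolution_family UD /\
  forall x t s, 0 <= s <= t ->
    UD t s x = U t s x
      + bochner s t (fun tau => U t tau (B tau (Delta tau (C tau (UD tau s x))))).

Definition r_stab (U : R -> R -> X -> X) (B : R -> V -> X) (C : R -> X -> Y) :
    \bar R :=
  ereal_sup [set r%:E | r in [set r : R | 0 <= r /\
    forall Delta : R -> Y -> V, Linf_s Delta -> (Linf_norm Delta <= r%:E)%E ->
      exists2 UD, perturbed_family U B C Delta UD & exponentially_stable UD]].

End StabilityRadius.

(* Main.v *)
Require Import Defs.
From HB Require Import structures.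
From mathcomp Require Import all_boot all_order all_algebra.
From mathcomp Require Import all_classical all_reals all_analysis.
From mathcomp.real_closed Require Import complex.
From mathcomp Require Import measurable_realfun ess_sup_inf ring lra.
Set Implicit Arguments.
Unset Strict Implicit.
Unset Printing Implicit Defensive.
Import Order.TTheory GRing.Theory Num.Theory.
Import numFieldNormedType.Exports.
Local Open Scope classical_set_scope.
Local Open Scope ring_scope.

(* Write [G] for [GG U], the Volterra operator of a stable family.

   [G] inverts minus the generator.  The quotient (G g - E^h G g) / h is the mean
   h^-1 \int_(t-h)^t U(t, s) g(s) ds; these means are uniformly bounded operators on L^p
   (Schur test) and converge to [g] when [g] is continuous with compact support, hence for
   all [g].  A function killed by the generator is fixed by every E^t, while E^t f vanishes
   on [0, t).

   Lower bound.  For x in X, the output y = C U_Delta(., s) x solves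
   y = C U(., s) x + L (Delta y).  If |Delta| <= r and r |L| < 1, cutting off at a finite
   time makes |y|_p finite and then bounds it by |C U(., s) x|_p / (1 - r |L|), uniformly
   in [s].  So t |-> U_Delta(t, s) x is in L^p with norm at most Q |x|, and Datko's argument
   yields exponential stability.

   Upper bound.  Let |l| > 1 / r and k = - 1 / l.  The perturbation Delta = k I is
   admissible, so the family W = U_Delta is stable, and its evolution semigroup has the
   generator Gamma + k.  Hence (1 - k G)^-1 = 1 + k G_W and l is not in the spectrum
   of Gamma^-1 = - G. *)

(** * Norms and nonnegative integrals *)

(** [bochner] returns 0 on functions that are not integrable, so every computation with integrals
    needs an integrability proof. Elements of L^p are representatives, and one that satisfies
    [pettis] is substituted whenever a measurable norm is required.

    [r_stab] asks for the existence of U_Delta, so this family is constructed, by Picard iteration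
    for the feedback F = B Delta C. As F is only strongly measurable in time, continuity of (t, s)
    |-> U_Delta(t, s) x rests on dominated convergence along sequences. The iteration yields an
    exponentially growing bound, which makes norms finite on bounded intervals and bridges unit time
    steps in Datko's argument.

    For the upper bound, the identities G (1 + k G_W) = G_W and G_W (1 - k G) = G are read off from
    the generators, each Volterra operator inverting minus its own generator, so that no order of
    integration is exchanged. The price is a proof that the difference of the two semigroups,
    divided by the time step, converges strongly to k in L^p. *)

Section NrmTheory.
Context {R : realType} {V : normedModType R[i]}.
Implicit Types (x y z : V) (s : nat -> V).

Lemma normE x : `|x| = (nrm x)%:C%C.
Proof. by rewrite /nrm RRe_real// ger0_real. Qed.

Lemma nrm_ge0 x : 0 <= nrm x.
Proof. by have := normr_ge0 x; rewrite normE ler0c. Qed.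

Lemma nrm0 : nrm (0 : V) = 0.
Proof. by rewrite /nrm normr0. Qed.

Lemma nrm_eq0 x : nrm x = 0 -> x = 0.
Proof. by move=> h; apply/eqP; rewrite -normr_eq0 normE h. Qed.

Lemma nrmD x y : nrm (x + y) <= nrm x + nrm y.
Proof. by rewrite -lecR rmorphD/= -!normE ler_normD. Qed.

Lemma nrmN x : nrm (- x) = nrm x.
Proof. by rewrite /nrm normrN. Qed.

Lemma nrmBC x y : nrm (x - y) = nrm (y - x).
Proof. by rewrite -nrmN opprB. Qed.

Lemma nrmZ (a : R[i]) x : nrm (a *: x) = complex.Re `|a| * nrm x.
Proof.
apply: complexI; rewrite -normE normrZ normE rmorphM/=.
by rewrite complexRe /= (RRe_real (normr_real a)).
Qed.

Lemma nrmZR (a : R) x : nrm (a%:C%C *: x) = `|a| * nrm x.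
Proof. by rewrite nrmZ normc_def/= expr0n addr0 sqrtr_sqr. Qed.

Lemma nrm_le_sub x y z : nrm (x - z) <= nrm (x - y) + nrm (y - z).
Proof. by rewrite -(subrKA y) nrmD. Qed.

Lemma nrm_dist x y : `|nrm x - nrm y| <= nrm (x - y).
Proof.
rewrite ler_norml lerBrDr lerBlDr; apply/andP; split.
  by have := nrmD (y - x) x; rewrite subrK nrmBC; lra.
by have := nrmD (x - y) y; rewrite subrK.
Qed.

Lemma nrm_sum (I : Type) (r : seq I) (F : I -> V) :
  nrm (\sum_(i <- r) F i) <= \sum_(i <- r) nrm (F i).
Proof.
elim/big_rec2: _ => [|i a b _ h]; first by rewrite nrm0.
by rewrite (le_trans (nrmD _ _))// lerD2l.
Qed.

Lemma cvg_nrmP (T : Type) (F : set_system T) {FF : Filter F} (f : T -> V) l :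
  f t @[t --> F] --> l <-> nrm (f t - l) @[t --> F] --> (0 : R).
Proof.
split=> [/cvgrPdist_lt h|/cvgrPdist_lt h]; apply/cvgrPdist_lt => e e0.
  have := h e%:C%C; rewrite ltcR => /(_ e0); apply: filterS => t.
  by rewrite sub0r normrN ger0_norm ?nrm_ge0// normE ltcR nrmBC.
(* A positive element of [R[i]] is real, so the radii of neighbourhoods in [V] can be taken in
   [R]. *)
have er : e = (complex.Re e)%:C%C by rewrite RRe_real// gtr0_real.
have := h (complex.Re e); rewrite -ltcR -er => /(_ e0); apply: filterS => t.
by rewrite sub0r normrN ger0_norm ?nrm_ge0// normE er ltcR nrmBC.
Qed.

Lemma cvg_nrm (T : Type) (F : set_system T) {FF : Filter F} (f : T -> V) l :
  f t @[t --> F] --> l -> nrm (f t) @[t --> F] --> nrm l.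
Proof.
move=> /cvg_nrmP/cvgrPdist_lt h; apply/cvgrPdist_lt => e /h; apply: filterS => t.
rewrite sub0r normrN ger0_norm ?nrm_ge0// => /le_lt_trans; apply.
by rewrite nrmBC nrm_dist.
Qed.

End NrmTheory.

Lemma nrm_cauchy_cvg {R : realType} {V : completeNormedModType R[i]} (s : nat -> V) :
  (forall e : R, 0 < e -> exists N, forall m n, (N <= m)%N -> (N <= n)%N ->
     nrm (s m - s n) < e) ->
  exists l : V, s n @[n --> \oo] --> l.
Proof.
move=> h; suff : cvg (s n @[n --> \oo]) by move=> /cvg_ex.
apply/cauchy_cvgP/cauchy_exP => e e0.
have er : e = (complex.Re e)%:C%C by rewrite RRe_real// gtr0_real.
have := h (complex.Re e); rewrite -ltcR -er => /(_ e0)[N hN].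
exists (s N); exists N => // n/= Nn.
by rewrite -ball_normE/= er normE ltcR hN.
Qed.

Section BoundedLinear.
Context {R : realType} {V W : normedModType R[i]}.
Variable A : V -> W.

Lemma opnorm_ge0 : (0 <= opnorm A)%E.
Proof.
apply: ereal_sup_ge; exists (nrm (A 0))%:E; last by rewrite lee_fin nrm_ge0.
by exists 0 => //=; rewrite nrm0.
Qed.

Lemma opnorm_le (k : R) : 0 <= k -> (forall x, nrm (A x) <= k * nrm x) ->
  (opnorm A <= k%:E)%E.
Proof.
move=> k0 h; apply: ub_ereal_sup => _ [x /= x1 <-].
by rewrite lee_fin (le_trans (h x))// ler_piMr.
Qed.

Hypothesis bA : bounded_linear A.

Lemma blinD x y : A (x + y) = A x + A y.
Proof. by have [h _] := bA; rewrite -{1}[x]scale1r h scale1r. Qed.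

Lemma blin0 : A 0 = 0.
Proof. by apply: (addrI (A 0)); rewrite -blinD !addr0. Qed.

Lemma blinZ a x : A (a *: x) = a *: A x.
Proof. by have [h _] := bA; rewrite -{1}[a *: x]addr0 h blin0 addr0. Qed.

Lemma blinN x : A (- x) = - A x.
Proof. by rewrite -scaleN1r blinZ scaleN1r. Qed.

Lemma blinB x y : A (x - y) = A x - A y.
Proof. by rewrite blinD blinN. Qed.

Lemma blin_sum (I : Type) (r : seq I) (F : I -> V) :
  A (\sum_(i <- r) F i) = \sum_(i <- r) A (F i).
Proof. by elim/big_rec2: _ => [|i a b _ <-]; rewrite ?blin0 ?blinD. Qed.

Lemma opnormP (k : R) : (opnorm A <= k%:E)%E -> forall x, nrm (A x) <= k * nrm x.
Proof.
move=> h x; have [x0|x0] := eqVneq (nrm x) 0.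
  by rewrite (nrm_eq0 x0) blin0 !nrm0 mulr0.
have xp : 0 < nrm x by rewrite lt_neqAle eq_sym x0 nrm_ge0.
have : (nrm (A ((nrm x)^-1%:C%C *: x)) <= k).
  rewrite -lee_fin (le_trans _ h)//; apply: ereal_sup_ubound.
  eexists; last reflexivity.
  by rewrite /= nrmZR ger0_norm ?invr_ge0 ?nrm_ge0// mulVf.
rewrite blinZ nrmZR ger0_norm ?invr_ge0 ?nrm_ge0//.
by rewrite mulrC ler_pdivrMr.
Qed.

Lemma blin_bound : exists2 k : R, 0 <= k & forall x, nrm (A x) <= k * nrm x.
Proof.
have [_ fin] := bA.
exists (fine (opnorm A)); first by rewrite fine_ge0// opnorm_ge0.
apply: opnormP; rewrite fineK// ge0_fin_numE//; exact: opnorm_ge0.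
Qed.

Lemma blin_cvg (T : Type) (F : set_system T) {FF : Filter F} (f : T -> V) l :
  f t @[t --> F] --> l -> A (f t) @[t --> F] --> A l.
Proof.
have [k k0 hk] := blin_bound.
move=> /cvg_nrmP h; apply/cvg_nrmP.
apply: (@squeeze_cvgr _ _ _ _ (fun=> 0) (fun t => k * nrm (f t - l))).
- by apply: nearW => t; rewrite nrm_ge0/= -blinB hk.
- exact: cvg_cst.
- by rewrite -[X in _ --> X](mulr0 k); apply: cvgMr.
Qed.

End BoundedLinear.

Lemma bounded_linearP {R : realType} {V W : normedModType R[i]} (A : V -> W) (k : R) :
  (forall a x y, A (a *: x + y) = a *: A x + A y) ->
  (forall x, nrm (A x) <= k * nrm x) -> bounded_linear A.
Proof.
move=> linA hk; split=> //; apply: (@le_lt_trans _ _ (Num.max 0 k)%:E); last exact: ltry.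
apply: opnorm_le => [|x]; first by rewrite le_max lexx.
by rewrite (le_trans (hk x))// ler_wpM2r ?nrm_ge0// le_max lexx orbT.
Qed.

Section LowerIntegral.
Context d (T : measurableType d) (R : realType).
Variable mu : {measure set T -> \bar R}.
Import HBNNSimple.
Local Open Scope ereal_scope.

(* [g] need not be measurable: the integral of a nonnegative function is the
   supremum of the integrals of the simple functions below it. *)
Lemma le_integral_ae (D : set T) (f g : T -> \bar R) : measurable D ->
  (forall x, D x -> 0 <= f x) -> (forall x, D x -> 0 <= g x) ->
  {ae mu, forall x, D x -> f x <= g x} ->
  \int[mu]_(x in D) f x <= \int[mu]_(x in D) g x.
Proof.
move=> mD f0 g0 [N [mN N0 hN]].
rewrite integral_mkcond [leRHS]integral_mkcond.
rewrite !ge0_integralTE//; [|by move=> x; apply: erestrict_ge0..].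
apply: ub_ereal_sup => _ [h /= hf <-].
(* A simple function below [f] is set to 0 on the null set where the inequality may fail; it then
   lies below [g] everywhere and loses nothing of its integral. *)
pose k : {nnsfun T >-> R} := proj_nnsfun h (measurableC mN).
have kE x : k x = (h \_ (~` N)) x by rewrite (mrestrict h (measurableC mN)).
apply: ereal_sup_ge; exists (sintegral mu k).
  exists k => // x; rewrite kE /patch.
  have [xN|xN] := boolP (x \in ~` N).
    rewrite (le_trans (hf x))//.
    move: xN; rewrite inE => xN; rewrite /patch; case: ifPn => // /[!inE] Dx.
    by apply: contrapT => fg; apply: xN; apply: hN => /= /(_ Dx).
  exact: (erestrict_ge0 g0 x).
rewrite -!integralT_nnsfun.
apply: ae_ge0_le_integral => //.
- by move=> x _; rewrite lee_fin; apply: fun_ge0.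
- exact/measurable_EFinP.
- by move=> x _; rewrite lee_fin; apply: fun_ge0.
- exact/measurable_EFinP.
exists N; split => // x /= /not_implyP[_]; apply: contra_notP => xN.
by rewrite mindicE mem_set// mulr1.
Qed.

Lemma eq_integral_ae (D : set T) (f g : T -> \bar R) : measurable D ->
  (forall x, D x -> 0 <= f x) -> (forall x, D x -> 0 <= g x) ->
  {ae mu, forall x, D x -> f x = g x} ->
  \int[mu]_(x in D) f x = \int[mu]_(x in D) g x.
Proof.
move=> mD f0 g0 fg; apply/eqP; rewrite eq_le !le_integral_ae//.
- by apply: filterS fg => x h Dx; rewrite h.
- by apply: filterS fg => x h Dx; rewrite h.
Qed.

(** Restricting both integrands to their domains moves the comparison to the whole space. This is
    the tool for integrals over different sets, such as a moving window against a half-line. *)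
Lemma le_integral_supp (D E : set T) (f g : T -> \bar R) :
  (forall x, 0 <= f x) -> (forall x, 0 <= g x) ->
  (forall x, D x -> E x -> f x <= g x) -> (forall x, D x -> ~ E x -> f x = 0) ->
  \int[mu]_(x in D) f x <= \int[mu]_(x in E) g x.
Proof.
move=> f0 g0 fg fz; rewrite integral_mkcond [leRHS]integral_mkcond.
apply: le_integral_ae; [by []|by move=> x _; exact: erestrict_ge0..|].
apply: aeW => x _; rewrite /patch; case: ifPn => [/set_mem Dx|_].
  by case: ifPn => [/set_mem Ex|/negP nE]; [exact: fg|rewrite fz// => /mem_set].
by case: ifPn => _; [exact: g0|exact: lexx].
Qed.

End LowerIntegral.

Lemma Re_norm_ge0 {R : realType} (c : R[i]) : 0 <= complex.Re `|c|.
Proof. by rewrite normc_def/= sqrtr_ge0. Qed.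

Section SmallSequences.
Context {R : realType}.

Lemma cvge0P (u : nat -> \bar R) : (forall n, 0 <= u n)%E ->
  (u n @[n --> \oo] --> 0%E <->
   forall e : R, 0 < e -> exists N, forall n, (N <= n)%N -> (u n <= e%:E)%E).
Proof.
move=> u0; split=> [cu e e0|h].
  have /cu[N _ hN] : nbhs (0%E : \bar R) [set x | (x < e%:E)%E].
    apply: open_nbhs_nbhs; split; [exact: open_ereal_lt_ereal|by rewrite /= lte_fin].
  by exists N => n Nn; apply/ltW/hN.
(* The terms may be infinite at first; the choice [e = 1] makes them finite from [N] on, where
   convergence of real numbers can be used. *)
have [N hN] := h 1 ltr01.
have fu n : (N <= n)%N -> u n \is a fin_num.
  by move=> Nn; rewrite ge0_fin_numE// (le_lt_trans (hN _ Nn))// ltry.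
apply/fine_cvgP; split; first by exists N.
apply/cvgrPdist_le => e e0; have [M hM] := h e e0.
exists (maxn N M) => // n /=; rewrite geq_max => /andP[Nn Mn].
rewrite sub0r normrN ger0_norm ?fine_ge0//.
by rewrite -lee_fin fineK ?fu// hM.
Qed.

Lemma cvgr0P (u : nat -> R) : (forall n, 0 <= u n) ->
  (u n @[n --> \oo] --> (0 : R) <->
   forall e : R, 0 < e -> exists N, forall n, (N <= n)%N -> u n <= e).
Proof.
move=> u0; split=> [/cvgrPdist_le cu e e0|h].
  have [N _ hN] := cu e e0; exists N => n /hN /=.
  by rewrite sub0r normrN ger0_norm.
apply/cvgrPdist_le => e e0; have [N hN] := h e e0; exists N => // n /hN /=.
by rewrite sub0r normrN ger0_norm.
Qed.

Lemma cvg_le_lim (u : nat -> R) l (c : R) N : u n @[n --> \oo] --> l ->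
  (forall n, (N <= n)%N -> u n <= c) -> l <= c.
Proof.
by move=> cu h; apply: (cvgr_to_le cu); exists N => // n /h.
Qed.

End SmallSequences.

(** * Strong measurability *)

Section FiniteValued.
Context {R : realType}.

(** The values lie in an arbitrary type, so that two simple functions, or a simple function and the
    membership test of a set, can be paired and then recombined by any map
    ([finite_valued_comp]). *)
Definition finite_valued (T : Type) (s : R -> T) : Prop :=
  finite_set (range s) /\ forall v, measurable (s @^-1` [set v]).

Lemma finite_valued_preimage (T : Type) (s : R -> T) (A : set T) :
  finite_valued s -> measurable (s @^-1` A).
Proof.
move=> [fs ms].
rewrite (_ : s @^-1` A = \bigcup_(v in range s `&` A) s @^-1` [set v]).
  by apply: fin_bigcup_measurable => //; apply: sub_finite_set fs => v [].
apply/seteqP; split => [t At|t [v [_ Av]] /= sv]; last by rewrite /preimage/= sv.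
by exists (s t) => //; split => //; exists t.
Qed.

Lemma finite_valued_comp (T T' : Type) (s : R -> T) (phi : T -> T') :
  finite_valued s -> finite_valued (phi \o s).
Proof.
move=> fs; split; last by move=> v; exact: (finite_valued_preimage (phi @^-1` [set v])).
by rewrite -(image_comp s phi); apply: finite_image; case: fs.
Qed.

Lemma finite_valued_pair (T T' : Type) (s : R -> T) (s' : R -> T') :
  finite_valued s -> finite_valued s' -> finite_valued (fun t => (s t, s' t)).
Proof.
move=> [fs ms] [fs' ms']; split.
  apply: sub_finite_set (finite_setX fs fs') => _ [t _ <-]; split => /=; by exists t.
move=> [v w]; rewrite (_ : _ @^-1` _ = s @^-1` [set v] `&` s' @^-1` [set w]).
  exact: measurableI.
by apply/seteqP; split => t /=; [case=> -> ->|case=> <- <-].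
Qed.

Lemma finite_valued_indic (A : set R) : measurable A ->
  finite_valued (fun t => t \in A).
Proof.
move=> mA; split.
  exact: finite_finset.
move=> [].
  rewrite (_ : _ @^-1` _ = A) //; apply/seteqP.
  by split=> t /= h; [exact: set_mem|exact: mem_set].
rewrite (_ : _ @^-1` _ = ~` A); first exact: measurableC.
apply/seteqP; split=> t /=; first by move=> tA At; move: tA; rewrite mem_set.
by move=> At; rewrite memNset.
Qed.

Lemma finite_valued_measurable (T : Type) (s : R -> T) (G : T -> R) :
  finite_valued s -> measurable_fun setT (G \o s).
Proof.
move=> fs _ Y mY; rewrite setTI; exact: (finite_valued_preimage (G @^-1` Y)).
Qed.

Lemma finite_valued_fimfun {V : normedModType R[i]} (s : R -> V) : finite_valued s ->
  exists2 s' : {fimfun R >-> V}, simple s' & s' = s :> (R -> V).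
Proof.
move=> [fs ms].
by exists (HB.pack_for {fimfun R >-> V} s (FiniteImage.Build _ _ s fs)).
Qed.

Lemma simple_finite_valued {V : normedModType R[i]} (s : {fimfun R >-> V}) :
  simple s -> finite_valued s.
Proof. by move=> ss; split => //; exact: fimfunP. Qed.

End FiniteValued.

Section Pettis.
Context {R : realType} {V : normedModType R[i]}.
Implicit Types (f g : R -> V).

(* The two conditions of Pettis' measurability theorem; unlike [strongly_measurable]
   they are visibly stable under pointwise limits. *)
Definition pettis f : Prop :=
  (exists d : nat -> V, forall t (e : R), 0 < e -> exists k, nrm (f t - d k) < e) /\
  forall v, measurable_fun setT (fun t => nrm (f t - v)).

Lemma pettis_nrm f : pettis f -> measurable_fun setT (fun t => nrm (f t)).
Proof. by move=> [_ /(_ 0)]; under eq_fun do rewrite subr0. Qed.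

Lemma finite_valued_pettis (s : R -> V) : finite_valued s -> pettis s.
Proof.
move=> fs; split; last by move=> v; exact: (finite_valued_measurable (fun w => nrm (w - v))).
have [fin _] := fs.
have /finite_seqP[r hr] := fin.
exists (fun k => nth 0 r k) => t e e0.
exists (index (s t) r).
rewrite nth_index ?subrr ?nrm0//.
by have : range s (s t) by [exists t]; rewrite hr.
Qed.

Lemma pettis_lim (f_ : nat -> R -> V) f : (forall n, pettis (f_ n)) ->
  (forall t, f_ n t @[n --> \oo] --> f t) -> pettis f.
Proof.
move=> pf cf; split.
  have /choice[d hd] : forall n, exists d : nat -> V,
    forall t (e : R), 0 < e -> exists k, nrm (f_ n t - d k) < e by move=> n; case: (pf n).
  (* The dense sequences of all the [f_ n] are coded as a single sequence; indices that decode to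
     nothing get the harmless value 0. *)
  pose D k : V := if @unpickle (nat * nat)%type k is Some (n, j) then d n j else 0.
  exists D => t e e0.
  have /cvg_nrmP/cvgrPdist_lt/(_ (e / 2)) := cf t.
  rewrite divr_gt0// => /(_ isT)[N _ /(_ N (leqnn N))/=].
  rewrite sub0r normrN ger0_norm ?nrm_ge0// => h1.
  have [|j h2] := hd N t (e / 2); first by rewrite divr_gt0.
  exists (pickle (N, j)); rewrite /D pickleK.
  rewrite (le_lt_trans (nrm_le_sub _ (f_ N t) _))// [e]splitr ltrD//.
  by rewrite nrmBC.
move=> v; apply: (@measurable_fun_cvg _ _ _ _ (fun n t => nrm (f_ n t - v))).
  by move=> n; case: (pf n) => _; apply.
by move=> t _; apply: cvg_nrm; apply: cvgB => //; exact: cvg_cst.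
Qed.

(** Greedy approximation: at step [n] the current value is replaced by [d n] wherever [d n] is
    closer to [f t]. The distance to [f t] thus decreases and is at most the distance to each [d k]
    already tried, which is small for some [k] by density. Since the sequence starts at 0, the error
    never exceeds [nrm (f t)], which later serves as a dominating function. *)
Lemma pettis_approx f : pettis f -> exists s : nat -> {fimfun R >-> V},
  [/\ forall n, simple (s n), forall t, s n t @[n --> \oo] --> f t
    & forall n t, nrm (f t - s n t) <= nrm (f t)].
Proof.
move=> [[d hd] mf].
pose s := fix s n t : V := if n is m.+1 then
  if nrm (f t - d m) < nrm (f t - s m t) then d m else s m t else 0.
have ms n : finite_valued (s n) /\ measurable_fun setT (fun t => nrm (f t - s n t)).
  elim: n => [|n [IH1 IH2]] /=.
    split; first exact: (finite_valued_comp (fun=> 0) (finite_valued_indic measurableT)).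
    exact: mf.
  pose A := [set t | nrm (f t - d n) < nrm (f t - s n t)].
  have mA : measurable A.
    rewrite -[A]setTI.
    have := measurable_fun_ltr (mf (d n)) IH2.
    move=> /(_ measurableT [set true] I).
    by congr (measurable (_ `&` _)); apply/seteqP; split=> t.
  split.
    rewrite (_ : (fun _ => _) = (fun z : bool * V => if z.1 then d n else z.2) \o
      (fun t => (t \in A, s n t))).
      by apply/finite_valued_comp/finite_valued_pair => //; exact: finite_valued_indic.
    apply/funext => t /=; case: ifPn => h; first by rewrite mem_set.
    by rewrite memNset//=; exact/negP.
  rewrite (_ : (fun _ => _) = (fun t => Num.min (nrm (f t - d n)) (nrm (f t - s n t)))).
    exact: measurable_minr.
  by apply/funext => t; rewrite minEle; case: ltgtP => //.
have dec t m n : (m <= n)%N -> nrm (f t - s n t) <= nrm (f t - s m t).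
  elim: n => [|n IH]; first by rewrite leqn0 => /eqP ->.
  rewrite leq_eqVlt => /predU1P[->//|/IH h]; apply: le_trans h => /=.
  by case: ifPn => // /ltW.
have near t n : nrm (f t - s n.+1 t) <= nrm (f t - d n) by rewrite /=; case: ltP.
have /choice[s' hs'] : forall n, exists s' : {fimfun R >-> V},
    simple s' /\ s' = s n :> (R -> V).
  by move=> n; have [s' ? ?] := finite_valued_fimfun (ms n).1; exists s'.
exists s'; split=> [n|t|n t]; first by case: (hs' n).
  under eq_fun do rewrite (hs' _).2.
  apply/cvg_nrmP/cvgrPdist_lt => e e0.
  have [k hk] := hd t e e0.
  exists k.+1 => // n /= kn; rewrite sub0r normrN ger0_norm ?nrm_ge0// nrmBC.
  exact: le_lt_trans (dec _ _ _ kn) (le_lt_trans (near _ _) hk).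
by rewrite (hs' n).2 (le_trans (dec _ 0%N _ _))//= subr0.
Qed.

End Pettis.

(** Simple approximations of [f] and [g] are paired, and [op] of such a pair is again finite-valued;
    sequential continuity of [op] then passes to the limit. *)
Lemma pettis_map2 {R : realType} {V W Z : normedModType R[i]} (op : V -> W -> Z)
    (f : R -> V) (g : R -> W) :
  (forall (s : nat -> V) (s' : nat -> W) v w, s n @[n --> \oo] --> v ->
     s' n @[n --> \oo] --> w -> op (s n) (s' n) @[n --> \oo] --> op v w) ->
  pettis f -> pettis g -> pettis (fun t => op (f t) (g t)).
Proof.
move=> cop /pettis_approx[s [ss cs _]] /pettis_approx[s' [ss' cs' _]].
apply: (@pettis_lim _ _ (fun n t => op (s n t) (s' n t))) => [n|t]; last exact: cop.
apply: finite_valued_pettis.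
exact: (finite_valued_comp (fun z => op z.1 z.2) (finite_valued_pair
  (simple_finite_valued (ss n)) (simple_finite_valued (ss' n)))).
Qed.

Definition cutoff {R : realType} {V : normedModType R[i]} (A : set R) (f : R -> V) : R -> V :=
  fun t => if t \in A then f t else 0.

Lemma pettis_cutoff {R : realType} {V : normedModType R[i]} (A : set R) (f : R -> V) :
  measurable A -> pettis f -> pettis (cutoff A f).
Proof.
move=> mA /pettis_approx[s [ss cs _]].
apply: (@pettis_lim _ _ (fun n => cutoff A (s n))) => [n|t].
  apply: finite_valued_pettis.
  have := finite_valued_pair (finite_valued_indic mA) (simple_finite_valued (ss n)).
  exact: (finite_valued_comp (fun z : bool * V => if z.1 then z.2 else 0)).
by rewrite /cutoff; case: ifPn => _; [exact: cs|exact: cvg_cst].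
Qed.

Lemma pettis_lin {R : realType} {V : normedModType R[i]} (a : R[i]) (f g : R -> V) :
  pettis f -> pettis g -> pettis (a *: f + g).
Proof.
apply: (@pettis_map2 _ _ _ _ (fun v w => a *: v + w)) => s s' v w cs cs'.
by apply: cvgD => //; apply: cvgZr.
Qed.

Lemma pettis_continuous {R : realType} {V : normedModType R[i]} (f : R -> V) :
  continuous f -> pettis f.
Proof.
move=> cf; split; last first.
  move=> v; apply: continuous_measurable_fun => t.
  by apply: cvg_nrm; apply: cvgB; [exact: cf|exact: cvg_cst].
(* By continuity the values at rational times are dense in the range. *)
pose q k : R := if @unpickle rat k is Some x then ratr x else 0.
exists (fun k => f (q k)) => t e e0.
have /cvg_nrmP/cvgrPdist_lt/(_ e e0) := cf t.
rewrite -nbhs_nearE => /nbhs_ballP[d /= d0 hd].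
have [|x /itvP hx] := @rat_in_itvoo R (t - d) (t + d); first by lra.
exists (pickle x); rewrite /q pickleK nrmBC.
have /= := hd (ratr x); rewrite sub0r normrN ger0_norm ?nrm_ge0//; apply.
have [h1 h2] : t - d < ratr x /\ ratr x < t + d by rewrite !hx.
by rewrite /ball/= ltr_norml; apply/andP; split; lra.
Qed.

Section StronglyMeasurable.
Context {R : realType}.
Local Notation mu := (@lebesgue_measure R).

Lemma ae_imply (P Q : R -> Prop) : {ae mu, forall t, P t} ->
  (forall t, P t -> Q t) -> {ae mu, forall t, Q t}.
Proof.
move=> [N [mN N0 h]] PQ; exists N; split => //.
by move=> t /= nQ; apply: h => /= /PQ.
Qed.

Lemma ae_imply2 (P Q S : R -> Prop) : {ae mu, forall t, P t} ->
  {ae mu, forall t, Q t} -> (forall t, P t -> Q t -> S t) -> {ae mu, forall t, S t}.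
Proof.
move=> hP hQ PQS; have [N [mN N0 h]] := negligibleU hP hQ; exists N; split => //.
move=> t /= nS; apply: h => /=; apply: contrapT => /not_orP[/contrapT p /contrapT q].
exact/nS/PQS.
Qed.

Section OneSpace.
Context {V : normedModType R[i]}.
Implicit Types (D : set R) (f g : R -> V).

Lemma cutoffE D f t : D t -> cutoff D f t = f t.
Proof. by move=> Dt; rewrite /cutoff mem_set. Qed.

Lemma cutoffN D f t : ~ D t -> cutoff D f t = 0.
Proof. by move=> Dt; rewrite /cutoff memNset. Qed.

Lemma pettis_strongly_measurable D f : pettis f -> strongly_measurable D f.
Proof.
by move=> /pettis_approx[s [ss cs _]]; exists s; split => //; apply: aeW => t _.
Qed.

Lemma strongly_measurable_ae D f g : {ae mu, forall t, D t -> f t = g t} ->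
  strongly_measurable D f -> strongly_measurable D g.
Proof.
move=> fg [s [ss cs]]; exists s; split => //.
by apply: (ae_imply2 fg cs) => t fgt ct Dt; rewrite -fgt//; exact: ct.
Qed.

Lemma strongly_measurable_sub D D' f : D' `<=` D ->
  strongly_measurable D f -> strongly_measurable D' f.
Proof.
move=> DD [s [ss cs]]; exists s; split => //.
by apply: (ae_imply cs) => t ct Dt; apply/ct/DD.
Qed.

(** Setting the function and its simple approximations to 0 outside [D] and on the null set of
    divergence turns an almost everywhere limit into a limit at every point, to which [pettis_lim]
    applies. *)
Lemma strongly_measurable_pettis D f : measurable D -> strongly_measurable D f ->
  exists g, [/\ pettis g, {ae mu, forall t, D t -> f t = g t}
    & forall t, ~ D t -> g t = 0].
Proof.
move=> mD [s [ss [N [mN N0 hN]]]].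
pose E := D `\` N.
have mE : measurable E by exact: measurableD.
exists (cutoff E f); split.
- apply: (@pettis_lim _ _ (fun n => cutoff E (s n))) => [n|t].
    apply: pettis_cutoff => //; apply: finite_valued_pettis.
    by have [] := simple_finite_valued (ss n).
  rewrite /cutoff; case: ifPn => [|_]; last exact: cvg_cst.
  rewrite inE => -[Dt Nt].
  by apply: contrapT => ct; apply: Nt; apply: hN => /= /(_ Dt).
- exists N; split => // t /= h; apply: contrapT => Nt; apply: h => Dt.
  by rewrite cutoffE.
- by move=> t Dt; rewrite cutoffN// => -[].
Qed.

Lemma strongly_measurable_lim D (f_ : nat -> R -> V) f : measurable D ->
  (forall n, strongly_measurable D (f_ n)) ->
  {ae mu, forall t, D t -> f_ n t @[n --> \oo] --> f t} -> strongly_measurable D f.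
Proof.
move=> mD sf cf.
have /choice[g hg] : forall n, exists g, pettis g /\ {ae mu, forall t, D t -> f_ n t = g t}.
  by move=> n; have [g [? ? _]] := strongly_measurable_pettis mD (sf n); exists g.
have : {ae mu, forall t, D t -> g n t @[n --> \oo] --> f t}.
  have aef := ae_foralln (fun n => (hg n).2); apply: (ae_imply2 cf aef) => t ct ht Dt.
  by apply: cvg_trans (ct Dt); apply: near_eq_cvg; apply: nearW => n; rewrite ht.
move=> [N [mN N0 hN]].
have mE : measurable (D `\` N) by exact: measurableD.
apply: (@strongly_measurable_ae _ (cutoff (D `\` N) f)).
  exists N; split => // t /= h; apply: contrapT => Nt; apply: h => Dt.
  by rewrite cutoffE.
apply/pettis_strongly_measurable/(@pettis_lim _ _ (fun n => cutoff (D `\` N) (g n))) => [n|t].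
  by apply: pettis_cutoff => //; case: (hg n).
rewrite /cutoff; case: ifPn => [|_]; last exact: cvg_cst.
rewrite inE => -[Dt Nt].
by apply: contrapT => ct; apply: Nt; apply: hN => /= /(_ Dt).
Qed.

Lemma strongly_measurable_lin D (a : R[i]) f g : measurable D ->
  strongly_measurable D f -> strongly_measurable D g ->
  strongly_measurable D (a *: f + g).
Proof.
move=> mD /(strongly_measurable_pettis mD)[f' [pf ff _]].
move=> /(strongly_measurable_pettis mD)[g' [pg gg _]].
apply: (@strongly_measurable_ae _ (a *: f' + g')).
  by apply: (ae_imply2 ff gg) => t h1 h2 Dt; rewrite !fctE h1// h2.
exact/pettis_strongly_measurable/pettis_lin.
Qed.

Lemma strongly_measurable_cst D (v : V) : strongly_measurable D (fun=> v).
Proof.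
by apply/pettis_strongly_measurable/pettis_continuous => t; exact: cvg_cst.
Qed.

Lemma strongly_measurableD D f g : measurable D ->
  strongly_measurable D f -> strongly_measurable D g -> strongly_measurable D (f + g).
Proof. by move=> mD sf sg; rewrite -[f]scale1r; exact: strongly_measurable_lin. Qed.

Lemma strongly_measurableZ D a f : measurable D ->
  strongly_measurable D f -> strongly_measurable D (a *: f).
Proof.
move=> mD sf; rewrite -[a *: f]addr0; apply: strongly_measurable_lin => //.
exact: strongly_measurable_cst.
Qed.

Lemma strongly_measurableB D f g : measurable D ->
  strongly_measurable D f -> strongly_measurable D g -> strongly_measurable D (f - g).
Proof.
move=> mD sf sg; apply: strongly_measurableD => //; rewrite -scaleN1r.
exact: strongly_measurableZ.
Qed.

Lemma strongly_measurable_cutoff D A f : measurable D -> measurable A ->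
  strongly_measurable (D `&` A) f -> strongly_measurable D (cutoff A f).
Proof.
move=> mD mA /strongly_measurable_pettis[|g [pg fg _]]; first exact: measurableI.
apply: (@strongly_measurable_ae _ (cutoff A g)).
  apply: (ae_imply fg) => t fgt Dt; rewrite /cutoff; case: ifPn => //.
  by rewrite inE => At; rewrite fgt.
exact/pettis_strongly_measurable/pettis_cutoff.
Qed.

Lemma strongly_measurable_continuous D f : measurable D ->
  continuous f -> strongly_measurable D f.
Proof. by move=> mD cf; exact/pettis_strongly_measurable/pettis_continuous. Qed.

End OneSpace.

(** For a simple [f] the composite is a finite sum of the functions [fun t => D t v], each cut off
    to the set where [f] takes the value [v]. Boundedness of every [D t] then carries the limit over
    simple functions. *)
Lemma strongly_measurable_app {V W : normedModType R[i]} (E : set R)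
    (D : R -> V -> W) (f : R -> V) : measurable E ->
  (forall t, E t -> bounded_linear (D t)) ->
  (forall v, strongly_measurable E (fun t => D t v)) ->
  strongly_measurable E f -> strongly_measurable E (fun t => D t (f t)).
Proof.
move=> mE bD sD [s [ss cs]].
apply: (@strongly_measurable_lim _ _ (fun n t => D t (s n t))) => //; last first.
  by apply: (ae_imply cs) => t ct Et; apply: blin_cvg; [exact: bD|exact: ct].
move=> n; have [/finite_seqP[r hr] ms] := simple_finite_valued (ss n).
pose r' := undup r.
apply: (@strongly_measurable_ae _ _
  (\sum_(v <- r') cutoff (s n @^-1` [set v]) (fun t => D t v))).
  apply: aeW => t Et; rewrite fct_sumE (bigD1_seq (s n t)) ?undup_uniq//=; last first.
    by rewrite mem_undup; have : range (s n) (s n t) by [exists t]; rewrite hr.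
  rewrite cutoffE// big1 ?addr0// => v /eqP vs.
  by rewrite cutoffN// => /= sv; apply: vs.
elim/big_rec: _ => [|v g _ sg]; first exact: strongly_measurable_cst.
apply: strongly_measurableD => //; apply: strongly_measurable_cutoff => //.
apply: strongly_measurable_sub (sD v); exact: subIsetl.
Qed.

End StronglyMeasurable.

(** * Integrals of norms of vector-valued functions *)

Section NormIntegral.
Context {R : realType} {V : normedModType R[i]}.
Local Notation mu := (@lebesgue_measure R).
Implicit Types (D : set R) (f g : R -> V).
Local Open Scope ereal_scope.

Lemma nrm_integral_ae (W : normedModType R[i]) D (f g : R -> W) : measurable D ->
  {ae mu, forall t, D t -> f t = g t} ->
  \int[mu]_(t in D) (nrm (f t))%:E = \int[mu]_(t in D) (nrm (g t))%:E.
Proof.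
move=> mD fg; apply: eq_integral_ae => //; try by move=> t _; rewrite lee_fin nrm_ge0.
by apply: (ae_imply fg) => t fgt Dt; rewrite fgt.
Qed.

Lemma le_nrm_integral D (W : normedModType R[i]) f (g : R -> W) : measurable D ->
  {ae mu, forall t, D t -> (nrm (f t) <= nrm (g t))%R} ->
  \int[mu]_(t in D) (nrm (f t))%:E <= \int[mu]_(t in D) (nrm (g t))%:E.
Proof.
move=> mD fg; apply: le_integral_ae => //; try by move=> t _; rewrite lee_fin nrm_ge0.
Qed.

Lemma le_nrm_integralD (V1 V2 : normedModType R[i]) D f (g : R -> V1) (h : R -> V2) :
  measurable D -> strongly_measurable D g -> strongly_measurable D h ->
  {ae mu, forall t, D t -> (nrm (f t) <= nrm (g t) + nrm (h t))%R} ->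
  \int[mu]_(t in D) (nrm (f t))%:E <=
  \int[mu]_(t in D) (nrm (g t))%:E + \int[mu]_(t in D) (nrm (h t))%:E.
Proof.
move=> mD /(strongly_measurable_pettis mD)[g' [pg gg _]].
move=> /(strongly_measurable_pettis mD)[h' [ph hh _]] le_gh.
rewrite (nrm_integral_ae mD gg) (nrm_integral_ae mD hh) -ge0_integralD//.
- apply: le_integral_ae => //.
  + by move=> t _; rewrite lee_fin nrm_ge0.
  + by move=> t _; rewrite lee_fin addr_ge0 ?nrm_ge0.
  + have gh' := ae_imply2 gg hh (fun t a b => conj a b).
    apply: (ae_imply2 le_gh gh') => t h1 [h2 h3] Dt.
    by rewrite lee_fin -h2// -h3// h1.
- by move=> t _; rewrite lee_fin nrm_ge0.
- by apply/measurable_EFinP; apply: measurable_funTS; exact: pettis_nrm.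
- by move=> t _; rewrite lee_fin nrm_ge0.
- by apply/measurable_EFinP; apply: measurable_funTS; exact: pettis_nrm.
Qed.

Lemma nrm_integralZ D (c : R[i]) f : measurable D -> strongly_measurable D f ->
  \int[mu]_(t in D) (nrm (c *: f t))%:E =
  (complex.Re `|c|)%:E * \int[mu]_(t in D) (nrm (f t))%:E.
Proof.
move=> mD /(strongly_measurable_pettis mD)[g [pg fg _]].
have fg' : {ae mu, forall t, D t -> c *: f t = c *: g t}.
  by apply: (ae_imply fg) => t h Dt; rewrite h.
rewrite (nrm_integral_ae mD fg') (nrm_integral_ae mD fg) -ge0_integralZl_EFin//.
- by apply: eq_integral => t _; rewrite nrmZ.
- by move=> t _; rewrite lee_fin nrm_ge0.
- by apply/measurable_EFinP; apply: measurable_funTS; exact: pettis_nrm.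
- exact: Re_norm_ge0.
Qed.

(** In the applications [u] is a norm known only up to null sets; [v n] is a measurable copy of
    [u n], and the dominated convergence theorem is applied to this copy. *)
Lemma integral_dominated0 D (u v : nat -> R -> R) (G : R -> R) : measurable D ->
  (forall n, measurable_fun D (v n)) ->
  (forall n, {ae mu, forall t, D t -> u n t = v n t}) -> measurable_fun D G ->
  \int[mu]_(t in D) (G t)%:E < +oo ->
  (forall n t, (0 <= u n t)%R) ->
  (forall n, {ae mu, forall t, D t -> (u n t <= G t)%R}) ->
  {ae mu, forall t, D t -> u n t @[n --> \oo] --> 0%R} ->
  (\int[mu]_(t in D) (u n t)%:E) @[n --> \oo] --> 0.
Proof.
move=> mD mv uv mG fG u0 domG cu.
have aeg := ae_foralln uv.
have aeG := ae_foralln domG.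
have aegG : {ae mu, forall t, D t -> forall n, (0 <= v n t <= G t)%R}.
  by apply: (ae_imply2 aeg aeG) => t h1 h2 Dt n; rewrite -h1// u0 h2.
(* [G] bounds the functions only almost everywhere and may be negative on a null set; its positive
   part has the same integral and is a legitimate dominating function. *)
pose G0 t := Num.max 0%R (G t).
have G0G : {ae mu, forall t, D t -> G0 t = G t}.
  apply: (ae_imply aegG) => t h Dt; apply/max_idPr.
  by have /andP[h0 h1] := h Dt 0%N; exact: le_trans h0 h1.
have mG0 : measurable_fun D G0 by exact: measurable_maxr.
have iG : mu.-integrable D (EFin \o G0).
  apply/integrableP; split; first exact/measurable_EFinP.
  have G00 t : 0 <= (G0 t)%:E by rewrite lee_fin le_max lexx.
  under eq_integral => t _ do rewrite /= -[`|_|%R%:E]/(`|(G0 t)%:E|) gee0_abs//.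
  apply: le_lt_trans fG; rewrite le_eqVlt; apply/orP; left; apply/eqP.
  apply: ae_eq_integral => //; [exact/measurable_EFinP..|].
  by apply: (ae_imply G0G) => t h Dt; rewrite h.
have := @dominated_convergence _ _ R mu D mD (fun n t => (v n t)%:E) (cst 0) (EFin \o G0).
have mg n : measurable_fun D (fun t => (v n t)%:E) by exact/measurable_EFinP.
move=> /(_ mg (measurable_cst _)) H.
have [|//||_ _] := H.
- apply: (ae_imply2 aeg cu) => t h1 h2 Dt.
  apply/cvg_EFin; first by apply: nearW.
  have := h2 Dt; apply: cvg_trans; apply: near_eq_cvg; apply: nearW => n /=.
  by rewrite h1.
- apply: (ae_imply2 aegG G0G) => t h h0 n Dt /=.
  by have /andP[v0 vG] := h Dt n; rewrite ger0_norm// lee_fin h0.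
rewrite integral0; apply: cvg_trans; apply: near_eq_cvg; apply: nearW => n /=.
transitivity (\int[mu]_(t in D) (Num.max 0 (v n t))%:E).
  have mm : measurable_fun D (fun t => Num.max 0%R (v n t)) by exact: measurable_maxr.
  have mm' := (@measurable_EFinP _ _ _ _ _).2 mm.
  apply: ae_eq_integral; [exact: mD|exact: mg|exact: mm'|].
  by apply: (ae_imply aegG) => t h Dt; have /andP[v0 _] := h Dt n; congr EFin; apply/esym/max_idPr.
apply: eq_integral_ae => //.
- by move=> t _; rewrite lee_fin le_max lexx.
- by move=> t _; rewrite lee_fin u0.
apply: (ae_imply2 aegG (uv n)) => t h h1 Dt; have /andP[v0 _] := h Dt n.
by rewrite h1//; congr EFin; apply/max_idPr.
Qed.

Lemma nrm_integral_dominated D (f_ : nat -> R -> V) (G : R -> R) : measurable D ->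
  (forall n, strongly_measurable D (f_ n)) -> measurable_fun D G ->
  \int[mu]_(t in D) (G t)%:E < +oo ->
  (forall n, {ae mu, forall t, D t -> (nrm (f_ n t) <= G t)%R}) ->
  {ae mu, forall t, D t -> f_ n t @[n --> \oo] --> (0%R : V)} ->
  (\int[mu]_(t in D) (nrm (f_ n t))%:E) @[n --> \oo] --> 0.
Proof.
move=> mD sf mG fG domG cf.
have /choice[g hg] : forall n, exists g, pettis g /\ {ae mu, forall t, D t -> f_ n t = g t}.
  by move=> n; have [g [? ? _]] := strongly_measurable_pettis mD (sf n); exists g.
apply: (integral_dominated0 (v := fun n t => nrm (g n t)) (G := G)) => //.
- by move=> n; apply: measurable_funTS; apply: pettis_nrm; case: (hg n).
- by move=> n; apply: (ae_imply (hg n).2) => t h Dt; rewrite h.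
- by move=> n t; rewrite nrm_ge0.
- apply: (ae_imply cf) => t h /h /cvg_nrmP; apply: cvg_trans.
  by apply: near_eq_cvg; apply: nearW => n /=; rewrite subr0.
Qed.

End NormIntegral.

(** * The Bochner integral *)

Section SimpleIntegral.
Context {R : realType} {V : normedModType R[i]}.
Local Notation mu := (@lebesgue_measure R).
Variables a b : R.

Let m (A : set R) : R := fine (mu (`[a, b] `&` A)).

Let mu_fin (A : set R) : measurable A -> (mu (`[a, b] `&` A) < +oo)%E.
Proof.
move=> mA; apply: (@le_lt_trans _ _ (mu `[a, b])).
  by apply: le_measure; rewrite ?inE//; exact: measurableI.
by rewrite lebesgue_measure_itv/=; case: ifPn => _; rewrite ?ltry// -EFinB ltry.
Qed.

Let mD (A B : set R) : measurable A -> measurable B -> A `&` B = set0 ->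
  m (A `|` B) = m A + m B.
Proof.
move=> mA mB AB; rewrite /m setIUr measureU//=; [|exact: measurableI..|].
  by rewrite fineD// ge0_fin_numE// mu_fin.
by rewrite setIACA AB setI0.
Qed.

Lemma measure_finite_valued (T : choiceType) (z : R -> T) (r : seq T) (P : set T) :
  finite_valued z -> uniq r -> (forall t, P (z t) -> z t \in r) ->
  m (z @^-1` P) = \sum_(w <- r) if w \in P then m (z @^-1` [set w]) else 0.
Proof.
move=> fz; elim: r P => [|w r IH] P /=.
  move=> _ h; rewrite big_nil (_ : z @^-1` P = set0) ?/m ?setI0 ?measure0//.
  by apply/seteqP; split => // t /h.
move=> /andP[wr ur] h; rewrite big_cons.
pose P' := P `\` [set w].
have IH' : m (z @^-1` P') = \sum_(w0 <- r) if w0 \in P then m (z @^-1` [set w0]) else 0.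
  rewrite IH//.
    rewrite big_seq [RHS]big_seq; apply: eq_bigr => v vr.
    have vw : v <> w by move=> vw; move: wr; rewrite -vw vr.
    case: ifPn => [/set_mem[Pv _]|/negP nPv]; first by rewrite mem_set.
    by case: ifPn => // /set_mem Pv; exfalso; apply: nPv; exact/mem_set.
  move=> t [Pt zw]; have := h t Pt; rewrite inE => /predU1P[|//].
  by move/zw.
rewrite -IH'; case: ifPn => [/set_mem Pw|/negP Pw].
  rewrite -mD; [|exact: finite_valued_preimage..|].
    congr m; apply/seteqP; split=> [t Pt|t [/= zw|[]//]]; last by rewrite /preimage/= zw.
    by have [zw|zw] := pselect (z t = w); [left|right].
  by apply/seteqP; split => // t [/= zw [_ /(_ zw)]].
rewrite add0r; congr m; apply/seteqP; split=> [t Pt|t []//]; split => // zw.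
by apply/Pw/mem_set; rewrite -zw.
Qed.

Lemma simple_integral_seq (s : {fimfun R >-> V}) (r : seq V) : uniq r ->
  (forall t, s t \in r) ->
  simple_integral a b s = \sum_(v <- r) (m (s @^-1` [set v]))%:C%C *: v.
Proof.
move=> ur hr; rewrite /simple_integral.
transitivity (\sum_(v \in [set` r]) (m (s @^-1` [set v]))%:C%C *: v); last first.
  exact/esym/fsbig_seq.
apply: fsbig_widen.
  by move=> _ [t _ <-] /=.
move=> v [_ vs] /=; rewrite (_ : s @^-1` [set v] = set0).
  by rewrite /m setI0 measure0 scale0r.
by apply/seteqP; split => // t /= sv; apply: vs; exists t.
Qed.

Lemma finite_valued_seq (T : choiceType) (z : R -> T) : finite_valued z ->
  exists2 r : seq T, uniq r & forall t, z t \in r.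
Proof.
move=> [/finite_seqP[r hr] _]; exists (undup r); first exact: undup_uniq.
by move=> t; rewrite mem_undup; have : range z (z t) by [exists t]; rewrite hr.
Qed.

(** Change of variables: the level sets of [s] are unions of level sets of [z], and the sum is
    regrouped accordingly. With [z] a pair of simple functions, the integrals of both components and
    of their combination become sums over one index set, whence linearity. *)
Lemma simple_integral_comp (T : choiceType) (z : R -> T) (phi : T -> V)
    (s : {fimfun R >-> V}) (r : seq T) :
  finite_valued z -> uniq r -> (forall t, z t \in r) ->
  (forall t, s t = phi (z t)) ->
  simple_integral a b s = \sum_(w <- r) (m (z @^-1` [set w]))%:C%C *: phi w.
Proof.
move=> fz ur hr hs.
pose r' := undup (map phi r).
rewrite (@simple_integral_seq s r') ?undup_uniq//; last first.
  by move=> t; rewrite mem_undup hs map_f.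
transitivity (\sum_(v <- r') \sum_(w <- r)
    if phi w == v then (m (z @^-1` [set w]))%:C%C *: phi w else 0).
  apply: eq_bigr => v _.
  rewrite (_ : s @^-1` [set v] = z @^-1` (phi @^-1` [set v])); last first.
    by apply/seteqP; split => t /=; rewrite hs.
  rewrite (measure_finite_valued fz ur) => [|t _]; last exact: hr.
  rewrite rmorph_sum/= scaler_suml; apply: eq_bigr => w _.
  have [/eqP|nw] := eqVneq (phi w) v.
    by move/eqP => <-; rewrite mem_set.
  by rewrite memNset ?scale0r//= => pw; rewrite pw eqxx in nw.
rewrite exchange_big/=; rewrite big_seq [RHS]big_seq; apply: eq_bigr => w wr.
rewrite (bigD1_seq (phi w)) ?undup_uniq ?mem_undup ?map_f//= eqxx big1 ?addr0//.
by move=> v /negbTE; rewrite eq_sym => ->.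
Qed.

Lemma simple_integral_lin (s1 s2 s3 : {fimfun R >-> V}) (c : R[i]) :
  simple s1 -> simple s2 -> (forall t, s3 t = c *: s1 t + s2 t) ->
  simple_integral a b s3 = c *: simple_integral a b s1 + simple_integral a b s2.
Proof.
move=> ss1 ss2 h3; pose z t := (s1 t, s2 t).
have fz : finite_valued z.
  by apply: finite_valued_pair; exact: simple_finite_valued.
have [r ur hr] := finite_valued_seq fz.
rewrite (@simple_integral_comp _ z (fun w => c *: w.1 + w.2) s3 r)//.
rewrite (@simple_integral_comp _ z fst s1 r)// (@simple_integral_comp _ z snd s2 r)//.
rewrite scaler_sumr -big_split; apply: eq_bigr => w _ /=.
by rewrite scalerDr !scalerA mulrC.
Qed.

Lemma nrm_simple_integral (s : {fimfun R >-> V}) : simple s ->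
  ((nrm (simple_integral a b s))%:E <= \int[mu]_(t in `[a, b]) (nrm (s t))%:E)%E.
Proof.
move=> ss; have [r ur hr] := finite_valued_seq (simple_finite_valued ss).
rewrite (simple_integral_seq ur hr).
have mab : measurable (`[a, b]%classic : set R) by [].
apply: (@le_trans _ _ (\sum_(v <- r) ((nrm v) * m (s @^-1` [set v]))%:E)%E).
  rewrite sumEFin lee_fin (le_trans (nrm_sum _ _))// ler_sum// => v _.
  by rewrite nrmZR ger0_norm 1?mulrC// fine_ge0.
rewrite [leRHS](_ : _ = \int[mu]_(t in `[a, b])
    \sum_(v <- r) ((nrm v)%:E * (\1_(s @^-1` [set v]) t)%:E))%E; last first.
  apply: eq_integral => t _; rewrite (bigD1_seq (s t) (hr t) ur) indicE mem_set// mule1.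
  rewrite big1 => [|v vs]; first by rewrite /= adde0.
  by rewrite indicE memNset ?mule0//= => sv; rewrite sv eqxx in vs.
rewrite ge0_integral_sum//=.
- apply: lee_sum => v _; rewrite ge0_integralZl_EFin ?nrm_ge0//.
  + have -> : (\int[mu]_(x in `[a, b]) (\1_(s @^-1` [set v]) x)%:E)%E =
        mu (s @^-1` [set v] `&` `[a, b]) by apply: integral_indic => //; exact: ss.
    by rewrite setIC EFinM fineK// ge0_fin_numE// mu_fin//; exact: ss.
  + by apply/measurable_EFinP; apply: measurable_indic; exact: ss.
- move=> v; apply: measurable_funeM; apply/measurable_EFinP.
  by apply: measurable_indic; exact: ss.
- by move=> v t _; rewrite mule_ge0// lee_fin ?nrm_ge0.
Qed.

End SimpleIntegral.

Section Bochner.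
Context {R : realType}.
Local Notation mu := (@lebesgue_measure R).

Definition bochner_integrable {V : normedModType R[i]} (a b : R) (f : R -> V) : Prop :=
  strongly_measurable `[a, b] f /\ (\int[mu]_(t in `[a, b]) (nrm (f t))%:E < +oo)%E.

Section HasIntegral.
Context {V : normedModType R[i]}.
Implicit Types (f g : R -> V) (s : nat -> {fimfun R >-> V}).
Variables a b : R.
Let mab : measurable (`[a, b]%classic : set R). Proof. by []. Qed.

Lemma has_bochner_sm f v : has_bochner_integral a b f v -> strongly_measurable `[a, b] f.
Proof. by move=> [s [ss cs _ _]]; exists s; split. Qed.

Lemma simple_integral_sub s s' n m : (forall n, simple (s n)) ->
  (forall n, simple (s' n)) ->
  ((nrm (simple_integral a b (s n) - simple_integral a b (s' m)))%:E <=
    \int[mu]_(t in `[a, b]) (nrm (s n t - s' m t))%:E)%E.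
Proof.
move=> ss ss'.
have fz : finite_valued (fun t => s n t - s' m t).
  exact: (finite_valued_comp (fun z => z.1 - z.2) (finite_valued_pair
    (simple_finite_valued (ss n)) (simple_finite_valued (ss' m)))).
have [d sd de] := finite_valued_fimfun fz.
rewrite (_ : _ - _ = simple_integral a b d).
  by rewrite (le_trans (nrm_simple_integral _ _ sd))// de.
apply/eqP; rewrite subr_eq -[X in X + _]scale1r; apply/eqP.
by apply: simple_integral_lin => // t; rewrite de scale1r subrK.
Qed.

(** One estimate with two uses: for two approximating sequences of the same [f] it gives uniqueness
    of the integral, and for [s' = s] it is the Cauchy criterion behind existence. *)
Lemma simple_integral_cvg f s s' : (forall n, simple (s n)) ->
  (forall n, simple (s' n)) -> strongly_measurable `[a, b] f ->
  (\int[mu]_(t in `[a, b]) (nrm (f t - s n t))%:E)%E @[n --> \oo] --> 0%E ->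
  (\int[mu]_(t in `[a, b]) (nrm (f t - s' n t))%:E)%E @[n --> \oo] --> 0%E ->
  forall e : R, 0 < e -> exists N, forall n m, (N <= n)%N -> (N <= m)%N ->
    nrm (simple_integral a b (s n) - simple_integral a b (s' m)) <= e.
Proof.
move=> ss ss' sf cs cs' e e0.
have e2 : 0 < e / 2 by rewrite divr_gt0.
have N0 (r : nat -> {fimfun R >-> V}) n :
    (0 <= \int[mu]_(t in `[a, b]) (nrm (f t - r n t))%:E)%E.
  by apply: integral_ge0 => t _; rewrite lee_fin nrm_ge0.
have [N hN] := (cvge0P (N0 s)).1 cs _ e2.
have [N' hN'] := (cvge0P (N0 s')).1 cs' _ e2.
exists (maxn N N') => n m; rewrite !geq_max => /andP[n1 _] /andP[_ m2].
rewrite -lee_fin (le_trans (simple_integral_sub _ _ ss ss'))//.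
have sms (r : {fimfun R >-> V}) : simple r -> strongly_measurable `[a, b] r.
  by move=> sr; exact/pettis_strongly_measurable/finite_valued_pettis/simple_finite_valued.
rewrite [e]splitr EFinD.
apply: (@le_trans _ _ (\int[mu]_(t in `[a, b]) (nrm (f t - s n t))%:E +
  \int[mu]_(t in `[a, b]) (nrm (f t - s' m t))%:E)%E); last first.
  by apply: leeD; [exact: hN|exact: hN'].
apply: (le_nrm_integralD (g := f - s n) (h := f - s' m)) => //.
- by apply: strongly_measurableB => //; exact: sms.
- by apply: strongly_measurableB => //; exact: sms.
- by apply: aeW => t _; rewrite -[nrm ((f - s n) t)]nrmN !fctE opprB nrm_le_sub.
Qed.

Lemma has_bochner_unique f v w : has_bochner_integral a b f v ->
  has_bochner_integral a b f w -> v = w.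
Proof.
move=> hv; have sf := has_bochner_sm hv; move: hv.
move=> [s [ss _ is1 cv]] [s' [ss' _ is2 cw]].
have h := simple_integral_cvg ss ss' sf is1 is2.
apply: subr0_eq; apply: nrm_eq0; apply/eqP; rewrite eq_le nrm_ge0 andbT.
apply/ler_addgt0Pr => e e0; rewrite add0r.
have /cvg_nrm cvw : (simple_integral a b (s n) - simple_integral a b (s' n))
    @[n --> \oo] --> v - w by exact: cvgB.
have [N hN] := h e e0.
by apply: (cvg_le_lim (N := N) cvw) => n Nn; exact: hN.
Qed.

Lemma bochner_val f v : has_bochner_integral a b f v -> bochner a b f = v.
Proof. by move=> hv; apply: xget_unique => // w hw; exact: (has_bochner_unique hw hv). Qed.

Lemma has_bochner_ae f g v : {ae mu, forall t, t \in `[a, b] -> f t = g t} ->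
  has_bochner_integral a b f v -> has_bochner_integral a b g v.
Proof.
move=> fg [s [ss cs is1 cv]]; exists s; split => //.
  by apply: (ae_imply2 fg cs) => t h1 h2 tab; rewrite -h1//; exact: h2.
apply: cvg_trans is1; apply: near_eq_cvg; apply: nearW => n.
by apply: nrm_integral_ae => //; apply: (ae_imply fg) => t h tab; rewrite h.
Qed.

Lemma bochner_ae f g : {ae mu, forall t, t \in `[a, b] -> f t = g t} ->
  bochner a b f = bochner a b g.
Proof.
move=> fg; rewrite /bochner; congr xget; apply/seteqP; split=> v /=.
  exact: has_bochner_ae.
by apply: has_bochner_ae; apply: (ae_imply fg) => t h /h.
Qed.

Lemma has_bochner_lin f g v w (c : R[i]) : has_bochner_integral a b f v ->
  has_bochner_integral a b g w ->
  has_bochner_integral a b (fun t => c *: f t + g t) (c *: v + w).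
Proof.
move=> hf hg; have smf := has_bochner_sm hf; have smg := has_bochner_sm hg.
move: hf hg => [s [ss cs is1 cv]] [s' [ss' cs' is2 cw]].
have fz n : finite_valued (fun t => c *: s n t + s' n t).
  exact: (finite_valued_comp (fun z => c *: z.1 + z.2) (finite_valued_pair
    (simple_finite_valued (ss n)) (simple_finite_valued (ss' n)))).
have /choice[u hu] : forall n, exists u : {fimfun R >-> V},
    simple u /\ (u = (fun t => c *: s n t + s' n t) :> (R -> V)).
  by move=> n; have [u ? ?] := finite_valued_fimfun (fz n); exists u.
have sms (r : {fimfun R >-> V}) : simple r -> strongly_measurable `[a, b] r.
  by move=> sr; exact/pettis_strongly_measurable/finite_valued_pettis/simple_finite_valued.
exists u; split.
- by move=> n; case: (hu n).
- apply: (ae_imply2 cs cs') => t h1 h2 tab.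
  under eq_fun do rewrite (hu _).2.
  by apply: cvgD; [apply: cvgZr; exact: h1|exact: h2].
- pose C := complex.Re `|c|.
  apply: (@squeeze_cvge _ _ _ _ (fun=> 0%E) _ (fun n =>
    C%:E * \int[mu]_(t in `[a, b]) (nrm (f t - s n t))%:E +
    \int[mu]_(t in `[a, b]) (nrm (g t - s' n t))%:E)%E).
  + apply: nearW => n; apply/andP; split.
      by apply: integral_ge0 => t _; rewrite lee_fin nrm_ge0.
    rewrite -(@nrm_integralZ _ _ _ c (f - s n))//; last first.
      by apply: strongly_measurableB => //; exact: sms.
    apply: (le_nrm_integralD (g := c *: (f - s n)) (h := g - s' n)) => //.
    * apply: strongly_measurableZ => //; apply: strongly_measurableB => //; exact: sms.
    * apply: strongly_measurableB => //; exact: sms.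
    * apply: aeW => t _; apply: le_trans (nrmD _ _).
      by rewrite (hu n).2 !fctE scalerBr opprD addrACA.
  + exact: cvg_cst.
  + rewrite -[X in _ --> X]adde0 -[X in _ --> (X + _)%E](mule0 C%:E).
    by apply: cvgeD => //; apply: cvgeZl.
- rewrite (_ : (fun n => _) = (fun n => c *: simple_integral a b (s n) + simple_integral a b (s' n))).
    by apply: cvgD => //; apply: cvgZr.
  apply/funext => n; apply: simple_integral_lin => // t.
  by rewrite (hu n).2.
Qed.

Lemma has_bochnerD f g v w : has_bochner_integral a b f v ->
  has_bochner_integral a b g w ->
  has_bochner_integral a b (fun t => f t + g t) (v + w).
Proof.
move=> hf hg; have := has_bochner_lin 1 hf hg; rewrite scale1r.
by under eq_fun do rewrite scale1r.
Qed.

Lemma nrm_has_bochner f v : has_bochner_integral a b f v ->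
  ((nrm v)%:E <= \int[mu]_(t in `[a, b]) (nrm (f t))%:E)%E.
Proof.
move=> hf; have smf := has_bochner_sm hf; move: hf => [s [ss cs is1 cv]].
have sms (r : {fimfun R >-> V}) : simple r -> strongly_measurable `[a, b] r.
  by move=> sr; exact/pettis_strongly_measurable/finite_valued_pettis/simple_finite_valued.
have cu : (\int[mu]_(t in `[a, b]) (nrm (f t))%:E +
    \int[mu]_(t in `[a, b]) (nrm (f t - s n t))%:E)%E @[n --> \oo] -->
    (\int[mu]_(t in `[a, b]) (nrm (f t))%:E)%E.
  rewrite -[X in _ --> X]adde0; apply: cvgeD => //; last exact: cvg_cst.
  by rewrite fin_num_adde_defl.
have cw : (nrm (simple_integral a b (s n)))%:E @[n --> \oo] --> (nrm v)%:E.
  by apply/cvg_EFin; [exact: nearW|exact: cvg_nrm].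
apply: lee_cvg_to cw cu _; apply: nearW => n.
apply: le_trans (nrm_simple_integral _ _ (ss n)) _.
apply: (le_nrm_integralD (g := f) (h := f - s n)) => //.
- by apply: strongly_measurableB => //; exact: sms.
- apply: aeW => t _; rewrite -[nrm ((f - s n) t)]nrmN !fctE opprB.
  by apply: le_trans (nrmD _ _); rewrite addrC subrK.
Qed.

Lemma has_bochner_cst v : a <= b ->
  has_bochner_integral a b (fun _ : R => v) ((b - a)%:C%C *: v : V).
Proof.
move=> ab.
have fz : finite_valued (fun _ : R => v).
  exact: (finite_valued_comp (fun=> v) (finite_valued_indic (@measurableT _ R))).
have [u su ue] := finite_valued_fimfun fz.
exists (fun=> u); split => //.
- by apply: aeW => t _; rewrite ue; exact: cvg_cst.
- rewrite ue; under eq_fun do under eq_integral do rewrite subrr nrm0.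
  by rewrite integral0; exact: cvg_cst.
rewrite (@simple_integral_seq _ _ a b u [:: v])//; last by move=> t; rewrite ue inE.
rewrite big_seq1 (_ : u @^-1` [set v] = setT) ?setIT; last first.
  by apply/seteqP; split => // t _ /=; rewrite /preimage/= ue.
rewrite lebesgue_measure_itv/= lte_fin.
move: ab; rewrite le_eqVlt => /predU1P[->|ab].
  by rewrite ltxx subrr; exact: cvg_cst.
by rewrite ab -EFinB/=; exact: cvg_cst.
Qed.

End HasIntegral.

Lemma has_bochner_blin {V W : normedModType R[i]} (A : V -> W) a b (f : R -> V) v :
  bounded_linear A -> has_bochner_integral a b f v ->
  has_bochner_integral a b (fun t => A (f t)) (A v).
Proof.
move=> bA [s [ss cs is1 cv]].
have fz n : finite_valued (fun t => A (s n t)).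
  exact: (finite_valued_comp A (simple_finite_valued (ss n))).
have /choice[u hu] : forall n, exists u : {fimfun R >-> W},
    simple u /\ (u = (fun t => A (s n t)) :> (R -> W)).
  by move=> n; have [u ? ?] := finite_valued_fimfun (fz n); exists u.
have [k k0 hk] := blin_bound bA.
exists u; split.
- by move=> n; case: (hu n).
- apply: (ae_imply cs) => t h1 tab.
  by under eq_fun do rewrite (hu _).2; apply: blin_cvg => //; exact: h1.
- apply: (@squeeze_cvge _ _ _ _ (fun=> 0%E) _ (fun n =>
    (complex.Re `|k%:C%C|)%:E * \int[mu]_(t in `[a, b]) (nrm (f t - s n t))%:E)%E).
  + apply: nearW => n; apply/andP; split.
      by apply: integral_ge0 => t _; rewrite lee_fin nrm_ge0.
    have mab : measurable (`[a, b]%classic : set R) by [].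
    have smf : strongly_measurable `[a, b] f by exists s.
    rewrite -(@nrm_integralZ _ _ _ k%:C%C (f - s n))//; last first.
      apply: strongly_measurableB => //.
      exact/pettis_strongly_measurable/finite_valued_pettis/simple_finite_valued.
    apply: le_nrm_integral => //; apply: aeW => t _.
    by rewrite (hu n).2 -(blinB bA) nrmZR ger0_norm ?hk.
  + exact: cvg_cst.
  + by rewrite -[X in _ --> X](mule0 (complex.Re `|k%:C%C|)%:E); apply: cvgeZl.
rewrite (_ : (fun n => _) = (fun n => A (simple_integral a b (s n)))).
  exact: blin_cvg.
apply/funext => n; have [r ur hr] := finite_valued_seq (simple_finite_valued (ss n)).
rewrite (simple_integral_comp a b (phi := A) (simple_finite_valued (ss n)) ur hr).
  rewrite (simple_integral_seq a b ur hr) (blin_sum bA).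
  by apply: eq_bigr => v' _; rewrite (blinZ bA).
by move=> t; rewrite (hu n).2.
Qed.

Lemma has_bochner_cutoff {V : normedModType R[i]} a b c d (f : R -> V) v :
  a <= c -> d <= b -> has_bochner_integral c d f v ->
  has_bochner_integral a b (cutoff `[c, d] f) v.
Proof.
move=> ac db [s [ss cs is1 cv]].
have mcd : measurable (`[c, d]%classic : set R) by [].
have cdab t : t \in `[c, d] -> t \in `[a, b].
  by rewrite !in_itv/= => /andP[h1 h2]; rewrite (le_trans ac h1) (le_trans h2 db).
have fz n : finite_valued (cutoff `[c, d] (s n)).
  have h := finite_valued_pair (finite_valued_indic mcd) (simple_finite_valued (ss n)).
  exact: (finite_valued_comp (fun z : bool * V => if z.1 then z.2 else 0) h).
have /choice[u hu] : forall n, exists u : {fimfun R >-> V},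
    simple u /\ (u = cutoff `[c, d] (s n) :> (R -> V)).
  by move=> n; have [u ? ?] := finite_valued_fimfun (fz n); exists u.
exists u; split.
- by move=> n; case: (hu n).
- apply: (ae_imply cs) => t h1 tab; under eq_fun do rewrite (hu _).2.
  rewrite /cutoff; case: ifPn => [/set_mem tcd|_]; [exact: h1|exact: cvg_cst].
- apply: cvg_trans is1; apply: near_eq_cvg; apply: nearW => n.
  rewrite [LHS]integral_mkcond [RHS]integral_mkcond; apply: eq_integral => t _.
  rewrite /patch (hu n).2 /cutoff; have [/set_mem tcd|tcd] := boolP (t \in `[c, d]%classic).
    by rewrite mem_set//; exact: cdab.
  by rewrite subrr nrm0; case: ifPn.
apply: cvg_trans cv; apply: near_eq_cvg; apply: nearW => n.
have [r ur hr] := finite_valued_seq (simple_finite_valued (ss n)).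
(* The cutoff takes the value 0 outside [[c, d]], so 0 is added to the list of values. Its level set
   changes, but its term vanishes in both sums; all other level sets agree. *)
have ur' := undup_uniq (0 :: r).
rewrite (simple_integral_seq c d (r := undup (0 :: r)))//; last first.
  by move=> t; rewrite mem_undup inE hr orbT.
rewrite (simple_integral_seq a b (r := undup (0 :: r)))//; last first.
  move=> t; rewrite mem_undup (hu n).2 /cutoff inE.
  by case: ifPn; rewrite ?hr ?orbT ?eqxx.
apply: eq_bigr => w _; have [->|w0] := eqVneq w 0; first by rewrite !scaler0.
congr ((fine (mu _))%:C%C *: _); apply/seteqP; split => t /= [t1 t2].
  by split; [exact: cdab|rewrite (hu n).2 cutoffE].
move: t2; rewrite (hu n).2 /cutoff; case: ifPn => [/set_mem tcd|_] //.
by move=> w0'; rewrite -w0' eqxx in w0.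
Qed.

Section Existence.
Context {V : completeNormedModType R[i]}.
Implicit Types (f g : R -> V).
Variables a b : R.
Let mab : measurable (`[a, b]%classic : set R). Proof. by []. Qed.

Lemma bochner_integrable_ex f : bochner_integrable a b f ->
  has_bochner_integral a b f (bochner a b f).
Proof.
move=> [smf fin]; suff [v hv] : exists v, has_bochner_integral a b f v.
  by rewrite (bochner_val hv).
have [g [pg fg _]] := strongly_measurable_pettis mab smf.
rewrite (nrm_integral_ae mab fg) in fin.
have [s [ss cs ls]] := pettis_approx pg.
have sms (r : {fimfun R >-> V}) : simple r -> strongly_measurable `[a, b] r.
  by move=> sr; exact/pettis_strongly_measurable/finite_valued_pettis/simple_finite_valued.
have smg : strongly_measurable `[a, b] g by exact: pettis_strongly_measurable.
have is1 : (\int[mu]_(t in `[a, b]) (nrm (g t - s n t))%:E)%E @[n --> \oo] --> 0%E.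
  (* The error of the greedy approximation is at most [nrm (g t)], which is integrable; this makes
     the integrals of [s n] a Cauchy sequence in the complete space [V]. *)
  apply: (nrm_integral_dominated (f_ := fun n => g - s n) (G := fun t => nrm (g t))) => //.
  - by move=> n; apply: strongly_measurableB => //; exact: sms.
  - by apply: measurable_funTS; exact: pettis_nrm.
  - by move=> n; apply: aeW => t _; exact: ls.
  - apply: aeW => t _; rewrite -[X in _ --> X](subrr (g t)).
    by apply: cvgB; [exact: cvg_cst|exact: cs].
have [|v hv] := @nrm_cauchy_cvg _ _ (fun n => simple_integral a b (s n)).
  move=> e e0; have [|N hN] := simple_integral_cvg ss ss smg is1 is1 (e := e / 2).
    by rewrite divr_gt0.
  exists N => m n Nm Nn; apply: le_lt_trans (hN _ _ Nm Nn) _.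
  by rewrite ltr_pdivrMr// ltr_pMr// ltr1n.
exists v; exists s; split => //.
  by apply: (ae_imply fg) => t h tab; rewrite h//; exact: cs.
apply: cvg_trans is1; apply: near_eq_cvg; apply: nearW => n.
by apply: nrm_integral_ae => //; apply: (ae_imply fg) => t h tab; rewrite h.
Qed.

End Existence.
End Bochner.

Section BochnerTheory.
Context {R : realType} {V : completeNormedModType R[i]}.
Local Notation mu := (@lebesgue_measure R).
Implicit Types (f g : R -> V) (a b c d : R).

Lemma bochner_integrableP a b f : bochner_integrable a b f ->
  has_bochner_integral a b f (bochner a b f).
Proof. exact: bochner_integrable_ex. Qed.

Lemma nrm_bochner a b f : bochner_integrable a b f ->
  ((nrm (bochner a b f))%:E <= \int[mu]_(t in `[a, b]) (nrm (f t))%:E)%E.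
Proof. by move=> /bochner_integrable_ex/nrm_has_bochner. Qed.

Lemma bochner_integrable_le a b (W : normedModType R[i]) f (g : R -> W) :
  strongly_measurable `[a, b] f -> bochner_integrable a b g ->
  {ae mu, forall t, `[a, b]%classic t -> nrm (f t) <= nrm (g t)} ->
  bochner_integrable a b f.
Proof.
by move=> sf [_ ig] fg; split => //; apply: le_lt_trans ig; exact: le_nrm_integral.
Qed.

Lemma bochner_integrable_lin a b (k : R[i]) f g : bochner_integrable a b f ->
  bochner_integrable a b g -> bochner_integrable a b (fun t => k *: f t + g t).
Proof.
move=> [sf If] [sg Ig]; split; first exact: strongly_measurable_lin.
apply: (@le_lt_trans _ _ (\int[mu]_(t in `[a, b]) (nrm (k *: f t))%:E +
  \int[mu]_(t in `[a, b]) (nrm (g t))%:E)%E).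
  apply: (le_nrm_integralD (g := k *: f)) => //; first exact: strongly_measurableZ.
  by apply: aeW => t _; exact: nrmD.
by rewrite nrm_integralZ// lte_add_pinfty// lte_mul_pinfty ?lee_fin ?Re_norm_ge0.
Qed.

Lemma bochner_lin a b (k : R[i]) f g : bochner_integrable a b f ->
  bochner_integrable a b g ->
  bochner a b (fun t => k *: f t + g t) = k *: bochner a b f + bochner a b g.
Proof.
move=> /bochner_integrableP hf /bochner_integrableP hg.
exact/bochner_val/has_bochner_lin.
Qed.

Lemma bochnerB a b f g : bochner_integrable a b f -> bochner_integrable a b g ->
  bochner a b (fun t => f t - g t) = bochner a b f - bochner a b g.
Proof.
move=> hf hg; have e : (fun t => f t - g t) = (fun t => -1 *: g t + f t).
  by apply/funext => t; rewrite scaleN1r addrC.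
by rewrite e (bochner_lin (-1) hg hf) scaleN1r addrC.
Qed.

Lemma bochner_integrableB a b f g : bochner_integrable a b f ->
  bochner_integrable a b g -> bochner_integrable a b (fun t => f t - g t).
Proof.
move=> hf hg; have := bochner_integrable_lin (-1) hg hf.
by under eq_fun do rewrite scaleN1r addrC.
Qed.

Lemma bochner_integrable_sub a b c d f : a <= c -> d <= b ->
  bochner_integrable a b f -> bochner_integrable c d f.
Proof.
move=> ac db [sf If].
have cdab : `[c, d]%classic `<=` (`[a, b]%classic : set R).
  by move=> t /=; rewrite !in_itv/= => /andP[h1 h2]; rewrite (le_trans ac h1) (le_trans h2 db).
split; first exact: strongly_measurable_sub cdab sf.
apply: le_lt_trans If.
have [g [pg fg _]] : exists g, [/\ pettis g,
    {ae mu, forall t, `[a, b]%classic t -> f t = g t} & forall t, ~ `[a, b]%classic t -> g t = 0].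
  exact: strongly_measurable_pettis.
have fg' : {ae mu, forall t, `[c, d]%classic t -> f t = g t}.
  by apply: (ae_imply fg) => t h /cdab.
rewrite (nrm_integral_ae _ fg)// (nrm_integral_ae _ fg')//.
apply: ge0_subset_integral => //.
- by apply/measurable_EFinP; apply: measurable_funTS; exact: pettis_nrm.
- by move=> t _; rewrite lee_fin nrm_ge0.
Qed.

Lemma bochner_cutoff a b c d f : a <= c -> d <= b -> bochner_integrable c d f ->
  bochner a b (cutoff `[c, d] f) = bochner c d f.
Proof.
move=> ac db /bochner_integrableP hf; apply: bochner_val; exact: has_bochner_cutoff.
Qed.

Lemma bochner_split a b c f : a <= c -> c <= b -> bochner_integrable a b f ->
  bochner a b f = bochner a c f + bochner c b f.
Proof.
move=> ac cb If.
have /bochner_integrableP hac := bochner_integrable_sub (lexx a) cb If.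
have /bochner_integrableP hcb := bochner_integrable_sub ac (lexx b) If.
apply: bochner_val.
have h := has_bochnerD (has_bochner_cutoff (lexx a) cb hac) (has_bochner_cutoff ac (lexx b) hcb).
apply: has_bochner_ae h.
(* Both cutoffs keep the value at [c], so their sum counts it twice there; a single point is
   null. *)
exists [set c]; split => //; first exact: lebesgue_measure_set1.
move=> t /= h; apply: contrapT => tc; apply: h; rewrite !in_itv/= => /andP[ta tb].
rewrite /cutoff; have [tlc|clt|//] := ltgtP t c.
  rewrite mem_set ?memNset ?addr0//= in_itv/= ?ta ?(ltW tlc)//.
  by rewrite leNgt tlc.
rewrite memNset ?mem_set ?add0r//= in_itv/= ?tb ?(ltW clt)//.
by rewrite (leNgt t c) clt andbF.
Qed.

Lemma bochner_le a b f (G : R -> R) (k : R) : strongly_measurable `[a, b] f ->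
  {ae mu, forall t, `[a, b]%classic t -> nrm (f t) <= G t} ->
  (forall t, 0 <= G t) ->
  (\int[mu]_(t in `[a, b]) (G t)%:E <= k%:E)%E ->
  bochner_integrable a b f /\ nrm (bochner a b f) <= k.
Proof.
move=> sf fG G0 Gk.
have le : (\int[mu]_(t in `[a, b]) (nrm (f t))%:E <= k%:E)%E.
  apply: le_trans Gk; apply: le_integral_ae => //.
  - by move=> t _; rewrite lee_fin nrm_ge0.
  - by move=> t _; rewrite lee_fin G0.
have If : bochner_integrable a b f by split => //; apply: le_lt_trans le _; rewrite ltry.
by split => //; rewrite -lee_fin (le_trans (nrm_bochner If)).
Qed.

Lemma integral_cst_itv a b (k : R) : a <= b ->
  (\int[mu]_(t in `[a, b]) k%:E = (k * (b - a))%:E)%E.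
Proof.
move=> ab; rewrite integral_cst//= lebesgue_measure_itv/= lte_fin.
move: ab; rewrite le_eqVlt => /predU1P[->|ab]; first by rewrite ltxx subrr mule0 mulr0.
by rewrite ab -EFinB EFinM.
Qed.

Lemma bochner_bound a b f (k : R) : a <= b -> 0 <= k -> strongly_measurable `[a, b] f ->
  {ae mu, forall t, `[a, b]%classic t -> nrm (f t) <= k} ->
  bochner_integrable a b f /\ nrm (bochner a b f) <= k * (b - a).
Proof.
move=> ab k0 sf fk; apply: (bochner_le (G := fun=> k)) => //.
by rewrite integral_cst_itv.
Qed.

Lemma bochner_cst a b (v : V) : a <= b -> bochner a b (fun=> v) = (b - a)%:C%C *: v.
Proof. by move=> ab; apply: bochner_val; exact: has_bochner_cst. Qed.

(** Quantitative form of the fundamental theorem of calculus: with [v] the limit of the integrand at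
    an endpoint, it turns continuity into convergence of the means over short windows. *)
Lemma bochner_mean a b f (v : V) (k : R) : a <= b -> strongly_measurable `[a, b] f ->
  (forall t, a <= t <= b -> nrm (f t - v) <= k) ->
  nrm (bochner a b f - (b - a)%:C%C *: v) <= k * (b - a).
Proof.
move=> ab sf fk.
have k0 : 0 <= k by apply: le_trans (fk a _); rewrite ?nrm_ge0// lexx.
have sc : strongly_measurable `[a, b] (fun _ : R => v) by exact: strongly_measurable_cst.
have sfv : strongly_measurable `[a, b] (fun t => f t - v) by exact: strongly_measurableB.
have [|Ifv le] := bochner_bound ab k0 sfv.
  by apply: aeW => t /=; rewrite in_itv/=; exact: fk.
have [|Ic _] := bochner_bound ab (nrm_ge0 v) sc; first exact: aeW.
have If : bochner_integrable a b f.
  have := bochner_integrable_lin 1 Ifv Ic.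
  by under eq_fun do rewrite scale1r subrK.
by rewrite -(bochner_cst v ab) -bochnerB.
Qed.

End BochnerTheory.

Lemma bochner_blin {R : realType} {V W : completeNormedModType R[i]} (A : V -> W)
    (a b : R) (f : R -> V) : bounded_linear A -> bochner_integrable a b f ->
  bochner a b (fun t => A (f t)) = A (bochner a b f).
Proof. by move=> bA /bochner_integrableP hf; apply: bochner_val; exact: has_bochner_blin. Qed.

(** * Integrals of exponentials *)

Section ExponentialIntegrals.
Context {R : realType}.
Local Notation mu := (@lebesgue_measure R).

Lemma is_derive_expR_affine (c d x : R) :
  is_derive x 1 (fun t => expR (c * t + d)) (c * expR (c * x + d)).
Proof.
have h : is_derive x 1 (fun t : R => c * t + d) c.
  rewrite (_ : (fun _ => _) = ((c \*: id) + cst d)) //.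
  by apply: is_derive_eq; rewrite addr0 /GRing.scale/= mulr1.
have := @is_derive1_comp R expR (fun t => c * t + d) x _ _ (is_derive_expR _) h.
by rewrite mulrC.
Qed.

Lemma continuous_expR_affine (c d : R) : continuous (fun t : R => expR (c * t + d)).
Proof.
move=> t; apply: continuous_comp; last exact: continuous_expR.
by apply: cvgD; [apply: cvgMr|exact: cvg_cst].
Qed.

Lemma continuous_derive_expR_affine (c d : R) :
  continuous (fun t : R => c * expR (c * t + d)).
Proof. by move=> t; apply: cvgMr; exact: continuous_expR_affine. Qed.

Lemma integral_expR_affine (a b c d : R) : a <= b ->
  (\int[mu]_(t in `[a, b]) (c * expR (c * t + d))%:E =
   (expR (c * b + d) - expR (c * a + d))%:E)%E.
Proof.
rewrite le_eqVlt => /predU1P[<-|ab].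
  rewrite subrr set_itv1 integral_set1//.
rewrite EFinB (@continuous_FTC2 _ _ (fun t => expR (c * t + d)))//.
- apply: continuous_subspaceT; exact: continuous_derive_expR_affine.
- split.
  + by move=> t _; have [] := is_derive_expR_affine c d t.
  + by apply/cvg_at_right_filter; exact: continuous_expR_affine.
  + by apply/cvg_at_left_filter; exact: continuous_expR_affine.
- by move=> t _; rewrite derive1E; have [_ ->] := is_derive_expR_affine c d t.
Qed.

Lemma integral_expR_affine_pinfty (a c d : R) : c < 0 ->
  (\int[mu]_(t in `[a, +oo[) (- c * expR (c * t + d))%:E = (expR (c * a + d))%:E)%E.
Proof.
move=> c0.
rewrite (@ge0_continuous_FTC2y _ _ (fun t => - expR (c * t + d)) a 0)//.
- by rewrite -EFinB sub0r opprK.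
- by move=> t _; rewrite mulr_ge0 ?expR_ge0// oppr_ge0 ltW.
- apply: continuous_subspaceT => t.
  by apply: cvgMr; exact: continuous_expR_affine.
- rewrite -oppr0; apply: cvgN.
  rewrite (_ : (fun _ => _) = (fun t => expR d * (@expR R \o -%R) (- c * t))); last first.
    by apply/funext => t; rewrite /= mulNr opprK -expRD addrC.
  rewrite -(mulr0 (expR d)); apply: cvgMr;
  apply: (@cvg_comp _ _ _ (fun t => - c * t) (@expR R \o -%R) _ (pinfty_nbhs R)); last first.
    exact: cvgr_expR.
  by apply: gt0_cvgMry; rewrite ?oppr_gt0//; exact: cvg_id.
- by apply/cvg_at_right_filter; apply: cvgN; exact: continuous_expR_affine.
- move=> t _; rewrite derive1E deriveN; last by have [] := is_derive_expR_affine c d t.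
  by have [_ ->] := is_derive_expR_affine c d t; rewrite mulNr.
Qed.

Lemma integral_expR_decay (A a c d : R) : 0 <= A -> c < 0 ->
  (\int[mu]_(t in `[a, +oo[) (A * expR (c * t + d))%:E = (A / - c * expR (c * a + d))%:E)%E.
Proof.
move=> A0 c0; have c0' : 0 < - c by rewrite oppr_gt0.
transitivity (\int[mu]_(t in `[a, +oo[) ((A / - c)%:E * (- c * expR (c * t + d))%:E))%E.
  by apply: eq_integral => t _; rewrite -EFinM mulrA divfK ?gt_eqF.
rewrite ge0_integralZl_EFin//.
- by rewrite integral_expR_affine_pinfty.
- by move=> t _; rewrite lee_fin mulr_ge0 ?expR_ge0// ltW.
- apply: measurable_funTS; apply/measurable_EFinP.
  apply: measurable_funM; first exact: measurable_cst.
  by apply: continuous_measurable_fun; exact: continuous_expR_affine.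
- by rewrite divr_ge0// ltW.
Qed.

End ExponentialIntegrals.

(** * The spaces L^p *)

Opaque integral powR poweR nrm.

Section LpTheory.
Context {R : realType}.
Local Notation mu := (@lebesgue_measure R).
Variable p : R.
Hypothesis p1 : 1 <= p.

Let p0 : 0 < p. Proof. exact: lt_le_trans p1. Qed.
Let pn0 : p != 0. Proof. by rewrite gt_eqF. Qed.
Let pV0 : p^-1 != 0. Proof. by rewrite invr_eq0. Qed.

Lemma measurable_Rplus : measurable (@Rplus R).
Proof.
rewrite (_ : Rplus = `[0, +oo[%classic) //.
by apply/seteqP; split=> t /=; rewrite in_itv/= andbT.
Qed.
Let mRp := measurable_Rplus.

Lemma poweRK_p (x : \bar R) : (0 <= x)%E -> ((x `^ p^-1) `^ p = x)%E.
Proof. by move=> x0; rewrite -poweRrM mulVf// poweRe1. Qed.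

Lemma poweRVK_p (x : \bar R) : (0 <= x)%E -> ((x `^ p) `^ p^-1 = x)%E.
Proof. by move=> x0; rewrite -poweRrM mulfV// poweRe1. Qed.

Lemma le_poweR (r : R) (x y : \bar R) : 0 <= r -> (0 <= x)%E -> (x <= y)%E ->
  (x `^ r <= y `^ r)%E.
Proof.
move=> r0 x0 xy; apply: gt0_ler_poweR => //; rewrite in_itv/= ?leey ?andbT//.
exact: le_trans xy.
Qed.

Lemma pettis_powR {V : normedModType R[i]} (g : R -> V) : pettis g ->
  measurable_fun setT (fun t => nrm (g t) `^ p).
Proof. by move=> pg; exact: (measurableT_comp (measurable_powR p) (pettis_nrm pg)). Qed.

Section OneSpace.
Context {V : normedModType R[i]}.
Implicit Types (f g h : R -> V).

Definition Lp_power f : \bar R := (\int[mu]_(t in Rplus) ((nrm (f t)) `^ p)%:E)%E.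

Lemma Lp_power_ge0 f : (0 <= Lp_power f)%E.
Proof. by apply: integral_ge0 => t _; rewrite lee_fin powR_ge0. Qed.

Lemma Lp_norm_ge0 f : (0 <= Lp_norm p f)%E.
Proof. exact: poweR_ge0. Qed.

Lemma Lp_norm_powerE f : (Lp_norm p f `^ p)%E = Lp_power f.
Proof. by rewrite poweRK_p// Lp_power_ge0. Qed.

Lemma Lp_norm_leP f (k : R) : 0 <= k ->
  (Lp_norm p f <= k%:E)%E <-> (Lp_power f <= (k `^ p)%:E)%E.
Proof.
move=> k0; split => h.
  rewrite -Lp_norm_powerE -poweR_EFin le_poweR ?Lp_norm_ge0//; exact: ltW.
rewrite -[k%:E]poweRVK_p ?lee_fin// poweR_EFin.
by rewrite le_poweR ?invr_ge0 ?Lp_power_ge0//; exact: ltW.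
Qed.

Lemma Lp_power_cst (c : R) f : 0 <= c -> strongly_measurable Rplus f ->
  (\int[mu]_(t in Rplus) (c * (nrm (f t)) `^ p)%:E = c%:E * Lp_power f)%E.
Proof.
move=> c0 /(strongly_measurable_pettis mRp)[g [pg fg _]].
rewrite /Lp_power.
have mg : measurable_fun Rplus (fun t => nrm (g t) `^ p).
  by apply: measurable_funTS; exact: pettis_powR.
transitivity (\int[mu]_(t in Rplus) (c%:E * (nrm (g t) `^ p)%:E))%E.
  apply: eq_integral_ae => //.
  - by move=> t _; rewrite lee_fin mulr_ge0 ?powR_ge0.
  - by move=> t _; rewrite mule_ge0 ?lee_fin ?powR_ge0.
  - by apply: (ae_imply fg) => t h Dt; rewrite h.
rewrite ge0_integralZl_EFin; [|by []| | |by []].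
- apply: (congr1 (fun x => c%:E * x)%E); apply: eq_integral_ae; first exact: mRp.
  + by move=> t _; rewrite lee_fin powR_ge0.
  + by move=> t _; rewrite lee_fin powR_ge0.
  + by apply: (ae_imply fg) => t h Dt; rewrite h.
- by move=> t _; rewrite lee_fin powR_ge0.
- exact/measurable_EFinP.
Qed.

Lemma Lp_power_lty f : (Lp_norm p f < +oo)%E <-> (Lp_power f < +oo)%E.
Proof.
split=> h; first by rewrite -Lp_norm_powerE; exact: poweR_lty.
exact: poweR_lty.
Qed.

End OneSpace.

Lemma Lp_norm_le (V W : normedModType R[i]) (f : R -> V) (g : R -> W) :
  {ae mu, forall t, 0 <= t -> nrm (f t) <= nrm (g t)} ->
  (Lp_norm p f <= Lp_norm p g)%E.
Proof.
move=> fg; apply: le_poweR; [by rewrite invr_ge0 ltW|exact: Lp_power_ge0|].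
apply: le_integral_ae => //.
- by move=> t _; rewrite lee_fin powR_ge0.
- by move=> t _; rewrite lee_fin powR_ge0.
apply: (ae_imply fg) => t h t0; rewrite lee_fin ge0_ler_powR ?nnegrE ?nrm_ge0//.
- exact: ltW.
- exact: h.
Qed.

Lemma Lp_norm_ae (V : normedModType R[i]) (f g : R -> V) : Lp_eq f g ->
  Lp_norm p f = Lp_norm p g.
Proof.
move=> fg; apply/eqP; rewrite eq_le; apply/andP; split; apply: Lp_norm_le.
- by apply: (ae_imply fg) => t h t0; rewrite h.
- by apply: (ae_imply fg) => t h t0; rewrite h.
Qed.

Lemma Lp_norm_Lnorm (V : normedModType R[i]) (f : R -> V) : (forall t, ~ Rplus t -> f t = 0) ->
  Lp_norm p f = Lnorm mu p%:E (EFin \o (fun t => nrm (f t))).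
Proof.
move=> f0; rewrite /Lp_norm unlock /Lnorm; apply: (congr1 (fun x => x `^ p^-1)%E).
rewrite [LHS]integral_mkcond; apply: eq_integral => t _; rewrite /patch /= ger0_norm ?nrm_ge0//.
case: ifPn => [_|/negP tR]; first by rewrite poweR_EFin.
rewrite f0 ?nrm0 ?poweR0r// => Rt; by apply: tR; rewrite inE.
Qed.

(** Minkowski's inequality is applied to the scalar functions [nrm (g t)] and [nrm (h t)], for
    representatives that are measurable and vanish at negative times; [f] enters through the
    pointwise bound alone, and the three functions may live in different spaces. *)
Lemma Lp_norm_leD (V W Z : normedModType R[i]) (f : R -> V) (g : R -> W) (h : R -> Z) :
  strongly_measurable Rplus g -> strongly_measurable Rplus h ->
  {ae mu, forall t, 0 <= t -> nrm (f t) <= nrm (g t) + nrm (h t)} ->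
  (Lp_norm p f <= Lp_norm p g + Lp_norm p h)%E.
Proof.
move=> /(strongly_measurable_pettis mRp)[g' [pg gg g0]].
move=> /(strongly_measurable_pettis mRp)[h' [ph hh h0]] le_f.
rewrite (Lp_norm_ae gg) (Lp_norm_ae hh) (Lp_norm_Lnorm g0) (Lp_norm_Lnorm h0).
apply: le_trans (minkowski_EFin _ _ _ p1); [|exact: pettis_nrm..].
rewrite [in leRHS]unlock /Lnorm /Lp_norm.
apply: le_poweR; [by rewrite invr_ge0 ltW|exact: Lp_power_ge0|].
rewrite [leLHS]integral_mkcond; apply: le_integral_ae => //.
- by move=> t _; apply: erestrict_ge0 => {}t _; rewrite lee_fin powR_ge0.
- by move=> t _; rewrite poweR_ge0.
have gh' := ae_imply2 gg hh (fun t a b => conj a b).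
apply: (ae_imply2 le_f gh') => t l [h1 h2] _; rewrite /patch; case: ifPn => [/set_mem Rt|_].
  rewrite /= lee_fin ger0_norm ?addr_ge0 ?nrm_ge0// ge0_ler_powR ?nnegrE ?addr_ge0 ?nrm_ge0//.
    exact: ltW.
  by rewrite -h1// -h2// l.
exact: poweR_ge0.
Qed.

Section LpVector.
Context {V : normedModType R[i]}.
Implicit Types (f g h : R -> V).

Lemma Lp_normD f g : strongly_measurable Rplus f -> strongly_measurable Rplus g ->
  (Lp_norm p (f + g)%R <= Lp_norm p f + Lp_norm p g)%E.
Proof. by move=> sf sg; apply: (Lp_norm_leD sf sg); apply: aeW => t _; exact: nrmD. Qed.

Lemma Lp_norm0 : Lp_norm p (0 : R -> V) = 0%E.
Proof.
rewrite /Lp_norm; under eq_integral do rewrite nrm0 powR0//.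
by rewrite integral0 poweR0r.
Qed.

Lemma Lp_normZ (a : R[i]) f : strongly_measurable Rplus f ->
  Lp_norm p (a *: f) = ((complex.Re `|a|)%:E * Lp_norm p f)%E.
Proof.
move=> sf; rewrite /Lp_norm.
under eq_integral do rewrite nrmZ (powRM _ (Re_norm_ge0 _) (nrm_ge0 _)).
rewrite Lp_power_cst ?powR_ge0// poweRM ?lee_fin ?powR_ge0 ?Lp_power_ge0//.
by rewrite -poweR_EFin poweRVK_p// lee_fin Re_norm_ge0.
Qed.

Lemma Lp_normN f : Lp_norm p (- f) = Lp_norm p f.
Proof.
by rewrite /Lp_norm; under eq_integral do rewrite opprfctE nrmN.
Qed.

Lemma Lp_lin (a : R[i]) f g : Lp p f -> Lp p g -> Lp p (a *: f + g).
Proof.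
move=> [sf nf] [sg ng]; split; first exact: strongly_measurable_lin measurable_Rplus _ _.
apply: le_lt_trans (Lp_normD _ sg) _; first exact: strongly_measurableZ.
apply: lte_add_pinfty ng; rewrite Lp_normZ//.
by apply: lte_mul_pinfty nf; rewrite ?lee_fin ?Re_norm_ge0.
Qed.

Lemma LpD f g : Lp p f -> Lp p g -> Lp p (f + g).
Proof.
move=> hf hg; have := Lp_lin 1 hf hg; congr (Lp p _).
by apply/funext => t; rewrite !fctE scale1r.
Qed.

Lemma Lp0 : Lp p (0 : R -> V).
Proof. by split; [exact: strongly_measurable_cst|rewrite Lp_norm0 ltry]. Qed.

Lemma LpZ a f : Lp p f -> Lp p (a *: f).
Proof.
move=> hf; have := Lp_lin a hf Lp0; congr (Lp p _).
by apply/funext => t; rewrite !fctE addr0.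
Qed.

Lemma LpN f : Lp p f -> Lp p (- f).
Proof.
move=> hf; have := LpZ (-1) hf; congr (Lp p _).
by apply/funext => t; rewrite !fctE scaleN1r.
Qed.

Lemma LpB f g : Lp p f -> Lp p g -> Lp p (f - g).
Proof. by move=> hf hg; exact: (LpD hf (LpN hg)). Qed.

Lemma Lp_norm_eq0 f : strongly_measurable Rplus f -> Lp_norm p f = 0%E ->
  Lp_eq f 0.
Proof.
move=> /(strongly_measurable_pettis mRp)[g [pg fg g0]].
rewrite (Lp_norm_ae fg) Lp_norm_Lnorm// => /Lnorm_eq0_eq0.
have mg : measurable_fun setT (EFin \o (fun t => nrm (g t))).
  by apply/measurable_EFinP; exact: pettis_nrm.
move=> /(_ mg); rewrite lte_fin => /(_ p0) h.
apply: (ae_imply2 fg h) => t h1 h2 Rt; rewrite h1//.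
by apply: nrm_eq0; have := h2 I => /= -[].
Qed.

Lemma Lp_norm_dominated (f_ : nat -> R -> V) (G : R -> R) :
  (forall n, strongly_measurable Rplus (f_ n)) -> measurable_fun Rplus G ->
  (\int[mu]_(t in Rplus) (G t)%:E < +oo)%E ->
  (forall n, {ae mu, forall t, Rplus t -> nrm (f_ n t) `^ p <= G t}) ->
  {ae mu, forall t, Rplus t -> f_ n t @[n --> \oo] --> (0 : V)} ->
  Lp_norm p (f_ n) @[n --> \oo] --> 0%E.
Proof.
move=> sf mG fG domG cf.
have /choice[g hg] : forall n, exists g, pettis g /\ {ae mu, forall t, Rplus t -> f_ n t = g t}.
  by move=> n; have [g [? ? _]] := strongly_measurable_pettis mRp (sf n); exists g.
have : (\int[mu]_(t in Rplus) (nrm (f_ n t) `^ p)%:E)%E @[n --> \oo] --> 0%E.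
  apply: (integral_dominated0 (v := fun n t => nrm (g n t) `^ p) (G := G)) => //.
  - move=> n; apply: measurable_funTS; apply: pettis_powR.
    by case: (hg n).
  - by move=> n; apply: (ae_imply (hg n).2) => t h Dt; rewrite h.
  - by move=> n t; rewrite powR_ge0.
  - apply: (ae_imply cf) => t h /h /cvg_nrmP ct.
    have {}ct : nrm (f_ n t) @[n --> \oo] --> (0 : R).
      by apply: cvg_trans ct; apply: near_eq_cvg; apply: nearW => n /=; rewrite subr0.
    apply/cvgr0P => [n|e e0]; first exact: powR_ge0.
    have [N hN] := (cvgr0P (fun n => nrm_ge0 _)).1 ct (e `^ p^-1) (powR_gt0 _ e0).
    exists N => n Nn; rewrite -[e]powRr1 ?(ltW e0)// -(mulVf pn0) powRrM.
    by rewrite ge0_ler_powR ?nnegrE ?nrm_ge0 ?powR_ge0 ?(ltW p0)// hN.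
have I0 n : (0 <= \int[mu]_(t in Rplus) (nrm (f_ n t) `^ p)%:E)%E by exact: Lp_power_ge0.
move=> /(cvge0P I0) h; apply/cvge0P => [n|e e0]; first exact: Lp_norm_ge0.
have [N hN] := h _ (powR_gt0 p e0).
by exists N => n Nn; apply/Lp_norm_leP; [exact: ltW|exact: hN].
Qed.

End LpVector.

Lemma Lp_bochner_integrable {V : normedModType R[i]} (f : R -> V) (a b : R) :
  0 <= a -> Lp p f -> bochner_integrable a b f.
Proof.
move=> a0 [sf /Lp_power_lty nf].
have abR : `[a, b]%classic `<=` (@Rplus R).
  by move=> t /=; rewrite in_itv/= => /andP[ta _]; exact: le_trans ta.
split; first exact: strongly_measurable_sub abR sf.
have [g [pg fg _]] := strongly_measurable_pettis mRp sf.
have fg' : {ae mu, forall t, `[a, b]%classic t -> f t = g t}.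
  by apply: (ae_imply fg) => t h /abR.
have mgp : measurable_fun setT (fun t => nrm (g t) `^ p).
  exact: pettis_powR.
rewrite (nrm_integral_ae _ fg')//.
apply: (@le_lt_trans _ _ (\int[mu]_(t in `[a, b]) (1%:E + (nrm (g t) `^ p)%:E))%E).
  apply: le_integral_ae => //.
  - by move=> t _; rewrite lee_fin nrm_ge0.
  - by move=> t _; rewrite lee_fin addr_ge0// powR_ge0.
  - apply: aeW => t _; rewrite lee_fin.
    have [g1|g1] := leP (nrm (g t)) 1.
      by rewrite (le_trans g1)// lerDl powR_ge0.
    by rewrite (le_trans (le1r_powR (ltW g1) p1))// lerDr.
rewrite ge0_integralD//; last 2 first.
- by move=> t _; rewrite lee_fin powR_ge0.
- by apply/measurable_EFinP; exact: measurable_funTS.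
apply: lte_add_pinfty.
  rewrite integral_cst//= mul1e lebesgue_measure_itv/=.
  by case: ifPn => _; rewrite -?EFinB ltry.
apply: le_lt_trans nf.
rewrite [leRHS](_ : _ = Lp_power g).
  apply: ge0_subset_integral => //.
  - by apply/measurable_EFinP; exact: measurable_funTS.
  - by move=> t _; rewrite lee_fin powR_ge0.
apply: eq_integral_ae => //.
- by move=> t _; rewrite lee_fin powR_ge0.
- by move=> t _; rewrite lee_fin powR_ge0.
- by apply: (ae_imply fg) => t h Dt; rewrite h.
Qed.

End LpTheory.

(** * Invariance of the Lebesgue measure under translations *)

Section Translation.
Context {R : realType}.
Local Notation mu := (@lebesgue_measure R).

Lemma lebesgue_measure_shift (h : R) (A : set R) : measurable A ->
  pushforward mu (fun x : measurableTypeR R => (x - h : measurableTypeR R)) A = mu A.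
Proof.
move=> mA; have mh : measurable_fun setT (fun x : measurableTypeR R => (x - h : measurableTypeR R)).
  by apply: measurable_funB => //; exact: measurable_id.
apply/esym/lebesgue_measure_unique => //= _ [[a b]] _ <-.
rewrite /pushforward (_ : _ @^-1` _ = `]a + h, b + h]%classic); last first.
  by apply/seteqP; split=> t; rewrite /= !in_itv/= ltrBrDr lerBlDr.
by rewrite !lebesgue_measure_itv/= !lte_fin ltrD2r -!EFinB opprD addrACA subrr addr0.
Qed.

Lemma ge0_integral_shift (h : R) (f : R -> \bar R) : measurable_fun setT f ->
  (forall t, 0 <= f t)%E ->
  (\int[mu]_(t in `[h, +oo[) f (t - h)%R = \int[mu]_(t in `[0%R, +oo[) f t)%E.
Proof.
move=> mf f0.
have mh : measurable_fun setT (fun x : measurableTypeR R => (x - h : measurableTypeR R)).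
  by apply: measurable_funB => //; exact: measurable_id.
rewrite (_ : `[h, +oo[%classic =
  (fun x : measurableTypeR R => (x - h : measurableTypeR R)) @^-1` `[0%R, +oo[%classic); last first.
  by apply/seteqP; split=> t; rewrite /= !in_itv/= !andbT subr_ge0.
have := @ge0_integral_pushforward _ _ _ _ R _ mh mu `[0%R, +oo[%classic f.
move=> <-//; last exact: measurable_funTS.
by apply: eq_measure_integral => //= A mA _; exact: lebesgue_measure_shift.
Qed.

End Translation.

(** * Schur test and density of continuous functions *)

Section Schur.
Context {R : realType}.
Local Notation mu := (@lebesgue_measure R).
Variable p : R.
Hypothesis p1 : 1 <= p.
Let p0 : 0 < p. Proof. exact: lt_le_trans p1. Qed.
Let pn0 : p != 0. Proof. by rewrite gt_eqF. Qed.

(* Tangent-line form of Young's inequality: it integrates against a kernel, and the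
   optimal [c] turns the result into Jensen's inequality. *)
Lemma young_affine (c x : R) : 0 < c -> 0 <= x ->
  x <= c * (1 - p^-1) + c `^ (1 - p) / p * x `^ p.
Proof.
move=> c0 x0.
(* The case [c = 1], from which the general one follows by scaling [x] to [x / c]. It is Young's
   inequality for the product [y * 1]; [p = 1] is separate because the conjugate exponent is then
   infinite. *)
have bern (y : R) : 0 <= y -> y <= 1 - p^-1 + y `^ p / p.
  move=> y0; move: p1; rewrite le_eqVlt => /predU1P[<-|p1'].
    by rewrite invr1 subrr add0r mulr1 powRr1.
  have q0 : 0 < 1 - p^-1 by rewrite subr_gt0 invf_lt1.
  have := @conjugate_powR R y 1 p (1 - p^-1)^-1 y0 ler01 p0.
  rewrite invr_gt0 invrK => /(_ q0); rewrite addrC subrK => /(_ erefl).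
  by rewrite mulr1 powR1 mul1r addrC.
have := bern (x / c) (divr_ge0 x0 (ltW c0)).
rewrite -(ler_pM2l c0) mulrCA divff ?gt_eqF// mulr1 => /le_trans; apply.
rewrite mulrDr lerD2l powRM ?invr_ge0 ?(ltW c0)//.
have -> : (c^-1) `^ p = c `^ (- p) by rewrite -powR_inv1 ?(ltW c0)// -powRrM mulN1r.
have -> : c `^ (1 - p) = c * c `^ (- p).
  by rewrite powRD ?(gt_eqF c0) ?implybT// powRr1// ltW.
by rewrite le_eqVlt; apply/orP; left; apply/eqP; ring.
Qed.

(** Jensen's inequality for the measure with density [k], of mass at most [a]. Integrating
    [young_affine] against [k] bounds the left integral by an expression in a free parameter
    [c > 0], which is then optimised. *)
Lemma jensen_kernel (k phi : R -> R) (a : R) : 0 < a ->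
  (forall s, 0 <= k s) -> (forall s, 0 <= phi s) ->
  measurable_fun setT k -> measurable_fun setT phi ->
  (\int[mu]_s (k s)%:E <= a%:E)%E ->
  ((\int[mu]_s (k s * phi s)%:E) `^ p <=
   (a `^ p / a)%:E * \int[mu]_s (k s * phi s `^ p)%:E)%E.
Proof.
move=> a0 k0 phi0 mk mphi ka.
set J := (\int[mu]_s (k s * phi s)%:E)%E.
set Q := (\int[mu]_s (k s * phi s `^ p)%:E)%E.
have mphip : measurable_fun setT (fun s => phi s `^ p).
  exact: (measurableT_comp (measurable_powR p) mphi).
have mkp : measurable_fun setT (fun s => k s * phi s `^ p) by exact: measurable_funM.
have J0 : (0 <= J)%E by apply: integral_ge0 => s _; rewrite lee_fin mulr_ge0.
have Q0 : (0 <= Q)%E by apply: integral_ge0 => s _; rewrite lee_fin mulr_ge0 ?powR_ge0.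
have main c : 0 < c -> (J <= (c * (1 - p^-1) * a)%:E + (c `^ (1 - p) / p)%:E * Q)%E.
  move=> c0.
  have A0 : 0 <= c * (1 - p^-1) by rewrite mulr_ge0 ?(ltW c0)// subr_ge0 invf_le1.
  have B0 : 0 <= c `^ (1 - p) / p by rewrite divr_ge0 ?powR_ge0 ?(ltW p0).
  apply: (@le_trans _ _ (\int[mu]_s ((c * (1 - p^-1))%:E * (k s)%:E +
     (c `^ (1 - p) / p)%:E * (k s * phi s `^ p)%:E))%E).
    apply: le_integral_ae; [by []|by move=> s _; rewrite lee_fin mulr_ge0| |].
      by move=> s _; rewrite lee_fin addr_ge0// mulr_ge0// mulr_ge0// powR_ge0.
    apply: aeW => s _; rewrite lee_fin.
    have := ler_wpM2l (k0 s) (young_affine c0 (phi0 s)) => /le_trans; apply.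
    by rewrite mulrDr lerD// le_eqVlt; apply/orP; left; apply/eqP; ring.
  rewrite ge0_integralD; [|by []|..]; last 4 first.
  - by move=> s _; rewrite lee_fin mulr_ge0.
  - by apply: measurable_funeM; exact/measurable_EFinP.
  - by move=> s _; rewrite lee_fin mulr_ge0// mulr_ge0// powR_ge0.
  - by apply: measurable_funeM; exact/measurable_EFinP.
  rewrite ge0_integralZl_EFin; [|by []|by move=> s _; rewrite lee_fin|exact/measurable_EFinP|by []].
  rewrite ge0_integralZl_EFin; [|by []| |exact/measurable_EFinP|by []]; last first.
    by move=> s _; rewrite lee_fin mulr_ge0// powR_ge0.
  apply: leeD2r; rewrite [in leRHS]EFinM; apply: lee_wpmul2l ka.
  by rewrite lee_fin.
have aa : 0 < a `^ p / a by rewrite divr_gt0// powR_gt0.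
have [Qoo|Qfin] := eqVneq Q +oo%E.
  by rewrite Qoo gt0_muley ?leey// lte_fin.
have Qq : Q = (fine Q)%:E by rewrite fineK// ge0_fin_numE// ltey.
have q0 : 0 <= fine Q by rewrite fine_ge0.
rewrite Qq -EFinM in main *.
have Jj : (J < +oo)%E by apply: le_lt_trans (main 1 ltr01) _; rewrite -EFinD ltry.
have JE : J = (fine J)%:E by rewrite fineK// ge0_fin_numE.
have j0 : 0 <= fine J by rewrite fine_ge0.
rewrite JE poweR_EFin lee_fin.
have {}main c : 0 < c -> fine J <= c * (1 - p^-1) * a + c `^ (1 - p) / p * fine Q.
  by move=> /main; rewrite JE -EFinM -EFinD lee_fin.
(* If the right integral is 0, the optimal [c] would be 0, which [young_affine] excludes; letting
   [c = e / a] tend to 0 gives the claim. *)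
move: q0; rewrite le_eqVlt => /predU1P[q0|q0].
  have -> : fine J = 0.
    apply/eqP; rewrite eq_le j0 andbT; apply/ler_addgt0Pr => e e0; rewrite add0r.
    apply: le_trans (main (e / a) (divr_gt0 e0 a0)) _.
    rewrite -q0 mulr0 addr0 mulrAC divfK ?gt_eqF// ler_piMr ?(ltW e0)//.
    by rewrite lerBlDr lerDl invr_ge0 ltW.
  by rewrite powR0// -q0 mulr0.
(* The minimiser: [c]^ p[is the mean of]phi [^ p] when the mass is [a], and the two terms of the
   bound then add up to [a * c]. *)
pose c := (fine Q / a) `^ p^-1.
have c0 : 0 < c by rewrite powR_gt0// divr_gt0.
have cp : c `^ p = fine Q / a.
  by rewrite -powRrM mulVf// powRr1// divr_ge0// ltW.
have le1 : fine J <= a * c.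
  apply: le_trans (main c c0) _.
  have -> : c `^ (1 - p) / p * fine Q = a * c / p.
    have -> : fine Q = a * c `^ p by rewrite cp mulrCA divff ?mulr1// gt_eqF.
    have e : c `^ (1 - p) * c `^ p = c.
      by rewrite -powRD ?(gt_eqF c0) ?implybT// subrK powRr1// ltW.
    by rewrite -[in RHS]e; ring.
  by rewrite le_eqVlt; apply/orP; left; apply/eqP; ring.
apply: le_trans (ge0_ler_powR (ltW p0) _ _ le1) _; rewrite ?nnegrE// ?mulr_ge0 ?(ltW a0) ?(ltW c0)//.
rewrite powRM ?(ltW a0) ?(ltW c0)// cp.
by rewrite le_eqVlt; apply/orP; left; apply/eqP; ring.
Qed.

Lemma schur_test (k : R -> R -> R) (phi : R -> R) (a : R) : 0 < a ->
  (forall t s, 0 <= k t s) -> (forall s, 0 <= phi s) ->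
  measurable_fun setT (fun z : R * R => k z.1 z.2) -> measurable_fun setT phi ->
  (forall t, \int[mu]_s (k t s)%:E <= a%:E)%E ->
  (forall s, \int[mu]_t (k t s)%:E <= a%:E)%E ->
  (\int[mu]_t ((\int[mu]_s (k t s * phi s)%:E) `^ p) <=
   (a `^ p)%:E * \int[mu]_s (phi s `^ p)%:E)%E.
Proof.
move=> a0 k0 phi0 mk mphi ka1 ka2.
have mkt t : measurable_fun setT (k t).
  exact: (measurableT_comp mk (pair1_measurable t)).
have mks s : measurable_fun setT (k ^~ s).
  exact: (measurableT_comp mk (pair2_measurable s)).
have mphip : measurable_fun setT (fun s => phi s `^ p).
  exact: (measurableT_comp (measurable_powR p) mphi).
have phip0 s : 0 <= phi s `^ p by exact: powR_ge0.
pose F (z : R * R) := (k z.1 z.2 * phi z.2 `^ p)%:E.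
have mF : measurable_fun setT F.
  apply/measurable_EFinP; apply: measurable_funM mk _.
  exact: (measurableT_comp mphip measurable_snd).
have F0 z : (0 <= F z)%E by rewrite lee_fin mulr_ge0.
have aa : 0 < a `^ p / a by rewrite divr_gt0// powR_gt0.
apply: (@le_trans _ _ (\int[mu]_t ((a `^ p / a)%:E * \int[mu]_s F (t, s)))%E).
  apply: le_integral_ae; first by [].
  - by move=> t _; rewrite poweR_ge0.
  - by move=> t _; apply: mule_ge0; [rewrite lee_fin ltW|apply: integral_ge0].
  by apply: aeW => t _; exact: jensen_kernel.
rewrite ge0_integralZl_EFin; [|exact: measurableT| |exact: measurable_fun_fubini_tonelli_F|exact: ltW]; last first.
  by move=> t _; exact: integral_ge0.
have fub : (\int[mu]_t \int[mu]_s F (t, s) = \int[mu]_s \int[mu]_t F (t, s))%E.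
  exact: (@fubini_tonelli _ _ (measurableTypeR R) (measurableTypeR R) R mu mu F mF F0).
rewrite fub.
apply: (@le_trans _ _ ((a `^ p / a)%:E * \int[mu]_s (a%:E * (phi s `^ p)%:E))%E).
  apply: lee_wpmul2l; first by rewrite lee_fin ltW.
  apply: le_integral_ae; first by [].
  - by move=> s _; rewrite integral_ge0.
  - by move=> s _; rewrite -EFinM lee_fin mulr_ge0 ?(ltW a0).
  apply: aeW => s _.
  rewrite (_ : (fun x => _) = (fun x => (phi s `^ p)%:E * (k x s)%:E)%E); last first.
    by apply/funext => x; rewrite /F/= EFinM muleC.
  rewrite ge0_integralZl_EFin; [|exact: measurableT| | |exact: phip0]; last 2 first.
  - by move=> t _; rewrite lee_fin; exact: k0.
  - exact: ((@measurable_EFinP _ _ _ _ _).2 (mks s)).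
  by rewrite muleC; apply: lee_wpmul2r (ka2 s); rewrite lee_fin.
rewrite ge0_integralZl_EFin; [|exact: measurableT| | |exact: ltW]; last 2 first.
- by move=> s _; rewrite lee_fin; exact: phip0.
- exact: ((@measurable_EFinP _ _ _ _ _).2 mphip).
by rewrite muleA -EFinM (divfK (negbT (gt_eqF a0))); exact: lexx.
Qed.

End Schur.

(** * Density of compactly supported continuous functions in L^p *)

Section Density.
Context {R : realType} {V : normedModType R[i]}.
Local Notation mu := (@lebesgue_measure R).
Variable p : R.
Hypothesis p1 : 1 <= p.
Let p0 : 0 < p. Proof. exact: lt_le_trans p1. Qed.
Implicit Types (f g : R -> V).

Definition compact_continuous g : Prop :=
  continuous g /\ exists N : R, forall t, N <= `|t| -> g t = 0.

Definition approximable f : Prop := forall e : R, 0 < e ->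
  exists g, compact_continuous g /\ (Lp_norm p (f - g)%R <= e%:E)%E.

Lemma compact_continuous_sm g : compact_continuous g -> strongly_measurable Rplus g.
Proof. by move=> [cg _]; apply: strongly_measurable_continuous => //; exact: measurable_Rplus. Qed.

Lemma approximableD f1 f2 : strongly_measurable Rplus f1 -> strongly_measurable Rplus f2 ->
  approximable f1 -> approximable f2 -> approximable (f1 + f2).
Proof.
move=> s1 s2 a1 a2 e e0; have e2 : 0 < e / 2 by rewrite divr_gt0.
have [g1 [[cg1 [N1 h1]] n1]] := a1 _ e2; have [g2 [[cg2 [N2 h2]] n2]] := a2 _ e2.
exists (g1 + g2); split.
  split; first by move=> t; apply: cvgD; [exact: cg1|exact: cg2].
  exists (Num.max N1 N2) => t; rewrite ge_max => /andP[t1 t2].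
  by rewrite !fctE h1// h2// addr0.
have mR := @measurable_Rplus R.
have cc1 : compact_continuous g1 by split => //; exists N1.
have cc2 : compact_continuous g2 by split => //; exists N2.
have sm1 : strongly_measurable Rplus (f1 - g1).
  exact: (strongly_measurableB mR s1 (compact_continuous_sm cc1)).
have sm2 : strongly_measurable Rplus (f2 - g2).
  exact: (strongly_measurableB mR s2 (compact_continuous_sm cc2)).
apply: le_trans (Lp_norm_leD p1 sm1 sm2 _) _.
  by apply: aeW => t _; apply: le_trans (nrmD _ _); rewrite !fctE opprD addrACA.
by rewrite [e]splitr EFinD; exact: (leeD n1 n2).
Qed.

(** The projection of the line onto [[0, 1]], written with absolute values so that continuity is
    immediate and the bounds follow from the triangle inequality. *)
Definition clamp (x : R) : R := (`|x| - `|x - 1| + 1) / 2.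

Lemma clamp_continuous : continuous clamp.
Proof.
move=> x; apply: cvgMl; apply: cvgD; last exact: cvg_cst.
apply: cvgB; first exact: (cvg_norm cvg_id).
by apply: cvg_norm; apply: cvgB; [exact: cvg_id|exact: cvg_cst].
Qed.

Lemma clamp_ge0 x : 0 <= clamp x.
Proof.
by rewrite /clamp; have := ler_normD x (- 1); rewrite normrN normr1; lra.
Qed.

Lemma clamp_le1 x : clamp x <= 1.
Proof.
by rewrite /clamp; have := ler_normD (x - 1) 1; rewrite subrK normr1; lra.
Qed.

Lemma clamp_le x : clamp x <= `|x|.
Proof.
by rewrite /clamp; have := ler_normD (1 - x) x; rewrite subrK normr1 distrC; lra.
Qed.

Lemma clamp_dist1 x : 1 - clamp x <= `|1 - x|.
Proof.
rewrite /clamp distrC; have := ler_normD (x - 1) 1; have := ler_normD (1 - x) x.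
rewrite subrK normr1 distrC; lra.
Qed.

Lemma clamp_eq1 x : 1 <= x -> clamp x = 1.
Proof. by move=> x1; rewrite /clamp !ger0_norm; lra. Qed.

Lemma clamp_eq0 x : x <= 0 -> clamp x = 0.
Proof. by move=> x1; rewrite /clamp !ler0_norm; lra. Qed.

(** An L^1 approximation of the indicator by continuous functions is enough for every [p]: once the
    approximants are clamped to [[0, 1]] the error is at most 1, so its [p]-th power is at most the
    error itself. Clamping brings the values no further from 0 and 1. *)
Lemma approximable_indic (A : set R) (N : R) (v : V) : measurable A ->
  (forall t, A t -> `|t| <= N) -> approximable (cutoff A (fun=> v)).
Proof.
move=> mA AN e e0.
pose E : set R := `[- (N + 1), N + 1]%classic.
have mE : measurable E by exact: measurable_itv.
have fE : (mu E < +oo)%E.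
  by rewrite lebesgue_measure_itv/=; case: ifPn => _; rewrite -?EFinD ltry.
have iA : mu.-integrable E (EFin \o \1_A).
  apply: measurable_bounded_integrable => //.
  exists 1; split; rewrite ?num_real// => M M1 t _ /=.
  by rewrite (le_trans _ (ltW M1))// indicE; case: (_ \in _); rewrite ?normr1 ?normr0.
have [g [cg _ ag]] := approximation_continuous_integrable mE fE iA.
(* The [+ 1] allows division by [K] when [v = 0]. *)
pose K := nrm v `^ p + 1.
have K0 : 0 < K by rewrite ltr_wpDl// powR_ge0.
have g0 n : (0 <= \int[mu]_(z in E) `|(\1_A z - g n z)%:E|)%E by apply: integral_ge0.
have ep : 0 < e `^ p / K by rewrite divr_gt0// powR_gt0.
have [n hn] := (cvge0P g0).1 ag _ ep.
have {}hn := hn n (leqnn n).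
(* The first factor is 1 for [|t| <= N], hence on [A], and 0 for [|t| >= N + 1]; it provides the
   compact support. *)
pose psi t : R := clamp (N + 1 - `|t|) * clamp (g n t).
have cpsi : continuous psi.
  move=> t; apply: cvgM.
    apply: (@cvg_comp _ _ _ (fun t : R => N + 1 - `|t|) clamp); last exact: clamp_continuous.
    by apply: cvgB; [exact: cvg_cst|apply: cvg_norm; exact: cvg_id].
  apply: (@cvg_comp _ _ _ (g n) clamp); last exact: clamp_continuous.
  exact: cg.
exists (fun t => (psi t)%:C%C *: v); split.
  split; last first.
    exists (N + 1) => t tN; rewrite /psi clamp_eq0 ?mul0r ?scale0r//.
    by rewrite subr_le0.
  move=> t; apply/cvg_nrmP.
  have h : `|psi s - psi t| * nrm v @[s --> t] --> (0 : R).
    rewrite -[X in _ --> X](mul0r (nrm v)); apply: cvgMl.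
    apply/cvgrPdist_lt => d d0; have /cvgrPdist_lt/(_ d d0) := cpsi t.
    by apply: filterS => s; rewrite sub0r normrN normr_id distrC.
  apply: cvg_trans h; apply: near_eq_cvg; apply: nearW => s.
  by rewrite -nrmZR -scalerBl -rmorphB.
apply/Lp_norm_leP; [by []|exact: ltW|].
have key t : nrm ((cutoff A (fun=> v) - (fun t => (psi t)%:C%C *: v)) t) =
    `|\1_A t - psi t| * nrm v.
  rewrite !fctE /cutoff indicE; case: ifPn => _.
    by rewrite -[X in nrm (X - _)]scale1r -scalerBl -nrmZR rmorphB.
  by rewrite sub0r nrmN nrmZR sub0r normrN.
have b1 t : `|\1_A t - psi t| <= `|\1_A t - g n t|.
  have h2 := clamp_le1 (g n t); have h3 := clamp_ge0 (g n t).
  rewrite indicE /psi; have [/set_mem At|_] := boolP (t \in A).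
    rewrite clamp_eq1 ?mul1r; last by have := AN t At; lra.
    by rewrite ger0_norm ?subr_ge0//; exact: clamp_dist1.
  rewrite !sub0r !normrN normrM (ger0_norm (clamp_ge0 _)) (ger0_norm h3).
  by apply: le_trans (clamp_le _); rewrite ler_piMl ?clamp_le1.
have b2 t : `|\1_A t - psi t| <= 1.
  rewrite ler_norml indicE /psi.
  have h1 := clamp_ge0 (N + 1 - `|t|); have h2 := clamp_le1 (N + 1 - `|t|).
  have h3 := clamp_ge0 (g n t); have h4 := clamp_le1 (g n t).
  have h5 : 0 <= clamp (N + 1 - `|t|) * clamp (g n t) by exact: mulr_ge0.
  have h6 : clamp (N + 1 - `|t|) * clamp (g n t) <= 1 by exact: mulr_ile1.
  by case: (t \in A); rewrite /=; lra.
have b3 t : ~ E t -> \1_A t - psi t = 0.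
  rewrite /E /= in_itv/= -ler_norml => /negP; rewrite -ltNge => Nt.
  rewrite indicE memNset => [|/AN]; last by lra.
  by rewrite /psi clamp_eq0 ?mul0r ?subrr//; lra.
have mg : measurable_fun setT (g n) by exact: continuous_measurable_fun.
have mh : measurable_fun setT (fun z => `|(\1_A z - g n z)%:E|)%E.
  apply: measurableT_comp => //; apply/measurable_EFinP; apply: measurable_funB mg.
  exact: measurable_indic.
have v0 : 0 <= nrm v `^ p by exact: powR_ge0.
apply: (@le_trans _ _ (\int[mu]_t ((nrm v `^ p)%:E * ((fun z => `|(\1_A z - g n z)%:E|) \_ E) t))%E).
  rewrite [leLHS]integral_mkcond; apply: le_integral_ae; first exact: measurableT.
  - by move=> t _; apply: erestrict_ge0 => s _; rewrite lee_fin powR_ge0.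
  - by move=> t _; apply: mule_ge0; [rewrite lee_fin|apply: erestrict_ge0].
  apply: aeW => t _; rewrite {1}/patch; case: ifPn => [_|_]; last first.
    by apply: mule_ge0; [rewrite lee_fin|apply: erestrict_ge0].
  rewrite key /patch; case: ifPn => [_|/negP tE]; last first.
    rewrite b3 ?normr0 ?mul0r ?powR0 ?gt_eqF//; last by move/mem_set.
    by apply: mule_ge0; rewrite ?lee_fin.
  rewrite -EFinM lee_fin powRM ?normr_ge0 ?nrm_ge0// mulrC.
  apply: ler_wpM2l v0 _ _ _; apply: le_trans (b1 t).
  have := b2 t; have := normr_ge0 (\1_A t - psi t).
  rewrite le_eqVlt => /predU1P[<-|q0] q1; first by rewrite powR0// gt_eqF.
  by apply: ge1r_powR => //; rewrite q0.
rewrite ge0_integralZl_EFin; [|exact: measurableT| | |exact: v0]; last 2 first.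
- by move=> t _; apply: erestrict_ge0.
- by apply/(measurable_restrictT _ mE); exact: measurable_funTS.
rewrite -integral_mkcond; apply: le_trans (lee_wpmul2l _ hn) _; first by rewrite lee_fin.
rewrite -EFinM lee_fin mulrCA ler_piMr ?powR_ge0// ler_pdivrMr// mul1r.
by rewrite /K lerDl.
Qed.

Lemma approximable_lim f (f_ : nat -> R -> V) : strongly_measurable Rplus f ->
  (forall n, strongly_measurable Rplus (f_ n)) ->
  (forall n, approximable (f_ n)) -> Lp_norm p (f - f_ n)%R @[n --> \oo] --> 0%E ->
  approximable f.
Proof.
move=> sf sf_ af_ cf e e0; have e2 : 0 < e / 2 by rewrite divr_gt0.
have [n hn] := (cvge0P (fun n => Lp_norm_ge0 p (f - f_ n))).1 cf _ e2.
have [g [cg ng]] := af_ n _ e2; exists g; split => //.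
have mR := @measurable_Rplus R.
have sm1 : strongly_measurable Rplus (f - f_ n) by exact: strongly_measurableB mR sf (sf_ n).
have sm2 : strongly_measurable Rplus (f_ n - g).
  exact: strongly_measurableB mR (sf_ n) (compact_continuous_sm cg).
apply: le_trans (Lp_norm_leD p1 sm1 sm2 _) _.
  by apply: aeW => t _; apply: nrm_le_sub.
by rewrite [e]splitr EFinD; exact: (leeD (hn n (leqnn n)) ng).
Qed.

Lemma approximable_finite_valued (s : R -> V) (N : R) : finite_valued s ->
  approximable (cutoff `[0, N] s).
Proof.
move=> fs; have [r ur hr] := finite_valued_seq fs.
have mR := @measurable_Rplus R.
have mcut v : measurable ((s @^-1` [set v]) `&` `[0, N]).
  by apply: measurableI => //; case: fs.
have -> : cutoff `[0, N] s = \sum_(v <- r) cutoff ((s @^-1` [set v]) `&` `[0, N]) (fun=> v).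
  apply/funext => t; rewrite fct_sumE (bigD1_seq (s t))//= big1 ?addr0; last first.
    by move=> v vs; rewrite cutoffN// => -[/= sv _]; rewrite sv eqxx in vs.
  rewrite /cutoff; case: ifPn => [/set_mem h|/negP h].
    by rewrite mem_set.
  by rewrite memNset// => -[_ /mem_set].
suff : strongly_measurable Rplus (\sum_(v <- r) cutoff ((s @^-1` [set v]) `&` `[0, N]) (fun=> v)) /\
  approximable (\sum_(v <- r) cutoff ((s @^-1` [set v]) `&` `[0, N]) (fun=> v)) by case.
elim: (r) => [|v r' [IH1 IH2]].
  rewrite big_nil; split; first exact: strongly_measurable_cst.
  move=> e e0; exists (0 : R -> V); split.
    by split; [move=> t; exact: cvg_cst|exists 0].
  rewrite (_ : 0 - 0 = 0 :> (R -> V)) ?Lp_norm0//; last by rewrite subrr.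
  by rewrite lee_fin ltW.
have sv : strongly_measurable Rplus (cutoff ((s @^-1` [set v]) `&` `[0, N]) (fun=> v)).
  by apply: strongly_measurable_cutoff => //; exact: strongly_measurable_cst.
rewrite big_cons; split; first exact: strongly_measurableD.
apply: (approximableD sv IH1 _ IH2).
apply: (@approximable_indic _ N); [exact: mcut|move=> t [_ /=]].
by rewrite in_itv/= => /andP[t0 tN]; rewrite ger0_norm.
Qed.

Lemma Lp_approximable f : Lp p f -> approximable f.
Proof.
move=> [sf nf]; have mR := @measurable_Rplus R.
have [g [pg fg g0]] := strongly_measurable_pettis mR sf.
have [s [ss cs ls]] := pettis_approx pg.
have sg : strongly_measurable Rplus g by exact: pettis_strongly_measurable.
have scut n : strongly_measurable Rplus (cutoff `[0, n%:R] (s n)).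
  apply: strongly_measurable_cutoff => //; apply/pettis_strongly_measurable.
  by apply/finite_valued_pettis/simple_finite_valued.
have : approximable g.
  (* Cutting the greedy approximations at time [n] gives bounded support, keeps the error below
     [nrm (g t)], and changes nothing at a fixed time once [n] is large. *)
  apply: (approximable_lim (f_ := fun n => cutoff `[0, n%:R] (s n))) => //.
    by move=> n; apply: approximable_finite_valued; exact: simple_finite_valued.
  apply: (Lp_norm_dominated p1 (G := fun t => nrm (g t) `^ p)).
  - by move=> n; apply: strongly_measurableB.
  - by apply: measurable_funTS; exact: pettis_powR.
  - by rewrite -/(Lp_power p g); apply/(Lp_power_lty p1); rewrite -(Lp_norm_ae p1 fg); exact: nf.
  - move=> n; apply: aeW => t _; rewrite ge0_ler_powR ?nnegrE ?nrm_ge0 ?(ltW p0)//.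
    rewrite !fctE /cutoff; case: ifPn => _; first exact: ls.
    by rewrite subr0.
  - apply: aeW => t Rt; apply/cvg_nrmP/cvgr0P => [n|e e0]; first exact: nrm_ge0.
    have /cvg_nrmP/(cvgr0P (fun n => nrm_ge0 _)) h := cs t.
    have [M hM] := h e e0; have [k tk] : exists k, t <= k%:R.
      by exists (Num.trunc t).+1; apply/ltW/truncnS_gt.
    exists (maxn M k) => n; rewrite geq_max => /andP[Mn kn].
    rewrite subr0 !fctE cutoffE; first by rewrite nrmBC hM.
    rewrite /= in_itv/=; apply/andP; split => //.
    by rewrite (le_trans tk)// ler_nat.
move=> ag e e0; have [h [ch nh]] := ag e e0; exists h; split; first exact: ch.
suff fgh : Lp_eq (f - h) (g - h) by rewrite (Lp_norm_ae p1 fgh); exact: nh.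
by apply: (ae_imply fg) => t ht Rt; rewrite !fctE ht.
Qed.

End Density.

(** * Sequential criteria for continuity *)

Section SequentialContinuity.
Context {R : realType} {V : normedModType R[i]}.

Lemma within_cvg_comp (T : topologicalType) (S : Type) (F : set_system S) {FF : Filter F}
    (A : set T) (f : T -> V) (c : S -> T) (z : T) :
  {within A, continuous f} -> A z -> (\forall x \near F, A (c x)) ->
  c x @[x --> F] --> z -> f (c x) @[x --> F] --> f z.
Proof.
move=> /subspace_continuousP cf Az Ac cz.
move=> P nP; suff : F (fun x => P (f (c x))) by [].
have wP : nbhs z (fun w => A w -> P (f w)) by exact: (cf z Az P nP).
have h : F (fun x => A (c x) -> P (f (c x))) by exact: (cz _ wP).
by apply: filterS2 Ac h => x Ax hx; exact: (hx Ax).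
Qed.

(** A failure of continuity produces bad points in the balls of radius [n.+1%:R^-1], hence a bad
    sequence. This is the bridge from dominated convergence, a statement on sequences, to the
    continuity demanded by [evolution_family]. *)
Lemma seq_within_cvg (T : pseudoMetricType R) (A : set T) (f : T -> V) (z : T) :
  (forall u : nat -> T, (forall n, A (u n)) -> u n @[n --> \oo] --> z ->
    f (u n) @[n --> \oo] --> f z) ->
  f x @[x --> within A (nbhs z)] --> f z.
Proof.
move=> h; apply/cvg_nrmP/cvgrPdist_lt => e e0; apply: contrapT => nh.
have bad (n : nat) : exists w, [/\ ball z n.+1%:R^-1 w, A w & e <= nrm (f w - f z)].
  apply: contrapT => nb; apply: nh.
  have : nbhs z (ball z (n.+1%:R^-1 : R)) by apply: nbhsx_ballx; rewrite invr_gt0 ltr0n.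
  apply: filterS => w bw Aw; rewrite sub0r normrN ger0_norm ?nrm_ge0// ltNge.
  by apply/negP => le; apply: nb; exists w.
have [u hu] := choice bad.
have cu : u n @[n --> \oo] --> z.
  apply/cvg_ballP => d d0.
  have [N _ hN] := (near_infty_natSinv_lt (PosNum d0)).
  exists N => // n Nn /=; have [bw _ _] := hu n.
  by apply: le_ball bw; apply/ltW/hN.
have /cvg_nrmP/cvgrPdist_lt/(_ e e0)[N _ hN] := h u (fun n => let: And3 _ a _ := hu n in a) cu.
have [_ _] := hu N; have := hN N (leqnn N).
by rewrite /= sub0r normrN ger0_norm ?nrm_ge0// => lt /(lt_le_trans lt); rewrite ltxx.
Qed.

Lemma seq_continuous (f : R -> V) :
  (forall (u : nat -> R) t, u n @[n --> \oo] --> t -> f (u n) @[n --> \oo] --> f t) ->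
  continuous f.
Proof.
move=> h t; have hw := @seq_within_cvg R setT f t (fun u _ => h u t).
move=> P nP; have hP : nbhs t (fun x => setT x -> P (f x)) by exact: (hw P nP).
suff : nbhs t (fun x => P (f x)) by [].
by apply: filterS hP => x hx; exact: (hx I).
Qed.

End SequentialContinuity.

(** * Multiplication operators and bounded operators between L^p spaces *)

Section LinfOperators.
Context {R : realType} {V W : normedModType R[i]}.
Local Notation mu := (@lebesgue_measure R).
Variable p : R.
Hypothesis p1 : 1 <= p.

Lemma Linf_norm_ge0 (D : R -> V -> W) : (0 <= Linf_norm D)%E.
Proof.
apply: ess_sup_gee.
  apply: (@lt_le_trans _ _ (mu `[0, 1])).
    by rewrite lebesgue_measure_itv/= lte_fin ltr01 sube0 lte_fin.
  by apply: le_measure; rewrite ?inE.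
by apply: aeW => t; apply: erestrict_ge0 => {}t _; exact: opnorm_ge0.
Qed.

Lemma Linf_norm_bound (D : R -> V -> W) (k : R) :
  (forall t, 0 <= t -> bounded_linear (D t)) -> (Linf_norm D <= k%:E)%E ->
  {ae mu, forall t, 0 <= t -> forall v, nrm (D t v) <= k * nrm v}.
Proof.
move=> bD Dk; have := @ess_sup_ge _ _ _ mu ((fun t => opnorm (D t)) \_ Rplus).
move=> h; apply: (ae_imply h) => t le t0; apply: opnormP; first exact: bD.
apply: le_trans Dk; apply: le_trans le.
by rewrite patchE mem_set.
Qed.

Lemma Linf_bound (D : R -> V -> W) : Linf_s D -> exists2 k : R, 0 <= k &
  {ae mu, forall t, 0 <= t -> forall v, nrm (D t v) <= k * nrm v}.
Proof.
move=> [bD sD fD]; exists (fine (Linf_norm D)); first by rewrite fine_ge0// Linf_norm_ge0.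
by apply: Linf_norm_bound => //; rewrite fineK// ge0_fin_numE// Linf_norm_ge0.
Qed.

Lemma Linf_sm (D : R -> V -> W) (E : set R) (f : R -> V) : measurable E -> E `<=` Rplus ->
  Linf_s D -> strongly_measurable E f -> strongly_measurable E (fun t => D t (f t)).
Proof.
move=> mE ER [bD sD fD] sf; apply: strongly_measurable_app => //.
- by move=> t /ER; exact: bD.
- by move=> v; exact: strongly_measurable_sub ER (sD v).
Qed.

Lemma Lp_norm_le_scale (Z : normedModType R[i]) (f : R -> Z) (g : R -> V) (k : R) : 0 <= k ->
  strongly_measurable Rplus g ->
  {ae mu, forall t, 0 <= t -> nrm (f t) <= k * nrm (g t)} ->
  (Lp_norm p f <= k%:E * Lp_norm p g)%E.
Proof.
move=> k0 sg fg; have -> : k = complex.Re `|k%:C%C| :> R.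
  by rewrite normc_def/= expr0n addr0 sqrtr_sqr ger0_norm.
rewrite -(Lp_normZ p1 _ sg); apply: (Lp_norm_le p1).
by apply: (ae_imply fg) => t h t0; rewrite !fctE nrmZR ger0_norm// h.
Qed.

Lemma Lp_opnorm_le (T : (R -> V) -> R -> W) (k : R) : 0 <= k ->
  (forall f, Lp p f -> (Lp_norm p (T f) <= k%:E * Lp_norm p f)%E) ->
  (Lp_opnorm p T <= k%:E)%E.
Proof.
move=> k0 h; apply: ub_ereal_sup => _ [f [hf nf] <-].
apply: le_trans (h f hf) _; rewrite -[leRHS]mule1; apply: lee_wpmul2l nf.
by rewrite lee_fin.
Qed.

Lemma Lp_boundedP (T : (R -> V) -> R -> W) (k : R) : 0 <= k ->
  (forall f, Lp p f -> strongly_measurable Rplus (T f)) ->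
  (forall f g, Lp p f -> Lp p g -> Lp_eq f g -> Lp_eq (T f) (T g)) ->
  (forall (a : R[i]) f g, Lp p f -> Lp p g -> Lp_eq (T (a *: f + g)) (a *: T f + T g)) ->
  (forall f, Lp p f -> (Lp_norm p (T f) <= k%:E * Lp_norm p f)%E) -> Lp_bounded p T.
Proof.
move=> k0 sT eT lT bT; split; [|exact: eT|exact: lT|].
- move=> f hf; split; first exact: sT.
  apply: le_lt_trans (bT f hf) _; case: hf => _ nf.
  by apply: lte_mul_pinfty nf; rewrite ?lee_fin.
- by apply: le_lt_trans (Lp_opnorm_le k0 bT) _; rewrite ltry.
Qed.

Lemma Lp_opnorm_ge0 (T : (R -> V) -> R -> W) : (0 <= Lp_opnorm p T)%E.
Proof.
apply: ereal_sup_ge; exists (Lp_norm p (T 0)); last exact: Lp_norm_ge0.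
by exists 0 => //=; split; [exact: Lp0|rewrite Lp_norm0].
Qed.

Lemma Lp_bounded0 (T : (R -> V) -> R -> W) : Lp_bounded p T -> Lp_eq (T 0) 0.
Proof.
move=> [T1 T2 T3 T4]; have h0 := @Lp0 R p p1 V.
have e : 1 *: (0 : R -> V) + 0 = 0 by rewrite scaler0 addr0.
have := T3 1 0 0 h0 h0; rewrite e => h.
apply: (ae_imply h) => t ht Rt; have := ht Rt; rewrite !fctE scale1r => h'.
by apply: (addrI (T 0 t)); rewrite -h' addr0.
Qed.

Lemma Lp_opnormP (T : (R -> V) -> R -> W) (o : R) : Lp_bounded p T ->
  (Lp_opnorm p T <= o%:E)%E -> forall f, Lp p f ->
  (Lp_norm p (T f) <= o%:E * Lp_norm p f)%E.
Proof.
move=> bT To f hf; have [T1 T2 T3 T4] := bT; have [sf nf] := hf.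
have fE : Lp_norm p f = (fine (Lp_norm p f))%:E by rewrite fineK// ge0_fin_numE// Lp_norm_ge0.
have h0 := @Lp0 R p p1 V.
(* A function of norm 0 cannot be normalised; it is 0 almost everywhere, and therefore so is its
   image. *)
have := Lp_norm_ge0 p f; rewrite fE lee_fin le_eqVlt => /predU1P[n0|n0].
  have f0 : Lp_eq f 0 by apply: (Lp_norm_eq0 p1 sf); rewrite fE -n0.
  have := T2 f 0 hf h0 f0 => h; rewrite (Lp_norm_ae p1 h).
  by rewrite (Lp_norm_ae p1 (Lp_bounded0 bT)) Lp_norm0// -n0 mule0.
set n := fine (Lp_norm p f) in n0 fE *.
pose c : R[i] := (n^-1)%:C%C; pose g := c *: f.
have cn : complex.Re `|c| = n^-1.
  by rewrite normc_def/= expr0n addr0 sqrtr_sqr ger0_norm// invr_ge0 ltW.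
have hg : Lp p g by exact: LpZ.
have ng : (Lp_norm p g <= 1)%E.
  by rewrite (Lp_normZ p1 _ sf) fE cn -EFinM mulVf// gt_eqF.
have Tg : (Lp_norm p (T g) <= o%:E)%E.
  by apply: le_trans To; apply: ereal_sup_ubound; exists g.
(* [Lp_bounded] states linearity for [a *: f + g] and almost everywhere; scaling is recovered by a
   zero summand, whose image is 0 almost everywhere. *)
have e : (n%:C%C : R[i]) *: g + 0 = f.
  apply/funext => t; rewrite !fctE addr0 /g !fctE scalerA -rmorphM mulfV ?gt_eqF//.
  by rewrite scale1r.
have := T3 n%:C%C g 0 hg h0; rewrite e => h.
have h2 : Lp_eq (T f) (n%:C%C *: T g).
  apply: (ae_imply2 h (Lp_bounded0 bT)) => t h1 h2 Rt.
  by rewrite h1// !fctE h2// addr0.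
rewrite (Lp_norm_ae p1 h2) (Lp_normZ p1 _ (T1 g hg).1).
have -> : complex.Re `|n%:C%C| = n by rewrite normc_def/= expr0n addr0 sqrtr_sqr ger0_norm// ltW.
by rewrite muleC; apply: lee_wpmul2r Tg; rewrite lee_fin ltW.
Qed.

Lemma mult_op_norm (D : R -> V -> W) (k : R) (f : R -> V) : 0 <= k ->
  strongly_measurable Rplus f ->
  {ae mu, forall t, 0 <= t -> forall v, nrm (D t v) <= k * nrm v} ->
  (Lp_norm p (mult_op D f) <= k%:E * Lp_norm p f)%E.
Proof.
move=> k0 sf Dk; apply: Lp_norm_le_scale => //.
by apply: (ae_imply Dk) => t h t0; exact: h.
Qed.

Lemma mult_op_bounded (D : R -> V -> W) : Linf_s D -> Lp_bounded p (mult_op D).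
Proof.
move=> LD; have [k k0 Dk] := Linf_bound LD; apply: (Lp_boundedP k0).
- by move=> f [sf _]; apply: Linf_sm => //; exact: measurable_Rplus.
- by move=> f g _ _ fg; apply: (ae_imply fg) => t h Rt; rewrite /mult_op h.
- move=> a f g _ _; apply: aeW => t Rt; case: LD => bD _ _.
  by have [lin _] := bD t Rt; rewrite /mult_op !fctE lin.
- by move=> f [sf _]; exact: mult_op_norm.
Qed.

End LinfOperators.

Section SchurBound.
Context {R : realType}.
Local Notation mu := (@lebesgue_measure R).
Variable p : R.
Hypothesis p1 : 1 <= p.
Let p0 : 0 < p. Proof. exact: lt_le_trans p1. Qed.

(** Passes from a vector-valued operator, dominated in norm by a scalar kernel, to [schur_test]. The
    representative of [f] vanishes at negative times, so that all integrals can run over the whole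
    line. *)
Lemma Lp_schur {V W : normedModType R[i]} (k : R -> R -> R) (a : R) (f : R -> V) (F : R -> W) :
  0 < a -> (forall t s, 0 <= k t s) ->
  measurable_fun setT (fun z : R * R => k z.1 z.2) ->
  (forall t, \int[mu]_s (k t s)%:E <= a%:E)%E ->
  (forall s, \int[mu]_t (k t s)%:E <= a%:E)%E ->
  strongly_measurable Rplus f ->
  (forall t, 0 <= t -> ((nrm (F t))%:E <= \int[mu]_(s in Rplus) (k t s * nrm (f s))%:E)%E) ->
  (Lp_norm p F <= a%:E * Lp_norm p f)%E.
Proof.
move=> a0 k0 mk ka1 ka2 sf leF; have mR := @measurable_Rplus R.
have [g [pg fg g0]] := strongly_measurable_pettis mR sf.
have leF' t : 0 <= t -> ((nrm (F t))%:E <= \int[mu]_s (k t s * nrm (g s))%:E)%E.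
  move=> /leF /le_trans; apply.
  rewrite [leLHS]integral_mkcond; apply: le_integral_ae; first by [].
  - by move=> s _; apply: erestrict_ge0 => {}s _; rewrite lee_fin mulr_ge0 ?nrm_ge0.
  - by move=> s _; rewrite lee_fin mulr_ge0 ?nrm_ge0.
  apply: (ae_imply fg) => s h _; rewrite /patch; case: ifPn => [/set_mem Rs|_].
    by rewrite h.
  by rewrite -[point]/(0%E) lee_fin mulr_ge0 ?nrm_ge0.
have := schur_test p1 a0 k0 (fun s => nrm_ge0 (g s)) mk (pettis_nrm pg) ka1 ka2.
have -> : (\int[mu]_s (nrm (g s) `^ p)%:E)%E = Lp_power p f.
  rewrite /Lp_power [RHS]integral_mkcond; apply: eq_integral_ae; first by [].
  - by move=> s _; rewrite lee_fin powR_ge0.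
  - by move=> s _; apply: erestrict_ge0 => {}s _; rewrite lee_fin powR_ge0.
  apply: (ae_imply fg) => s h _; rewrite /patch; case: ifPn => [/set_mem Rs|/negP Rs].
    by rewrite h.
  by rewrite g0 ?nrm0 ?powR0 ?gt_eqF// => Rs'; apply: Rs; exact: mem_set.
set J := (X in (X <= _)%E) => hJ.
have FJ : (Lp_power p F <= J)%E.
  rewrite /Lp_power /J [leLHS]integral_mkcond; apply: le_integral_ae; first by [].
  - by move=> s _; apply: erestrict_ge0 => {}s _; rewrite lee_fin powR_ge0.
  - by move=> s _; exact: poweR_ge0.
  apply: aeW => t _; rewrite /patch; case: ifPn => [/set_mem Rt|_]; last exact: poweR_ge0.
  rewrite -poweR_EFin; apply: le_poweR; [exact: ltW|by rewrite lee_fin nrm_ge0|exact: leF'].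
have h := le_trans FJ hJ.
rewrite -(poweRVK_p p1 (x := a%:E)) ?lee_fin ?(ltW a0)// poweR_EFin /Lp_norm.
rewrite -poweRM ?lee_fin ?powR_ge0 ?Lp_power_ge0//.
by apply: le_poweR h; [rewrite invr_ge0 ltW|exact: Lp_power_ge0].
Qed.

Lemma measurable_fun_shift (h : R) : measurable_fun setT (fun t : R => t - h).
Proof. by apply: measurable_funB => //; exact: measurable_id. Qed.

Lemma ae_shift (h : R) (P : R -> Prop) : {ae mu, forall t, 0 <= t -> P t} ->
  {ae mu, forall t, h <= t -> P (t - h)}.
Proof.
move=> [N [mN N0 hN]]; exists ((fun t : R => t - h) @^-1` N); split.
- by rewrite -[X in measurable X]setTI; exact: (measurable_fun_shift h).
- by rewrite -[LHS]/(pushforward mu (fun t : measurableTypeR R => (t - h : measurableTypeR R)) N)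
    lebesgue_measure_shift.
- move=> t /= nP; apply: hN => /= Pt; apply: nP => ht; apply: Pt.
  by rewrite subr_ge0.
Qed.

Lemma pettis_shift {V : normedModType R[i]} (h : R) (f : R -> V) : pettis f ->
  pettis (fun t => f (t - h)).
Proof.
move=> [[d hd] mf]; split; first by exists d => t e; exact: hd.
move=> v; exact: (measurableT_comp (mf v) (measurable_fun_shift h)).
Qed.

Lemma strongly_measurable_shift {V : normedModType R[i]} (h : R) (f : R -> V) :
  strongly_measurable Rplus f -> strongly_measurable `[h, +oo[ (fun t => f (t - h)).
Proof.
move=> /(strongly_measurable_pettis (@measurable_Rplus R))[g [pg fg _]].
apply: (@strongly_measurable_ae _ _ _ (fun t => g (t - h))).
  by apply: (ae_imply (ae_shift h fg)) => t ht; rewrite /= in_itv/= andbT => /ht.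
exact/pettis_strongly_measurable/pettis_shift.
Qed.

Lemma Lp_norm_shift {V : normedModType R[i]} (h : R) (f : R -> V) : 0 <= h ->
  strongly_measurable Rplus f ->
  Lp_norm p (cutoff `[h, +oo[ (fun t => f (t - h))) = Lp_norm p f.
Proof.
move=> h0 /(strongly_measurable_pettis (@measurable_Rplus R))[g [pg fg _]].
have fg' := ae_shift h fg.
have e : Lp_eq (cutoff `[h, +oo[ (fun t => f (t - h))) (cutoff `[h, +oo[ (fun t => g (t - h))).
  apply: (ae_imply fg') => t ht _; rewrite /cutoff; case: ifPn => // /set_mem/=.
  by rewrite in_itv/= andbT => /ht.
rewrite (Lp_norm_ae p1 e) (Lp_norm_ae p1 fg) /Lp_norm; apply: (congr1 (fun x => x `^ p^-1)%E).
have RE : @Rplus R = `[0, +oo[%classic.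
  by apply/seteqP; split=> t /=; rewrite in_itv/= andbT.
transitivity (\int[mu]_(t in `[h, +oo[) (nrm (g (t - h)) `^ p)%:E)%E.
  rewrite [LHS]integral_mkcond [RHS]integral_mkcond; apply: eq_integral => t _.
  rewrite /patch /cutoff RE; have [/set_mem/= ht|ht] := boolP (t \in `[h, +oo[%classic).
    rewrite mem_set//=; move: ht; rewrite !in_itv/= !andbT; exact: le_trans.
  by rewrite nrm0 powR0 ?gt_eqF//; case: ifPn.
rewrite RE; apply: (@ge0_integral_shift R h (fun t => (nrm (g t) `^ p)%:E)).
- by apply/measurable_EFinP; exact: pettis_powR.
- by move=> t; rewrite lee_fin powR_ge0.
Qed.

End SchurBound.

Lemma cvg_upper_bound {R : realType} (u : nat -> R) (l : R) : u n @[n --> \oo] --> l ->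
  exists T, forall n, u n <= T.
Proof.
move=> /cvgrPdist_le/(_ 1 ltr01)[N _ hN].
have {hN} : forall n, (N <= n)%N -> u n <= l + 1.
  by move=> n /hN /=; rewrite ler_norml => /andP[h1 h2]; lra.
elim: N (l + 1) => [|N IH] B h; first by exists B => n; exact: h.
apply: (IH (Num.max B (u N))) => n Nn; rewrite le_max.
by move: Nn; rewrite leq_eqVlt => /predU1P[->|/h ->//]; rewrite lexx orbT.
Qed.

Section ConvolutionKernels.
Context {R : realType}.
Local Notation mu := (@lebesgue_measure R).

(* Volterra kernel of convolution type, supported on [max 0 (h t) <= s <= t]. *)
Definition window_kernel (w : R -> R) (h : R -> R) (t s : R) : R :=
  if (0 <= s) && (h t <= s) && (s <= t) then w (t - s) else 0.

Lemma measurable_window_kernel (w h : R -> R) : measurable_fun setT w ->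
  measurable_fun setT h ->
  measurable_fun setT (fun z : R * R => window_kernel w h z.1 z.2).
Proof.
move=> mw mh.
have m1 : measurable_fun setT (fst : R * R -> R) by exact: measurable_fst.
have m2 : measurable_fun setT (snd : R * R -> R) by exact: measurable_snd.
apply: measurable_fun_ifT.
- apply: measurable_and; first apply: measurable_and.
  + by apply: measurable_fun_ler => //; exact: measurable_cst.
  + by apply: measurable_fun_ler => //; exact: (measurableT_comp mh m1).
  + exact: measurable_fun_ler.
- by apply: (measurableT_comp mw); exact: measurable_funB.
- exact: measurable_cst.
Qed.

End ConvolutionKernels.

(** * Volterra operators of an evolution family *)

Opaque Lp_norm.

Lemma ae_neq {R : realType} (a : R) : {ae @lebesgue_measure R, forall r : R, r != a}.
Proof.
exists [set a]; split; [exact: measurable_set1|exact: lebesgue_measure_set1|].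
by move=> r /= /negP; rewrite negbK => /eqP.
Qed.

Section Evolution.
Context {R : realType} {X : completeNormedModType R[i]}.
Local Notation mu := (@lebesgue_measure R).
Variables (U : R -> R -> X -> X) (M : R).
Hypotheses (evU : evolution_family U) (M0 : 0 <= M)
  (UM : forall (t s : R) (x : X), 0 <= s <= t -> nrm (U t s x) <= M * nrm x).
Implicit Types (t s a b r h T : R) (x : X).

Lemma evolution_blin t s : 0 <= s <= t -> bounded_linear (U t s).
Proof. by case: evU => h _ _ _; exact: h. Qed.

(** The axioms give continuity in the two times for a fixed vector; the uniform bound [M] takes care
    of the moving vector, by splitting [y i] as [(y i - x) + x]. *)
Lemma evolution_cvg (S : Type) (F : set_system S) {FF : Filter F} (a b : S -> R) (y : S -> X)
    (t s : R) (x : X) : 0 <= s <= t -> (\forall i \near F, 0 <= b i <= a i) ->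
  a i @[i --> F] --> t -> b i @[i --> F] --> s -> y i @[i --> F] --> x ->
  U (a i) (b i) (y i) @[i --> F] --> U t s x.
Proof.
move=> st ba ca cb cy; have [_ _ _ cU] := evU.
have c1 : U (a i) (b i) x @[i --> F] --> U t s x.
  apply: (@within_cvg_comp _ _ _ _ F FF [set z : R * R | 0 <= z.2 <= z.1]
    (fun z => U z.1 z.2 x) (fun i => (a i, b i)) (t, s) (cU x)) => //.
  apply/cvg_ballP => e e0; have /cvg_ballP/(_ e e0) ha := ca.
  have /cvg_ballP/(_ e e0) hb := cb.
  by apply: filterS2 ha hb => i.
have c2 : U (a i) (b i) (y i - x) @[i --> F] --> (0 : X).
  have /cvg_nrmP h := cy; apply/cvg_nrmP.
  apply: (@squeeze_cvgr _ _ _ _ (fun=> 0) (fun i => M * nrm (y i - x))).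
  - by apply: filterS ba => i bai; rewrite nrm_ge0/= subr0 UM.
  - exact: cvg_cst.
  - by rewrite -[X in _ --> X](mulr0 M); apply: cvgMr.
rewrite -[X in _ --> X]add0r.
apply: cvg_trans (cvgD c2 c1); apply: near_eq_cvg; apply: filterS ba => i bai.
by rewrite -[LHS]/(U (a i) (b i) (y i - x) + U (a i) (b i) x) (blinB (evolution_blin bai)) subrK.
Qed.

Lemma evolution_sm t a b (f : R -> X) : 0 <= a -> b <= t ->
  strongly_measurable `[a, b] f -> strongly_measurable `[a, b] (fun s => U t s (f s)).
Proof.
move=> a0 bt sf; apply: strongly_measurable_app => //.
  by move=> s /=; rewrite in_itv/= => /andP[as_ sb]; apply: evolution_blin;
    rewrite (le_trans a0 as_) (le_trans sb bt).
move=> v; have [t0|t0] := leP 0 t; last first.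
  apply: (@strongly_measurable_ae _ _ _ (fun=> 0)); last exact: strongly_measurable_cst.
  apply: aeW => s /=; rewrite in_itv/= => /andP[h1 h2].
  by have := le_trans (le_trans a0 h1) (le_trans h2 bt); rewrite leNgt t0.
(* [U t s] is meaningful for [0 <= s <= t] only; clamping [s] into this range gives a function that
   is continuous on the whole line and agrees with the given one on [[a, b]]. *)
pose c s : R := Num.max 0 (Num.min s t).
have cb s : 0 <= c s <= t by rewrite /c le_max lexx/= ge_max t0 ge_min lexx orbT.
apply: (@strongly_measurable_ae _ _ _ (fun s => U t (c s) v)).
  apply: aeW => s /=; rewrite in_itv/= => /andP[h1 h2].
  by rewrite /c (min_idPl (le_trans h2 bt)) (max_idPr (le_trans a0 h1)).
apply: strongly_measurable_continuous => // s.
apply: evolution_cvg; [exact: cb|exact: nearW|exact: cvg_cst| |exact: cvg_cst].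
apply: (@continuous_max R R (fun=> 0) (fun s => Num.min s t) s); first exact: cvg_cst.
by apply: (@continuous_min R R id (fun=> t) s); [exact: cvg_id|exact: cvg_cst].
Qed.

Lemma evolution_bochner_integrable t a b (f : R -> X) : 0 <= a -> b <= t ->
  bochner_integrable a b f -> bochner_integrable a b (fun s => U t s (f s)).
Proof.
move=> a0 bt If; have [sf _] := If.
have I0 : bochner_integrable a b (fun _ : R => (0 : X)).
  by have := bochner_integrableB If If; under eq_fun do rewrite subrr.
apply: (bochner_integrable_le _ (bochner_integrable_lin (M%:C%C) If I0)).
  exact: evolution_sm.
apply: aeW => s /=; rewrite in_itv/= => /andP[h1 h2]; rewrite addr0 nrmZR ger0_norm//.
by apply: UM; rewrite (le_trans a0 h1) (le_trans h2 bt).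
Qed.

Lemma evolution_bochner t a b r (f : R -> X) : 0 <= a -> a <= b -> b <= r -> r <= t ->
  bochner_integrable a b f ->
  U t r (bochner a b (fun s => U r s (f s))) = bochner a b (fun s => U t s (f s)).
Proof.
move=> a0 ab br rt If; have r0 : 0 <= r by rewrite (le_trans a0)// (le_trans ab).
rewrite -bochner_blin; last first.
- exact: evolution_bochner_integrable.
- by apply: evolution_blin; rewrite r0.
apply: bochner_ae; apply: aeW => s; rewrite in_itv/= => /andP[h1 h2].
by have [_ ev _ _] := evU; rewrite -(ev t r s (le_trans a0 h1) (le_trans h2 br) rt).
Qed.

(** Dominated convergence for Volterra integrals whose endpoints move together with the first time
    of [U]; every continuity statement about such integrals goes through it. Convergence of the
    integrands is asked for strictly between [s] and [t], since the endpoints form a null set. *)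
Lemma cvg_volterra (a b : nat -> R) t s T (phi_ : nat -> R -> X) (phi : R -> X) (G : R -> R) :
  (forall n, 0 <= b n <= a n) -> (forall n, a n <= T) -> 0 <= s <= t -> t <= T ->
  a n @[n --> \oo] --> t -> b n @[n --> \oo] --> s ->
  (forall n, strongly_measurable `[b n, a n] (phi_ n)) -> strongly_measurable `[s, t] phi ->
  (forall r, 0 <= G r) -> measurable_fun `[0, T] G ->
  (\int[mu]_(r in `[0%R, T]) (G r)%:E < +oo)%E ->
  (forall n, {ae mu, forall r, b n <= r <= a n -> nrm (phi_ n r) <= G r}) ->
  {ae mu, forall r, s <= r <= t -> nrm (phi r) <= G r} ->
  {ae mu, forall r, s < r < t -> phi_ n r @[n --> \oo] --> phi r} ->
  bochner (b n) (a n) (fun r => U (a n) r (phi_ n r)) @[n --> \oo] -->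
  bochner s t (fun r => U t r (phi r)).
Proof.
move=> ba aT st tT ca cb smn sm G0 mG fG dn dphi cphi.
have [s0 st'] := andP st.
have T0 : 0 <= T by rewrite (le_trans s0)// (le_trans st').
have integ (b' a' : R) (psi : R -> X) : 0 <= b' <= a' -> a' <= T ->
    strongly_measurable `[b', a'] psi ->
    {ae mu, forall r, b' <= r <= a' -> nrm (psi r) <= G r} ->
    bochner_integrable b' a' psi.
  move=> /andP[b0 b1] a1 spsi dpsi; split => //; apply: le_lt_trans fG.
  apply: (@le_trans _ _ (\int[mu]_(r in `[b', a']) (G r)%:E)%E).
    apply: le_integral_ae; [by []|by move=> r _; rewrite lee_fin nrm_ge0| |].
      by move=> r _; rewrite lee_fin.
    by apply: (ae_imply dpsi) => r h; rewrite /= in_itv/= => /h; rewrite lee_fin.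
  apply: ge0_subset_integral => //.
  - exact/measurable_EFinP.
  - by move=> r _; rewrite lee_fin.
  - move=> r /=; rewrite !in_itv/= => /andP[h1 h2].
    by rewrite (le_trans b0 h1) (le_trans h2 a1).
(* Extension by 0 to the fixed interval [[0, T]] makes the difference of the two integrals a single
   integral of [D n]. *)
pose D n r := cutoff `[b n, a n] (fun r => U (a n) r (phi_ n r)) r -
              cutoff `[s, t] (fun r => U t r (phi r)) r.
have In n : bochner_integrable (b n) (a n) (fun r => U (a n) r (phi_ n r)).
  have [b0 b1] := andP (ba n); apply: evolution_bochner_integrable => //.
  exact: integ.
have I : bochner_integrable s t (fun r => U t r (phi r)).
  by apply: evolution_bochner_integrable => //; exact: integ.
have Icut b' a' psi : 0 <= b' <= a' -> a' <= T -> bochner_integrable b' a' psi ->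
    bochner_integrable 0 T (cutoff `[b', a'] psi).
  move=> /andP[b0 _] a1 [spsi Ipsi]; split.
    apply: strongly_measurable_cutoff => //.
    by apply: strongly_measurable_sub spsi => r [].
  apply: le_lt_trans Ipsi; apply: le_integral_supp => r.
  - by rewrite lee_fin nrm_ge0.
  - by rewrite lee_fin nrm_ge0.
  - by move=> _ Er; rewrite cutoffE.
  - by move=> _ Er; rewrite cutoffN// nrm0.
have IDn n : bochner_integrable 0 T (D n).
  by apply: bochner_integrableB; apply: Icut.
have DE n : bochner (b n) (a n) (fun r => U (a n) r (phi_ n r)) -
    bochner s t (fun r => U t r (phi r)) = bochner 0 T (D n).
  have [b0 b1] := andP (ba n).
  rewrite bochnerB; [|exact: Icut..].
  by rewrite !bochner_cutoff.
apply/cvg_nrmP; apply/cvgr0P => [n|e e0]; first exact: nrm_ge0.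
suff lim : (\int[mu]_(r in `[0%R, T]) (nrm (D n r))%:E)%E @[n --> \oo] --> 0%E.
  have D0 n : (0 <= \int[mu]_(r in `[0%R, T]) (nrm (D n r))%:E)%E.
    by apply: integral_ge0 => r _; rewrite lee_fin nrm_ge0.
  have [N hN] := (cvge0P D0).1 lim e e0; exists N => n Nn.
  by rewrite DE -lee_fin (le_trans (nrm_bochner (IDn n)))// hN.
(* One summand dominates each of the two cut-off integrands. *)
apply: (nrm_integral_dominated (f_ := D) (G := fun r => (M * G r) + (M * G r))) => //.
- by move=> n; case: (IDn n).
- by apply: measurable_funD; apply: measurable_funM => //; exact: measurable_cst.
- under eq_integral do rewrite EFinD EFinM.
  rewrite ge0_integralD//; last 4 first.
  + by move=> r _; rewrite mule_ge0 ?lee_fin.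
  + by apply: measurable_funeM; exact/measurable_EFinP.
  + by move=> r _; rewrite mule_ge0 ?lee_fin.
  + by apply: measurable_funeM; exact/measurable_EFinP.
  rewrite ge0_integralZl_EFin//; last 2 first.
  + by move=> r _; rewrite lee_fin.
  + exact/measurable_EFinP.
  by apply: lte_add_pinfty; apply: lte_mul_pinfty fG; rewrite ?lee_fin.
- move=> n; apply: (ae_imply2 (dn n) dphi) => r h1 h2 _; apply: le_trans (nrmD _ _) _.
  rewrite nrmN; apply: lerD.
    rewrite /cutoff; case: ifPn => [/set_mem/=|_]; last by rewrite nrm0 mulr_ge0.
    rewrite in_itv/= => /[dup] /andP[r1 r2] /h1 h; have [b0 b1] := andP (ba n).
    apply: le_trans (UM _ _) _; first by rewrite r2 (le_trans b0).
    exact: ler_wpM2l.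
  rewrite /cutoff; case: ifPn => [/set_mem/=|_]; last by rewrite nrm0 mulr_ge0.
  rewrite in_itv/= => /[dup] /andP[r1 r2] /h2 h.
  apply: le_trans (UM _ _) _; first by rewrite r2 (le_trans s0).
  exact: ler_wpM2l.
have ends : {ae mu, forall r : R, r != s /\ r != t}.
  by apply: (ae_imply2 (ae_neq s) (ae_neq t)) => r h1 h2.
apply: (ae_imply2 cphi ends) => r cr [rs rt] _.
have zero : (\forall n \near \oo, D n r = 0) -> D n r @[n --> \oo] --> (0 : X).
  exact: cvg_near_cst.
(* Away from [s] and [t] the position of [r] with respect to the moving endpoints is eventually that
   with respect to the limits: outside, both cutoffs vanish; inside, [evolution_cvg] applies. *)
have [rls|slr|E] := ltgtP r s; last by rewrite E eqxx in rs.
  apply: zero; have : \forall n \near \oo, r < b n by exact: (cvgr_gt _ cb).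
  apply: filterS => n rb; rewrite /D !cutoffN ?subrr//= in_itv/=.
    by rewrite leNgt rls.
  by rewrite leNgt rb.
have [rlt|tlr|E] := ltgtP r t; last by rewrite E eqxx in rt.
  have ra : \forall n \near \oo, r < a n by exact: (cvgr_gt _ ca).
  have br : \forall n \near \oo, b n < r by exact: (cvgr_lt _ cb).
  have r0 : 0 <= r by rewrite (le_trans s0)// ltW.
  have lim : U (a n) r (phi_ n r) @[n --> \oo] --> U t r (phi r).
    apply: evolution_cvg; [by rewrite r0 ltW| |exact: ca|exact: cvg_cst|].
      by apply: filterS ra => n ran; rewrite r0 ltW.
    by apply: cr; rewrite slr.
  have /cvg_nrmP lim0 := lim; apply/cvg_nrmP.
  apply: cvg_trans lim0; apply: near_eq_cvg; apply: filterS2 ra br => n h1 h2.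
  by rewrite /D !cutoffE ?subr0//= in_itv/= ?(ltW h1) ?(ltW h2) ?(ltW rlt) ?(ltW slr).
apply: zero; have : \forall n \near \oo, a n < r by exact: (cvgr_lt _ ca).
apply: filterS => n ar; rewrite /D !cutoffN ?subrr//= in_itv/=.
  by rewrite (leNgt r t) tlr andbF.
by rewrite (leNgt r (a n)) ar andbF.
Qed.

End Evolution.

Section VolterraOperators.
Context {R : realType} {X : completeNormedModType R[i]}.
Local Notation mu := (@lebesgue_measure R).
Variables (U : R -> R -> X -> X) (M : R).
Hypotheses (evU : evolution_family U) (M0 : 0 <= M)
  (UM : forall (t s : R) (x : X), 0 <= s <= t -> nrm (U t s x) <= M * nrm x).

(** The integral is continuous in [t >= 0] by [cvg_volterra], and is prolonged to negative times by
    its value at 0. The lower limit [l] is a parameter in order to cover both [GG] and the means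
    over [[t - h, t]]. *)
Lemma strongly_measurable_volterra (l : R -> R) (f : R -> X) : continuous l ->
  (forall t : R, 0 <= t -> 0 <= l t <= t) -> strongly_measurable Rplus f ->
  (forall T : R, 0 <= T -> bochner_integrable 0 T f) ->
  strongly_measurable Rplus (fun t => bochner (l t) t (fun s => U t s (f s))).
Proof.
move=> cl hl sf If; have mR := @measurable_Rplus R.
have [g [pg fg _]] := strongly_measurable_pettis mR sf.
pose m (t : R) : R := Num.max (0 : R) t.
have m0 t : 0 <= m t by rewrite le_max lexx.
apply: (@strongly_measurable_ae _ _ _ (fun t => bochner (l (m t)) (m t) (fun s => U (m t) s (f s)))).
  by apply: aeW => t t0; rewrite /m (max_idPr t0).
apply: strongly_measurable_continuous; first exact: mR.
apply: seq_continuous => u t ut.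
have cm : m (u n) @[n --> \oo] --> m t.
  have cmax : continuous m.
    move=> y; apply: (@continuous_max R R (fun=> 0) id y); [exact: cvg_cst|exact: cvg_id].
  exact: (cvg_comp _ _ ut (cmax t)).
have cl' : l (m (u n)) @[n --> \oo] --> l (m t) by exact: (cvg_comp _ _ cm (cl (m t))).
have [T1 hT1] := cvg_upper_bound cm; pose T := Num.max T1 (m t).
have T0 : 0 <= T by rewrite le_max m0 orbT.
have smf a b : 0 <= a -> strongly_measurable `[a, b] f.
  move=> a0; apply: strongly_measurable_sub sf => s /=; rewrite in_itv/= => /andP[h _].
  exact: le_trans h.
have fle a b : 0 <= a -> {ae mu, forall r, a <= r <= b -> nrm (f r) <= nrm (g r)}.
  by move=> a0; apply: (ae_imply fg) => r h /andP[ar _]; rewrite h//; exact: le_trans ar.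
apply: (@cvg_volterra R X U M evU M0 UM (fun n => m (u n)) (fun n => l (m (u n))) (m t)
  (l (m t)) T (fun=> f) f (fun r => nrm (g r))).
- by move=> n; exact: hl.
- by move=> n; rewrite le_max hT1.
- exact: hl.
- by rewrite le_max lexx orbT.
- exact: cm.
- exact: cl'.
- by move=> n; apply: smf; have /andP[] := hl _ (m0 (u n)).
- by apply: smf; have /andP[] := hl _ (m0 t).
- by move=> r; exact: nrm_ge0.
- by apply: measurable_funTS; exact: pettis_nrm.
- have [_ fin] := If T T0; apply: le_lt_trans fin; apply: le_nrm_integral => //.
  apply: (ae_imply fg) => r h; rewrite /= in_itv/= => /andP[r0 _].
  by rewrite (h r0).
- by move=> n; apply: fle; have /andP[] := hl _ (m0 (u n)).
- by apply: fle; have /andP[] := hl _ (m0 t).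
- by apply: aeW => r _; exact: cvg_cst.
Qed.

Lemma volterra_integrable (t a b : R) (f : R -> X) : 0 <= a -> b <= t ->
  (forall T : R, 0 <= T -> bochner_integrable 0 T f) ->
  bochner_integrable a b (fun s => U t s (f s)).
Proof.
move=> a0 bt If; apply: (evolution_bochner_integrable evU M0 UM a0 bt).
have [b0|b0] := leP 0 b; first exact: (bochner_integrable_sub a0 _ (If b b0)).
apply: (bochner_integrable_sub a0 _ (If 0 (lexx 0))); exact: ltW.
Qed.

Variable p : R.
Hypothesis p1 : 1 <= p.

Lemma Lp_norm_volterra (l w : R -> R) (a : R) (f : R -> X) : 0 < a -> continuous l ->
  (forall t : R, 0 <= t -> 0 <= l t) -> (forall t, 0 <= w t) -> measurable_fun setT w ->
  (forall (t s : R) (x : X), 0 <= s <= t -> nrm (U t s x) <= w (t - s) * nrm x) ->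
  (forall t, \int[mu]_s (window_kernel w l t s)%:E <= a%:E)%E ->
  (forall s, \int[mu]_t (window_kernel w l t s)%:E <= a%:E)%E -> Lp p f ->
  (Lp_norm p (fun t => bochner (l t) t (fun s => U t s (f s))) <= a%:E * Lp_norm p f)%E.
Proof.
move=> a0 cl l0 w0 mw Uw k1 k2 hf.
have k0 t s : 0 <= window_kernel w l t s by rewrite /window_kernel; case: ifP.
apply: (@Lp_schur R p p1 X X (window_kernel w l) a f _ a0 k0 _ k1 k2) => //.
- by apply: measurable_window_kernel => //; exact: continuous_measurable_fun.
- by case: hf.
move=> t t0; have If (T : R) : 0 <= T -> bochner_integrable 0 T f.
  by move=> T0; exact: Lp_bochner_integrable hf.
apply: le_trans (nrm_bochner (volterra_integrable (l0 t t0) (lexx t) If)) _.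
apply: le_integral_supp => s /=.
- by rewrite lee_fin nrm_ge0.
- by rewrite lee_fin mulr_ge0 ?nrm_ge0.
- rewrite in_itv/= => /andP[ls st] s0; rewrite lee_fin /window_kernel.
  rewrite (_ : (0 <= s) = true)// ls st/=; apply: Uw; exact/andP.
- by rewrite in_itv/= => /andP[ls st] []; exact: le_trans (l0 t t0) ls.
Qed.

End VolterraOperators.

(** * Schur bounds for the constant and the exponential kernel *)

Section Kernels.
Context {R : realType}.
Local Notation mu := (@lebesgue_measure R).

(** For fixed [t] the support in [s] lies in [[t - d, t]], and for fixed [s] the support in [t] lies
    in [[s, s + d]]. Divided by the window length [d], the bound no longer depends on [d]. *)
Lemma window_kernel_cst (M d : R) : 0 <= M -> 0 <= d ->
  (forall t, \int[mu]_s (window_kernel (fun=> M) (fun t => Num.max 0 (t - d)) t s)%:E <=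
     (M * d)%:E)%E /\
  (forall s, \int[mu]_t (window_kernel (fun=> M) (fun t => Num.max 0 (t - d)) t s)%:E <=
     (M * d)%:E)%E.
Proof.
move=> M0 d0.
have k0 t s : 0 <= window_kernel (fun=> M) (fun t => Num.max 0 (t - d)) t s.
  by rewrite /window_kernel; case: ifP.
split=> [t|s].
- have -> : M * d = M * (t - (t - d)) by rewrite opprB addrC subrK.
  rewrite -integral_cst_itv ?gerBl//; apply: le_integral_supp => s; rewrite ?lee_fin// => _.
    by rewrite /window_kernel; case: ifP.
  rewrite /window_kernel; case: ifPn => // /andP[/andP[_ h1] h2] [].
  by rewrite /= in_itv/= h2 andbT; move: h1; rewrite ge_max => /andP[].
- have -> : M * d = M * (s + d - s) by rewrite addrAC subrr add0r.
  rewrite -integral_cst_itv ?lerDl//; apply: le_integral_supp => t; rewrite ?lee_fin// => _.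
    by rewrite /window_kernel; case: ifP.
  rewrite /window_kernel; case: ifPn => // /andP[/andP[_ h1] h2] [].
  by rewrite /= in_itv/= h2/=; move: h1; rewrite ge_max lerBlDr => /andP[].
Qed.

(** [M / - o] is the integral of [M * expR (o * x)] over the half-line; the kernel is a function of
    [t - s >= 0], so it bounds both partial integrals. *)
Lemma window_kernel_expR (M o : R) : 0 <= M -> o < 0 ->
  (forall t, \int[mu]_s (window_kernel (fun x => M * expR (o * x)) (fun=> 0) t s)%:E <=
     (M / - o)%:E)%E /\
  (forall s, \int[mu]_t (window_kernel (fun x => M * expR (o * x)) (fun=> 0) t s)%:E <=
     (M / - o)%:E)%E.
Proof.
move=> M0 o0; have o0' : 0 < - o by rewrite oppr_gt0.
have k0 t s : 0 <= window_kernel (fun x => M * expR (o * x)) (fun=> 0) t s.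
  by rewrite /window_kernel; case: ifP => // _; rewrite mulr_ge0 ?expR_ge0.
have Mo : 0 <= M / - o by rewrite divr_ge0// ltW.
split=> [t|s].
- have [t0|t0] := leP 0 t; last first.
    rewrite (_ : (fun s => _) = cst 0%E) ?integral0 ?lee_fin//.
    apply/funext => s; rewrite /window_kernel; case: ifP => // /andP[/andP[s0 _] st].
    by have := le_trans s0 st; rewrite leNgt t0.
  have e0 s : (0 <= (- o * expR (- o * s + o * t))%:E)%E.
    by rewrite lee_fin mulr_ge0 ?expR_ge0// ltW.
  apply: (@le_trans _ _ (\int[mu]_(s in `[0%R, t])
      ((M / - o)%:E * (- o * expR (- o * s + o * t))%:E))%E).
    apply: le_integral_supp => s.
    + by rewrite lee_fin.
    + exact: mule_ge0.
    + move=> _ _; rewrite -EFinM lee_fin mulrA divfK ?gt_eqF// /window_kernel.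
      by case: ifP => _; rewrite ?mulr_ge0 ?expR_ge0// mulrBr addrC mulNr.
    + move=> _; rewrite /window_kernel; case: ifPn => // /andP[/andP[s0 _] st] [].
      by rewrite /= in_itv/= st s0.
  rewrite ge0_integralZl_EFin//.
  + rewrite integral_expR_affine// -EFinM lee_fin -[leRHS]mulr1.
    apply: ler_wpM2l => //; rewrite mulNr addNr expR0.
    by rewrite gerBl expR_ge0.
  + apply: measurable_funTS; apply/measurable_EFinP.
    by apply: continuous_measurable_fun; exact: continuous_derive_expR_affine.
- apply: (@le_trans _ _ (\int[mu]_(t in `[s, +oo[) (M * expR (o * t + - (o * s)))%:E)%E).
    apply: le_integral_supp => t.
    + by rewrite lee_fin.
    + by rewrite lee_fin mulr_ge0 ?expR_ge0.
    + move=> _ _; rewrite lee_fin /window_kernel -mulrBr.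
      by case: ifP => // _; rewrite mulr_ge0 ?expR_ge0.
    + move=> _; rewrite /window_kernel; case: ifPn => // /andP[_ st] [].
      by rewrite /= in_itv/= st.
  by rewrite integral_expR_decay// subrr expR0 mulr1.
Qed.

End Kernels.

(** * Limits in L^p as the time step decreases to 0 *)

Section RightLimits.
Context {R : realType}.
Local Notation mu := (@lebesgue_measure R).

Lemma cvge0_at_rightP (u : R -> \bar R) : (forall h, 0 <= u h)%E ->
  (u h @[h --> (0 : R)^'+] --> 0%E <->
   forall e : R, 0 < e -> exists2 d : R, 0 < d & forall h, 0 < h -> h <= d -> (u h <= e%:E)%E).
Proof.
move=> u0; split=> [cu e e0|h].
  have [d /= d0 hd] : (0 : R)^'+ [set h | (u h < e%:E)%E].
    apply: (cu [set x | (x < e%:E)%E]).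
    by apply: open_nbhs_nbhs; split; [exact: open_ereal_lt_ereal|rewrite /= lte_fin].
  exists (d / 2); first by rewrite divr_gt0.
  move=> h h0 hd2; apply/ltW/hd => //=; rewrite sub0r normrN gtr0_norm//.
  by apply: le_lt_trans hd2 _; rewrite ltr_pdivrMr// mulr2n mulrDr mulr1 ltrDl.
apply/cvge_at_rightP => v [v0 cv]; apply/cvge0P => // e e0.
have [d d0 hd] := h e e0; have /cvgrPdist_le/(_ d d0)[N _ hN] := cv.
exists N => n Nn; apply: hd => //.
by have := hN n Nn; rewrite /= sub0r normrN gtr0_norm.
Qed.

Lemma cvge_right0_squeeze (u v : R -> \bar R) (k : R) : 0 < k -> (forall h, 0 <= u h)%E ->
  (forall h, 0 < h -> h <= k -> (u h <= v h)%E) -> v h @[h --> (0 : R)^'+] --> 0%E ->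
  u h @[h --> (0 : R)^'+] --> 0%E.
Proof.
move=> k0 u0 uv cv; apply: (squeeze_cvge _ (cvg_cst 0%E) cv).
have : \forall h \near (0 : R)^'+, h <= k by exact: nbhs_right_ltW.
have : \forall h \near (0 : R)^'+, 0 < h by exact: nbhs_right_gt.
by apply: filterS2 => h h0 hk; rewrite u0 uv.
Qed.

Variable p : R.
Hypothesis p1 : 1 <= p.
Let p0 : 0 < p. Proof. exact: lt_le_trans p1. Qed.

(** Dominated convergence along sequences of time steps; a uniform bound and a common bounded
    support provide the dominating function. Pointwise convergence is used at positive times, where
    a short window [[t - h, t]] is not truncated at 0. *)
Lemma Lp_norm_cvg_right {V : normedModType R[i]} (F : R -> R -> V) (K N : R) :
  (forall h : R, 0 < h -> h <= 1 -> strongly_measurable Rplus (F h)) ->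
  (forall h t : R, 0 < h -> h <= 1 -> 0 <= t -> nrm (F h t) <= K) ->
  (forall h t : R, 0 < h -> h <= 1 -> N <= t -> F h t = 0) ->
  (forall t e : R, 0 < t -> 0 < e -> exists2 d : R, 0 < d &
    forall h : R, 0 < h -> h <= d -> nrm (F h t) <= e) ->
  Lp_norm p (F h) @[h --> (0 : R)^'+] --> 0%E.
Proof.
move=> sF bF zF cF; have mR := @measurable_Rplus R.
apply/cvge_at_rightP => u [u0 cu].
(* The assumptions concern steps [h <= 1]; clipping the sequence at 1 alters finitely many terms. *)
pose v n : R := Num.min (u n) 1.
have v0 n : 0 < v n by rewrite lt_min u0 ltr01.
have v1 n : v n <= 1 by rewrite ge_min lexx orbT.
have K0 : 0 <= K by exact: le_trans (nrm_ge0 _) (bF 1 0 ltr01 (lexx 1) (lexx 0)).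
pose N' := Num.max N 0; have N0 : 0 <= N' by rewrite le_max lexx orbT.
pose G (t : R) : R := if (0 <= t) && (t <= N') then K `^ p else 0.
suff lim : Lp_norm p (F (v n)) @[n --> \oo] --> 0%E.
  have pos w : forall n : nat, (0 <= Lp_norm p (F (w n)))%E by move=> n; exact: Lp_norm_ge0.
  apply/cvge0P; first exact: pos.
  move=> e e0; have [n1 h1] := (cvge0P (pos v)).1 lim e e0.
  have /cvgrPdist_le/(_ 1 ltr01)[n2 _ h2] := cu.
  exists (maxn n1 n2) => n; rewrite geq_max => /andP[n1n n2n].
  have un : u n <= 1 by have := h2 n n2n; rewrite /= sub0r normrN gtr0_norm.
  by have := h1 n n1n; rewrite /v (min_idPl un).
apply: (@Lp_norm_dominated R p p1 V (fun n => F (v n)) G).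
- by move=> n; exact: sF.
- apply: measurable_funTS; apply: measurable_fun_ifT; last 2 first.
  + exact: measurable_cst.
  + exact: measurable_cst.
  apply: measurable_and.
  + by apply: measurable_fun_ler; [exact: measurable_cst|exact: measurable_id].
  + by apply: measurable_fun_ler; [exact: measurable_id|exact: measurable_cst].
- apply: (@le_lt_trans _ _ (\int[mu]_(t in `[0%R, N']) (K `^ p)%:E)%E); last first.
    by rewrite integral_cst_itv// ltry.
  apply: le_integral_supp => t; rewrite /G ?lee_fin ?powR_ge0//.
  + by case: ifP; rewrite ?powR_ge0.
  + by move=> _ _; case: ifP; rewrite ?powR_ge0.
  + by move=> _ h; case: ifP => // htN; case: h; rewrite /= in_itv.
- move=> n; apply: aeW => t t0; rewrite /G.
  have [tN|Nt] := leP t N'.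
    rewrite (_ : (0 <= t) = true)//=; apply: ge0_ler_powR; first exact: ltW.
    + by rewrite nnegrE nrm_ge0.
    + by rewrite nnegrE.
    + exact: bF.
  rewrite andbF zF//; last by apply: ltW; move: Nt; rewrite gt_max => /andP[].
  by rewrite nrm0 powR0 ?gt_eqF.
- apply: (ae_imply (ae_neq (0 : R))) => t t0 Rt.
  have tp : 0 < t by rewrite lt_neqAle eq_sym t0.
  apply/cvg_nrmP; apply/cvgr0P; first by move=> n; exact: nrm_ge0.
  move=> e e0; have [d d0 hd] := cF t e tp e0.
  have /cvgrPdist_le/(_ d d0)[N1 _ hN] := cu.
  exists N1 => n Nn; rewrite subr0; apply: hd => //.
  rewrite /v ge_min; have := hN n Nn; rewrite /= sub0r normrN gtr0_norm => // ->//.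
Qed.

(* Banach-Steinhaus: a uniformly bounded family that tends to 0 on a dense subspace
   tends to 0 everywhere. *)
Lemma Lp_density_cvg {V W : normedModType R[i]} (D : R -> (R -> V) -> R -> W) (K : R) : 0 <= K ->
  (forall (h : R) f, 0 < h -> h <= 1 -> Lp p f -> strongly_measurable Rplus (D h f)) ->
  (forall (h : R) f, 0 < h -> h <= 1 -> Lp p f ->
     (Lp_norm p (D h f) <= K%:E * Lp_norm p f)%E) ->
  (forall (h : R) f g, 0 < h -> h <= 1 -> Lp p f -> Lp p g ->
     Lp_eq (D h (f - g)) (D h f - D h g)) ->
  (forall g, Lp p g -> compact_continuous g ->
     Lp_norm p (D h g) @[h --> (0 : R)^'+] --> 0%E) ->
  forall f, Lp p f -> Lp_norm p (D h f) @[h --> (0 : R)^'+] --> 0%E.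
Proof.
move=> K0 sD bD lD cD f hf.
have pos g : forall h : R, (0 <= Lp_norm p (D h g))%E by move=> h; exact: Lp_norm_ge0.
apply/cvge0_at_rightP; first exact: pos.
(* Chosen so that [K * e1 <= e / 2]; the [+ 1] keeps the denominator positive when [K = 0]. *)
move=> e e0; pose e1 := e / (2 * (K + 1)).
have K1 : 0 < K + 1 by rewrite ltr_wpDl.
have e10 : 0 < e1 by rewrite divr_gt0// mulr_gt0.
have [g [cg ng]] := Lp_approximable p1 hf e10.
have hfg : Lp p (f - g).
  split; last by apply: le_lt_trans ng _; rewrite ltry.
  by apply: strongly_measurableB; [exact: measurable_Rplus|case: hf|exact: compact_continuous_sm].
have hg : Lp p g.
  by have := LpB p1 hf hfg; rewrite opprB addrC subrK.
have e20 : 0 < e / 2 by rewrite divr_gt0.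
have [d d0 hd] := (cvge0_at_rightP (pos g)).1 (cD g hg cg) _ e20.
exists (Num.min d 1); first by rewrite lt_min d0 ltr01.
move=> h h0; rewrite le_min => /andP[hd1 h1].
have E : Lp_eq (D h f) (D h (f - g) + D h g).
  have := lD h f g h0 h1 hf hg; move=> E; apply: (ae_imply E) => t Et t0.
  by rewrite fctE Et// !fctE subrK.
rewrite (Lp_norm_ae p1 E).
apply: le_trans (Lp_normD p1 (sD h _ h0 h1 hfg) (sD h _ h0 h1 hg)) _.
apply: (@le_trans _ _ ((K * e1)%:E + (e / 2)%:E)%E).
  apply: leeD; last exact: hd.
  apply: le_trans (bD h _ h0 h1 hfg) _; rewrite EFinM; apply: lee_wpmul2l ng.
  by rewrite lee_fin.
rewrite -EFinD lee_fin /e1.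
have -> : K * (e / (2 * (K + 1))) = (K / (K + 1)) * (e / 2).
  by field; rewrite gt_eqF.
rewrite [leRHS](splitr e) lerD2r.
rewrite -[leRHS]mul1r; apply: ler_wpM2r; first exact: ltW.
by rewrite ler_pdivrMr// mul1r lerDl.
Qed.

Lemma compact_continuous_bounded {V : normedModType R[i]} (g : R -> V) :
  compact_continuous g -> exists2 K : R, 0 <= K & forall t, nrm (g t) <= K.
Proof.
move=> [cg [N hN]]; pose N' := Num.max N 0.
have N0 : 0 <= N' by rewrite le_max lexx orbT.
have cn : {within `[- N', N'], continuous (fun t => nrm (g t))}.
  by apply: continuous_subspaceT => t; exact: cvg_nrm (cg t).
have [c _ hc] := EVT_max (ge0_cp N0).2 cn.
exists (nrm (g c)); first exact: nrm_ge0.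
move=> t; have [tN|Nt] := leP `|t| N'.
  by apply: hc; rewrite in_itv/= -ler_norml.
by rewrite hN ?nrm0 ?nrm_ge0//; move: Nt; rewrite gt_max => /andP[/ltW].
Qed.

End RightLimits.

Lemma exponentially_stableP {R : realType} {X : normedModType R[i]} (U : R -> R -> X -> X) :
  evolution_family U -> exponentially_stable U ->
  exists M o : R, [/\ 1 <= M, o < 0 & forall (t s : R) (x : X), 0 <= s <= t ->
    nrm (U t s x) <= M * expR (o * (t - s)) * nrm x].
Proof.
move=> [bU _ _ _] [M [om [M1 o0 h]]]; exists M, om; split=> // t s x st.
by apply: opnormP; [exact: bU|exact: h].
Qed.

(** * The evolution semigroup and its generator *)

Section EvolutionSemigroup.
Context {R : realType} {X : completeNormedModType R[i]}.
Local Notation mu := (@lebesgue_measure R).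
Variables (p : R) (U : R -> R -> X -> X) (M : R).
Hypotheses (p1 : 1 <= p) (evU : evolution_family U) (M0 : 0 <= M)
  (UM : forall (t s : R) (x : X), 0 <= s <= t -> nrm (U t s x) <= M * nrm x).
Local Notation E := (evolution_semigroup U).

(** Right translation, filled with 0 on [[0, h)], is an isometry of L^p(R_+), so any operator
    dominated by it is bounded. It serves for the semigroup and for the difference of two
    semigroups. *)
Lemma Lp_norm_shift_le {V W : normedModType R[i]} (h k : R) (f : R -> V) (F : R -> W) :
  0 <= h -> 0 <= k -> strongly_measurable Rplus f ->
  (forall t, h <= t -> nrm (F t) <= k * nrm (f (t - h))) ->
  (forall t, t < h -> F t = 0) -> (Lp_norm p F <= k%:E * Lp_norm p f)%E.
Proof.
move=> h0 k0 sf Fle F0; rewrite -(Lp_norm_shift p1 h0 sf).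
apply: Lp_norm_le_scale => //.
  apply: strongly_measurable_cutoff => //; first exact: measurable_Rplus.
  by apply: strongly_measurable_sub (@strongly_measurable_shift _ _ h _ sf) => t [].
apply: aeW => t t0; have [ht|th] := leP h t.
  by rewrite cutoffE ?Fle//= in_itv/= ht.
by rewrite F0// nrm0 mulr_ge0// nrm_ge0.
Qed.

Lemma evolution_between (h t : R) : 0 <= h -> h <= t -> 0 <= t - h <= t.
Proof. by move=> h0 ht; rewrite subr_ge0 ht/= gerBl. Qed.

Lemma evolution_semigroup_sm (h : R) (f : R -> X) : 0 <= h ->
  strongly_measurable Rplus f -> strongly_measurable Rplus (E h f).
Proof.
move=> h0 sf; have mR := @measurable_Rplus R.
have -> : E h f = cutoff `[h, +oo[ (fun t => U t (t - h) (f (t - h))).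
  apply/funext => t; rewrite /evolution_semigroup; case: ifPn => ht.
    by rewrite cutoffE//= in_itv/= ht.
  by rewrite cutoffN//= in_itv/= (negbTE ht).
apply: strongly_measurable_cutoff => //.
apply: (@strongly_measurable_sub _ _ `[h, +oo[%classic); first by move=> t [].
apply: (@strongly_measurable_app _ _ _ _ (fun t => U t (t - h))) => //.
- move=> t /=; rewrite in_itv/= andbT => ht.
  by apply: evolution_blin => //; exact: evolution_between.
- move=> v; pose m (t : R) : R := Num.max h t.
  have hm t : h <= m t by rewrite le_max lexx.
  apply: (@strongly_measurable_ae _ _ _ (fun t => U (m t) (m t - h) v)).
    by apply: aeW => t /=; rewrite in_itv/= andbT => ht; rewrite /m (max_idPr ht).
  apply: strongly_measurable_continuous => // t.
  have cm : m y @[y --> t] --> m t.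
    by apply: (@continuous_max R R (fun=> h) id t); [exact: cvg_cst|exact: cvg_id].
  suff : U (m y) (m y - h) v @[y --> t] --> U (m t) (m t - h) v by [].
  apply: (evolution_cvg evU UM) => //.
  + exact: evolution_between.
  + by apply: nearW => y; exact: evolution_between.
  + by apply: cvgB => //; exact: cvg_cst.
  + exact: cvg_cst.
- exact: strongly_measurable_shift.
Qed.

Lemma evolution_semigroup_norm (h : R) (f : R -> X) : 0 <= h ->
  strongly_measurable Rplus f -> (Lp_norm p (E h f) <= M%:E * Lp_norm p f)%E.
Proof.
move=> h0 sf; apply: (Lp_norm_shift_le h0) => //.
- by move=> t ht; rewrite /evolution_semigroup ht; apply: UM; exact: evolution_between.
- by move=> t th; rewrite /evolution_semigroup leNgt th.
Qed.

Lemma evolution_semigroup_Lp (h : R) (f : R -> X) : 0 <= h -> Lp p f -> Lp p (E h f).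
Proof.
move=> h0 [sf nf]; split; first exact: evolution_semigroup_sm.
apply: le_lt_trans (evolution_semigroup_norm h0 sf) _.
by apply: lte_mul_pinfty; rewrite ?lee_fin.
Qed.

Lemma evolution_semigroupD (s t : R) (f : R -> X) : 0 <= s -> 0 <= t ->
  E (s + t) f = E s (E t f).
Proof.
move=> s0 t0; apply/funext => r; rewrite /evolution_semigroup.
have [sr|rs] := leP s r; last first.
  case: ifPn => // h; have sr : s <= r by apply: le_trans h; rewrite lerDl.
  by move: rs; rewrite ltNge sr.
have srb := evolution_between s0 sr.
rewrite lerBrDl; case: ifPn => str; last by rewrite (blin0 (evolution_blin evU srb)).
have [_ ev _ _] := evU; rewrite opprD addrA; apply: ev.
- by rewrite subr_ge0 lerBrDl.
- by rewrite gerBl.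
- by case/andP: srb.
Qed.

Lemma evolution_semigroup_lin (h : R) (a : R[i]) (f g : R -> X) : 0 <= h ->
  E h (a *: f + g) = a *: E h f + E h g.
Proof.
move=> h0; apply/funext => t; rewrite !fctE /evolution_semigroup.
case: ifPn => ht; last by rewrite scaler0 addr0.
have [lin _] := evolution_blin evU (evolution_between h0 ht).
by rewrite lin.
Qed.

Lemma evolution_semigroupB (h : R) (f g : R -> X) : 0 <= h ->
  E h (f - g) = E h f - E h g.
Proof.
move=> h0; have := evolution_semigroup_lin (-1) g f h0.
by rewrite !scaleN1r addrC => ->; rewrite addrC.
Qed.

Lemma difference_quotient_sm (h : R) (f g : R -> X) : 0 <= h ->
  Lp p f -> Lp p g -> strongly_measurable Rplus ((h^-1)%:C%C *: (E h f - f) - g).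
Proof.
move=> h0 [sf _] [sg _]; have mR := @measurable_Rplus R.
apply: strongly_measurableB => //; apply: strongly_measurableZ => //.
by apply: strongly_measurableB => //; exact: evolution_semigroup_sm.
Qed.

Lemma generatorB (f f' g g' : R -> X) : generator p E f g -> generator p E f' g' ->
  generator p E (f - f') (g - g').
Proof.
move=> [hf hg c1] [hf' hg' c2]; split; [exact: LpB|exact: LpB|].
apply: (cvge_right0_squeeze ltr01 (v := fun h =>
    (Lp_norm p ((h^-1)%:C%C *: (E h f - f) - g)%R +
     Lp_norm p ((h^-1)%:C%C *: (E h f' - f') - g')%R)%E)).
- by move=> h; exact: Lp_norm_ge0.
- move=> h h0 _; have h0' := ltW h0.
  have -> : (h^-1)%:C%C *: (E h (f - f') - (f - f')) - (g - g') =
      ((h^-1)%:C%C *: (E h f - f) - g) - ((h^-1)%:C%C *: (E h f' - f') - g').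
    rewrite (evolution_semigroupB f f' h0').
    rewrite (_ : E h f - E h f' - (f - f') = (E h f - f) - (E h f' - f')); last first.
      by rewrite !opprB addrACA [RHS]addrACA (addrC (- E h f')).
    by rewrite scalerBr !opprB addrACA [RHS]addrACA (addrC (- g)).
  have := Lp_normD p1 (difference_quotient_sm h0' hf hg)
    (strongly_measurableZ (-1) (@measurable_Rplus R) (difference_quotient_sm h0' hf' hg')).
  by rewrite scaleN1r Lp_normN.
- rewrite -[X in _ --> X](adde0 0%E).
  by apply: cvgeD; [by []|exact: c1|exact: c2].
Qed.

(** Telescoping: E^((n+1)h) f - f is the sum of E^(nh) (E^h f - f) and E^(nh) f - f, and E^(nh) has
    norm at most [M] whatever [n]. *)
Lemma semigroup_iter (h : R) (f : R -> X) n : 0 <= h -> Lp p f ->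
  (Lp_norm p (E (n%:R * h) f - f)%R <= n%:R%:E * (M%:E * Lp_norm p (E h f - f)%R))%E.
Proof.
move=> h0 hf; have hEf := LpB p1 (evolution_semigroup_Lp h0 hf) hf.
elim: n => [|n IH].
  rewrite mul0r mul0e (@Lp_norm_ae R p p1 X _ 0) ?Lp_norm0//.
  apply: aeW => t t0; rewrite !fctE /evolution_semigroup t0 subr0.
  by case: evU => _ _ -> //; rewrite subrr.
have nh0 : 0 <= n%:R * h by rewrite mulr_ge0.
have -> : E (n.+1%:R * h) f - f = E (n%:R * h) (E h f - f) + (E (n%:R * h) f - f).
  rewrite -natr1 mulrDl mul1r evolution_semigroupD// evolution_semigroupB//.
  by rewrite addrA subrK.
have hn := LpB p1 (evolution_semigroup_Lp nh0 hf) hf.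
apply: le_trans (Lp_normD p1 _ _) _.
- by apply: evolution_semigroup_sm; [|case: hEf].
- by case: hn.
rewrite -natr1 EFinD ge0_muleDl ?lee_fin// mul1e addeC; apply: leeD; first exact: IH.
by apply: evolution_semigroup_norm; [|case: hEf].
Qed.

(* E^(n h) f - f telescopes, so E^t f = f for every t, whereas E^t f is 0 on [0, t). *)
Lemma generator_ker (f : R -> X) : generator p E f 0 -> Lp_eq f 0.
Proof.
move=> [hf _ cf]; have [sf _] := hf.
have pos g : forall h : R, (0 <= Lp_norm p (g h : R -> X))%E by move=> h; exact: Lp_norm_ge0.
have fixed (n : nat) : Lp_norm p (E n.+1%:R f - f) = 0%E.
  apply/eqP; rewrite eq_le Lp_norm_ge0 andbT; apply/lee_addgt0Pr => e e0; rewrite add0e.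
  have M1 : 0 < M + 1 by rewrite ltr_wpDl.
  pose e1 := e / (n.+1%:R * (M + 1)).
  have e10 : 0 < e1 by rewrite divr_gt0// mulr_gt0.
  have [d d0 hd] := (cvge0_at_rightP (pos _)).1 cf _ e10.
  have [k hk] : exists k : nat, n.+1%:R / k.+1%:R <= d.
    have [k hk] := ltr_add_invr (y := 0) (x := d / n.+1%:R) (divr_gt0 d0 (ltr0Sn _ _)).
    exists k; move: hk; rewrite add0r => /ltW.
    by rewrite ler_pdivlMr ?ltr0Sn// mulrC.
  (* [k.+1] steps of length [h] lead exactly to time [n.+1], and [h <= d] makes the difference
     quotient smaller than [e1]. *)
  pose h := n.+1%:R / k.+1%:R : R.
  have h0 : 0 < h by rewrite divr_gt0// ltr0Sn.
  have := hd h h0 hk; rewrite subr0 Lp_normZ//; last first.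
    apply: strongly_measurableB => //; first exact: measurable_Rplus.
    exact: evolution_semigroup_sm (ltW h0) sf.
  have -> : complex.Re `|(h^-1)%:C%C| = h^-1.
    by rewrite normc_def/= expr0n addr0 sqrtr_sqr ger0_norm// invr_ge0 ltW.
  rewrite lee_pdivrMl// => hE.
  have := semigroup_iter k.+1 (ltW h0) hf.
  have -> : k.+1%:R * h = n.+1%:R by rewrite /h mulrC divfK// gt_eqF ?ltr0Sn.
  move/le_trans; apply.
  apply: (@le_trans _ _ (k.+1%:R%:E * (M%:E * (h%:E * e1%:E)))%E).
    apply: lee_wpmul2l; first by rewrite lee_fin.
    by apply: lee_wpmul2l => //; rewrite lee_fin.
  rewrite -!EFinM lee_fin.
  have -> : k.+1%:R * (M * (h * e1)) = e * (M / (M + 1)).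
    rewrite /h /e1; field; rewrite ?gt_eqF ?ltr0Sn//.
  rewrite -[leRHS]mulr1; apply: ler_wpM2l; first exact: ltW.
  by rewrite ler_pdivrMr// mul1r lerDl.
have ev n : {ae mu, forall t, Rplus t -> t < n.+1%:R -> f t = 0}.
  have se : strongly_measurable Rplus (E n.+1%:R f - f).
    apply: strongly_measurableB => //; first exact: measurable_Rplus.
    exact: evolution_semigroup_sm.
  have E0 := Lp_norm_eq0 p1 se (fixed n); apply: (ae_imply E0) => t h Rt tn.
  have := h Rt; rewrite !fctE /evolution_semigroup leNgt tn sub0r => /eqP.
  by rewrite oppr_eq0 => /eqP.
apply: (ae_imply (ae_foralln ev)) => t h t0.
by apply: (h (Num.truncn t)) => //; exact: truncnS_gt.
Qed.

End EvolutionSemigroup.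

Lemma continuous_max0_subr {R : realType} (h : R) : continuous (fun t : R => Num.max 0 (t - h)).
Proof.
move=> t; apply: (@continuous_max R R (fun=> 0) (fun t => t - h) t); first exact: cvg_cst.
by apply: cvgB; [exact: cvg_id|exact: cvg_cst].
Qed.

Lemma Lp_normB {R : realType} (p : R) {V : normedModType R[i]} (p1 : 1 <= p) (f g : R -> V) :
  strongly_measurable Rplus f -> strongly_measurable Rplus g ->
  (Lp_norm p (f - g)%R <= Lp_norm p f + Lp_norm p g)%E.
Proof.
move=> sf sg; have sN : strongly_measurable Rplus (- g).
  by rewrite -scaleN1r; apply: strongly_measurableZ; [exact: measurable_Rplus|exact: sg].
by have := Lp_normD p1 sf sN; rewrite Lp_normN; exact.
Qed.

Lemma bochner0 {R : realType} {V : completeNormedModType R[i]} (a b : R) :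
  bochner a b (fun=> 0 : V) = 0.
Proof.
have I : bochner_integrable a b (fun=> 0 : V).
  split; first exact: strongly_measurable_cst.
  by under eq_integral do rewrite nrm0; rewrite integral0 ltry.
by have := bochnerB I I; rewrite !subrr.
Qed.

(** The window is truncated at 0 because [evolution_semigroup] vanishes on [[0, h)]; in this form it
    is exactly the difference quotient of the semigroup at [- GG U g], also for [t < h]
    ([mean_resolvent]). *)
Definition volterra_mean {R : realType} {X : normedModType R[i]} (U : R -> R -> X -> X)
    (h : R) (g : R -> X) (t : R) : X :=
  (h^-1)%:C%C *: bochner (Num.max 0 (t - h)) t (fun s => U t s (g s)).

(** * Volterra operator and generator of a stable family *)

Section StableFamily.
Context {R : realType} {X : completeNormedModType R[i]}.
Local Notation mu := (@lebesgue_measure R).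
Variables (p : R) (U : R -> R -> X -> X) (M o : R).
Hypotheses (p1 : 1 <= p) (evU : evolution_family U) (M1 : 1 <= M) (o0 : o < 0)
  (Uexp : forall (t s : R) (x : X), 0 <= s <= t ->
    nrm (U t s x) <= M * expR (o * (t - s)) * nrm x).
Local Notation E := (evolution_semigroup U).

Let M0 : 0 < M. Proof. exact: lt_le_trans M1. Qed.

Lemma stable_uniform (t s : R) (x : X) : 0 <= s <= t -> nrm (U t s x) <= M * nrm x.
Proof.
move=> /[dup] /andP[_ st] /Uexp /le_trans; apply; apply: ler_wpM2r; first exact: nrm_ge0.
rewrite -[leRHS]mulr1; apply: ler_wpM2l; first exact: ltW.
by rewrite -expR0 ler_expR nmulr_rle0// subr_ge0.
Qed.

Lemma stable_integrable (t a b : R) (f : R -> X) : 0 <= a -> b <= t -> Lp p f ->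
  bochner_integrable a b (fun s => U t s (f s)).
Proof.
move=> a0 bt hf; apply: (volterra_integrable evU (ltW M0) stable_uniform) => // T T0.
exact: (Lp_bochner_integrable p1 _ (lexx 0) hf).
Qed.

Lemma bochner_evolution_lin (a b t : R) (k : R[i]) (f g : R -> X) : 0 <= a -> b <= t ->
  Lp p f -> Lp p g ->
  bochner a b (fun s => U t s ((k *: f + g) s)) =
  k *: bochner a b (fun s => U t s (f s)) + bochner a b (fun s => U t s (g s)).
Proof.
move=> a0 bt hf hg; rewrite -bochner_lin; [|exact: stable_integrable..].
apply: bochner_ae; apply: aeW => s; rewrite in_itv/= => /andP[as_ sb].
have st : 0 <= s <= t by rewrite (le_trans a0 as_) (le_trans sb bt).
by have [lin _] := evolution_blin evU st; rewrite !fctE lin.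
Qed.

Lemma GG_lin (k : R[i]) (f g : R -> X) (t : R) : Lp p f -> Lp p g ->
  GG U (k *: f + g) t = k *: GG U f t + GG U g t.
Proof. by move=> hf hg; exact: bochner_evolution_lin. Qed.

Lemma GG_ae (f g : R -> X) (t : R) : Lp_eq f g -> GG U f t = GG U g t.
Proof.
move=> fg; apply: bochner_ae; apply: (ae_imply fg) => s h; rewrite in_itv/= => /andP[s0 _].
by rewrite h.
Qed.

Lemma GG_norm (f : R -> X) : Lp p f -> (Lp_norm p (GG U f) <= (M / - o)%:E * Lp_norm p f)%E.
Proof.
have [k1 k2] := window_kernel_expR (ltW M0) o0.
move=> hf; apply: (@Lp_norm_volterra R X U M evU (ltW M0) stable_uniform p p1 (fun=> 0)
  (fun x => M * expR (o * x)) (M / - o) f _ _ _ _ _ Uexp k1 k2 hf).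
- by rewrite divr_gt0// oppr_gt0.
- by move=> t; exact: cvg_cst.
- by [].
- by move=> t; rewrite mulr_ge0 ?expR_ge0 ?ltW.
- apply: measurable_funM; first exact: measurable_cst.
  by apply: continuous_measurable_fun; have := @continuous_expR_affine R o 0;
    under eq_fun do rewrite addr0.
Qed.

Lemma GG_sm (f : R -> X) : Lp p f -> strongly_measurable Rplus (GG U f).
Proof.
move=> hf; have [sf _] := hf.
apply: (strongly_measurable_volterra evU (ltW M0) stable_uniform (l := fun=> 0)) => //.
- by move=> t; exact: cvg_cst.
- by move=> t t0; rewrite lexx.
- by move=> T _; exact: (Lp_bochner_integrable p1 _ (lexx 0) hf).
Qed.

Lemma GG_bounded : Lp_bounded p (GG U).
Proof.
have k0 : 0 <= M / - o by rewrite divr_ge0 ?ltW// oppr_gt0.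
apply: (Lp_boundedP k0).
- exact: GG_sm.
- by move=> f g _ _ fg; apply: aeW => t _; exact: GG_ae.
- by move=> a f g hf hg; apply: aeW => t _; rewrite GG_lin// !fctE.
- exact: GG_norm.
Qed.

Lemma GG_Lp (f : R -> X) : Lp p f -> Lp p (GG U f).
Proof. by case: GG_bounded => h _ _ _; exact: h. Qed.

Local Notation mean := (volterra_mean U).

Lemma mean_sm (h : R) (g : R -> X) : 0 < h -> Lp p g -> strongly_measurable Rplus (mean h g).
Proof.
move=> h0 hg; apply: strongly_measurableZ; first exact: measurable_Rplus.
apply: (strongly_measurable_volterra evU (ltW M0) stable_uniform
  (l := fun t => Num.max 0 (t - h))).
- exact: continuous_max0_subr.
- by move=> t t0; rewrite le_max lexx/= ge_max t0 gerBl ltW.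
- by case: hg.
- by move=> T _; exact: (Lp_bochner_integrable p1 _ (lexx 0) hg).
Qed.

(** The Schur constant of the window kernel is [M * h], and the factor [h] cancels against [h^-1]:
    the bound is uniform in [h], as the density argument requires. *)
Lemma mean_norm (h : R) (g : R -> X) : 0 < h -> Lp p g ->
  (Lp_norm p (mean h g) <= M%:E * Lp_norm p g)%E.
Proof.
move=> h0 hg; have [k1 k2] := window_kernel_cst (ltW M0) (ltW h0).
have := Lp_norm_volterra evU (ltW M0) stable_uniform p1 (l := fun t => Num.max 0 (t - h))
  (w := fun=> M) (mulr_gt0 M0 h0) (@continuous_max0_subr R h) _ _ _ _ k1 k2 hg.
move=> bd; have {}bd := bd _ _ _ _.
have sm : strongly_measurable Rplus (fun t => bochner (Num.max 0 (t - h)) t (fun s => U t s (g s))).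
  have := @strongly_measurableZ R X Rplus (h%:C%C) _ (@measurable_Rplus R) (mean_sm h0 hg).
  rewrite /volterra_mean (_ : h%:C%C *: _ =
      (fun t => bochner (Num.max 0 (t - h)) t (fun s => U t s (g s))))//.
  apply/funext => t; rewrite fctE scalerA -rmorphM/= mulfV ?gt_eqF// scale1r//.
apply: (@le_trans _ _ (Lp_norm p ((h^-1)%:C%C *:
    (fun t => bochner (Num.max 0 (t - h)) t (fun s => U t s (g s)))))).
  exact: lexx.
rewrite (Lp_normZ p1 _ sm).
have -> : complex.Re `|(h^-1)%:C%C| = h^-1.
  by rewrite normc_def/= expr0n addr0 sqrtr_sqr ger0_norm// invr_ge0 ltW.
rewrite lee_pdivrMl// muleA -EFinM mulrC; apply: bd.
- by move=> t _; rewrite le_max lexx.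
- by move=> t; exact: ltW.
- exact: measurable_cst.
- exact: stable_uniform.
Qed.

(** For continuous [g] the integrand [U t s (g s)] tends to [g t] as [s] increases to [t], so the
    means converge at each [t > 0]. For [h <= 1] and [t >= N + 1] the window lies beyond [N], where
    [g] vanishes. *)
Lemma mean_compact (g : R -> X) : Lp p g -> compact_continuous g ->
  Lp_norm p (mean h g - g) @[h --> (0 : R)^'+] --> 0%E.
Proof.
move=> hg cg; have [C C0 hC] := compact_continuous_bounded cg; have [cont [N hN]] := cg.
have [sg _] := hg; have mR := @measurable_Rplus R.
apply: (@Lp_norm_cvg_right R p p1 X (fun h => mean h g - g) (M * C + C) (N + 1)).
- by move=> h h0 _; apply: strongly_measurableB => //; exact: mean_sm.
- move=> h t h0 h1 t0; rewrite !fctE; apply: le_trans (nrmD _ _) _; rewrite nrmN.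
  apply: lerD; last exact: hC.
  have mt : Num.max 0 (t - h) <= t by rewrite ge_max t0 gerBl ltW.
  have m0 : 0 <= Num.max 0 (t - h) by rewrite le_max lexx.
  have [sU _] := stable_integrable m0 (lexx t) hg.
  have [|_ bd] := bochner_bound mt (mulr_ge0 (ltW M0) C0) sU.
    apply: aeW => s /=; rewrite in_itv/= => /andP[ms st].
    apply: le_trans (stable_uniform _ _) _; first by rewrite st (le_trans m0).
    by apply: ler_wpM2l; [exact: ltW|exact: hC].
  rewrite /volterra_mean nrmZR ger0_norm ?invr_ge0 ?(ltW h0)// ler_pdivrMl//; apply: le_trans bd _.
  rewrite mulrC; apply: ler_wpM2r; first by rewrite mulr_ge0// ltW.
  by rewrite lerBlDr -lerBlDl le_max lexx orbT.
- move=> h t h0 h1 Nt; rewrite !fctE.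
  have Nth : N <= t - h by rewrite lerBrDr (le_trans _ Nt)// lerD2l.
  have -> : g t = 0 by apply: hN; apply: le_trans (ler_norm t); rewrite (le_trans Nth)// gerBl ltW.
  rewrite subr0 /mean (@bochner_ae _ _ _ _ _ (fun=> 0)).
    by rewrite bochner0 scaler0.
  apply: aeW => s; rewrite in_itv/= => /andP[+ st]; rewrite ge_max => /andP[s0 ths].
  rewrite hN; first by apply: blin0; apply: evolution_blin => //; rewrite s0.
  by apply: le_trans (ler_norm s); exact: le_trans Nth ths.
- move=> t e t0 e0.
  pose b (s : R) : R := Num.max 0 (Num.min s t).
  have cb : b s @[s --> t] --> t.
    rewrite -[X in _ --> X](_ : b t = t); last by rewrite /b minxx (max_idPr (ltW t0)).
    apply: (@continuous_max R R (fun=> 0) (fun s => Num.min s t) t); first exact: cvg_cst.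
    by apply: (@continuous_min R R id (fun=> t) t); [exact: cvg_id|exact: cvg_cst].
  have bt s : 0 <= b s <= t by rewrite /b le_max lexx/= ge_max (ltW t0) ge_min lexx orbT.
  have lim : U t (b s) (g (b s)) @[s --> t] --> U t t (g t).
    apply: (evolution_cvg evU stable_uniform (a := fun=> t) (b := b) (y := fun s => g (b s))).
    + by rewrite lexx ltW.
    + exact: nearW.
    + exact: cvg_cst.
    + exact: cb.
    + exact: (cvg_comp _ _ cb (cont t)).
  have [_ _ Uid _] := evU; rewrite (Uid t (ltW t0)) in lim.
  have /cvg_nrmP/cvgrPdist_le/(_ e e0)[d /= d0 hd] := lim.
  (* [h <= t] avoids the truncation at 0, and [d / 2] turns the closed bound on [h] into the strict
     one on distances. *)
  exists (Num.min (d / 2) t); first by rewrite lt_min t0 divr_gt0.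
  move=> h h0; rewrite le_min => /andP[hd2 ht]; rewrite !fctE /volterra_mean.
  have th0 : 0 <= t - h by rewrite subr_ge0.
  rewrite (max_idPr th0).
  have tht : t - h <= t by rewrite gerBl ltW.
  have [sU _] := stable_integrable th0 (lexx t) hg.
  have hs (s : R) : t - h <= s <= t -> nrm (U t s (g s) - g t) <= e.
    move=> /andP[ths st]; have s0 := le_trans th0 ths.
    have bs : b s = s by rewrite /b (min_idPl st) (max_idPr s0).
    have ts : `|t - s| < d.
      rewrite ger0_norm ?subr_ge0//; apply: (@le_lt_trans _ _ h).
        by rewrite lerBlDr -lerBlDl.
      by apply: le_lt_trans hd2 _; rewrite ltr_pdivrMr// mulr2n mulrDr mulr1 ltrDl.
    by have := hd s ts; rewrite /= bs sub0r normrN ger0_norm ?nrm_ge0.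
  have := bochner_mean tht sU hs; rewrite opprB addrCA subrr addr0 => bd.
  have -> : (h^-1)%:C%C *: bochner (t - h) t (fun s => U t s (g s)) - g t =
      (h^-1)%:C%C *: (bochner (t - h) t (fun s => U t s (g s)) - h%:C%C *: g t).
    by rewrite scalerBr scalerA -rmorphM/= mulVf ?gt_eqF// scale1r.
  rewrite nrmZR ger0_norm ?invr_ge0 ?(ltW h0)// ler_pdivrMl// mulrC; exact: bd.
Qed.

Lemma meanB (h t : R) (f g : R -> X) : Lp p f -> Lp p g ->
  mean h (f - g) t = mean h f t - mean h g t.
Proof.
move=> hf hg; have m0 : 0 <= Num.max 0 (t - h) by rewrite le_max lexx.
rewrite /volterra_mean -scalerBr; apply: (congr1 (fun x => _ *: x)).
have h' := bochner_evolution_lin (-1) m0 (lexx t) hg hf; rewrite !scaleN1r [- g + f]addrC in h'.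
by rewrite h' addrC.
Qed.

Lemma mean_cvg (g : R -> X) : Lp p g -> Lp_norm p (mean h g - g) @[h --> (0 : R)^'+] --> 0%E.
Proof.
have mR := @measurable_Rplus R.
apply: (@Lp_density_cvg R p p1 X X (fun h g => mean h g - g) (M + 1)).
- by rewrite addr_ge0 ?ltW.
- by move=> h f h0 _ hf; apply: strongly_measurableB => //; [exact: mean_sm|case: hf].
- move=> h f h0 _ hf; have [sf _] := hf.
  apply: le_trans (Lp_normB p1 (mean_sm h0 hf) sf) _.
  rewrite EFinD ge0_muleDl ?lee_fin ?ler01 ?(ltW M0)// mul1e.
  by apply: leeD; [exact: mean_norm|exact: lexx].
- move=> h f g' h0 _ hf hg'; apply: aeW => t t0.
  rewrite -[LHS]/(mean h (f - g') t - (f t - g' t)).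
  rewrite -[RHS]/((mean h f t - f t) - (mean h g' t - g' t)) (meanB _ _ hf hg').
  by rewrite !opprB addrACA [RHS]addrACA (addrC (- f t)).
- by move=> g' hg' cg'; exact: mean_compact.
Qed.

(** Applying [U t (t - h)] under the integral shows that E^h G g (t) is the part of G g (t) over
    [[0, t - h]]; the part over the window remains. For [t < h] the semigroup contributes 0 and the
    window is all of [[0, t]]. *)
Lemma mean_resolvent (h : R) (g : R -> X) (t : R) : 0 < h -> Lp p g -> 0 <= t ->
  (h^-1)%:C%C *: (E h (- GG U g) - (- GG U g)) t = mean h g t.
Proof.
move=> h0 hg t0; rewrite /volterra_mean !fctE opprK /evolution_semigroup; congr (_ *: _).
have [ht|th] := leP h t; last first.
  rewrite add0r /GG (max_idPl _)// subr_le0; exact: ltW.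
have th0 : 0 <= t - h by rewrite subr_ge0.
have tht : t - h <= t by rewrite gerBl ltW.
rewrite (max_idPr th0) blinN; last by apply: evolution_blin => //; rewrite th0.
have I := Lp_bochner_integrable p1 (t - h) (lexx 0) hg.
rewrite /GG (evolution_bochner evU (ltW M0) stable_uniform (lexx 0) th0 (lexx _) tht I).
rewrite (bochner_split th0 tht (stable_integrable (lexx 0) (lexx t) hg)).
by rewrite addKr.
Qed.

Lemma generator_GG (g : R -> X) : Lp p g -> generator p E (- GG U g) g.
Proof.
move=> hg; have hG := LpN p1 (GG_Lp hg); split => //.
apply: (cvge_right0_squeeze ltr01 _ _ (mean_cvg hg)).
- by move=> h; exact: Lp_norm_ge0.
- move=> h h0 _; rewrite (@Lp_norm_ae R p p1 X _ (mean h g - g))//.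
  apply: aeW => t t0; have := mean_resolvent h0 hg t0; rewrite !fctE => <-//.
Qed.

Lemma GG_inverse : bounded_inverse p (generator p E) (fun g => - GG U g).
Proof.
have k0 : 0 <= M / - o by rewrite divr_ge0 ?ltW// oppr_gt0.
split; last 2 first.
- exact: generator_GG.
(* If the generator maps [f] to [g], it maps [f + GG U g] to 0, and [generator_ker] applies. *)
- move=> f g fg; have [hf hg _] := fg; have := generatorB p1 evU stable_uniform fg (generator_GG hg).
  rewrite subrr => /(generator_ker p1 evU (ltW M0) stable_uniform) h.
  apply: (ae_imply h) => t ht Rt; have := ht Rt; rewrite !fctE => /eqP.
  by rewrite subr_eq0 => /eqP ->.
apply: (Lp_boundedP k0).
- move=> f hf; rewrite -scaleN1r; apply: strongly_measurableZ; first exact: measurable_Rplus.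
  exact: GG_sm.
- by move=> f g _ _ fg; apply: aeW => t _; exact: (congr1 (fun x => - x) (GG_ae t fg)).
- move=> a f g hf hg; apply: aeW => t _.
  apply: (etrans (congr1 (fun x => - x) (GG_lin a t hf hg))).
  by apply: (etrans (opprD _ _)); rewrite -scalerN.
- by move=> f hf; rewrite Lp_normN; exact: GG_norm.
Qed.

End StableFamily.

(** * Perturbed evolution families *)

Section LinfComposition.
Context {R : realType}.
Local Notation mu := (@lebesgue_measure R).

Lemma Linf_norm_le {V W : normedModType R[i]} (D : R -> V -> W) (k : R) : 0 <= k ->
  {ae mu, forall t, 0 <= t -> forall v, nrm (D t v) <= k * nrm v} ->
  (Linf_norm D <= k%:E)%E.
Proof.
move=> k0 h; apply/ess_supP; apply: (ae_imply h) => t ht; rewrite /patch.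
case: ifPn => [/set_mem t0|_]; last by rewrite -[point]/(0%E) lee_fin.
by apply: opnorm_le => // x; exact: ht.
Qed.

Lemma Linf_s_comp {V W Z : normedModType R[i]} (D : R -> W -> Z) (D' : R -> V -> W) :
  Linf_s D -> Linf_s D' -> Linf_s (fun t v => D t (D' t v)).
Proof.
move=> LD LD'; have [k k0 hk] := Linf_bound LD; have [k' k0' hk'] := Linf_bound LD'.
have [bD _ _] := LD; have [bD' sD' _] := LD'; split.
- move=> t t0; have [m m0 hm] := blin_bound (bD t t0); have [m' m0' hm'] := blin_bound (bD' t t0).
  apply: (@bounded_linearP _ _ _ _ (m * m')).
    move=> a x y; have [lin _] := bD t t0; have [lin' _] := bD' t t0.
    by rewrite lin' lin.
  by move=> x; apply: le_trans (hm _) _; rewrite -mulrA; apply: ler_wpM2l.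
- by move=> v; apply: Linf_sm => //; exact: measurable_Rplus.
- apply: (@le_lt_trans _ _ (k * k')%:E); last exact: ltry.
  apply: Linf_norm_le; first exact: mulr_ge0.
  apply: (ae_imply2 hk hk') => t h h' t0 v.
  by apply: le_trans (h t0 _) _; rewrite -mulrA; apply: ler_wpM2l => //; exact: h'.
Qed.

End LinfComposition.

Section Perturbation.
Context {R : realType} {X : completeNormedModType R[i]}.
Local Notation mu := (@lebesgue_measure R).
Variables (U : R -> R -> X -> X) (M : R) (F : R -> X -> X) (K : R).
Hypotheses (evU : evolution_family U) (M0 : 0 <= M)
  (UM : forall (t s : R) (x : X), 0 <= s <= t -> nrm (U t s x) <= M * nrm x)
  (LF : Linf_s F) (K0 : 0 <= K)
  (FK : {ae mu, forall t, 0 <= t -> forall v, nrm (F t v) <= K * nrm v}).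
Implicit Types (t s r N : R) (x y : X) (w : R -> X) (W : R -> R -> X -> X).

(** The [+ 1] keeps the rate positive, hence invertible, when [M * K = 0]. *)
Definition growth_rate : R := 2 * M * K + 1.
Local Notation c := growth_rate.

Lemma growth_rate_gt0 : 0 < c.
Proof. by rewrite /c ltr_wpDl// !mulr_ge0. Qed.
Let c0 := growth_rate_gt0.

Lemma expR_growth_ge1 s t : s <= t -> 1 <= expR (c * (t - s)).
Proof. by move=> st; rewrite -expR0 ler_expR; apply: mulr_ge0; [exact: ltW|rewrite subr_ge0]. Qed.

Definition volterra s t w : X := bochner s t (fun r => U t r (F r (w r))).

Lemma perturbation_sm a b w : 0 <= a -> strongly_measurable `[a, b] w ->
  strongly_measurable `[a, b] (fun r => F r (w r)).
Proof.
by move=> a0; apply: Linf_sm => // r /=; rewrite in_itv/= => /andP[ar _]; exact: le_trans ar.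
Qed.

(* [c] is chosen so that the Volterra operator is a contraction by [1/2] for the weight
   [exp (c (t - s))]. *)
Lemma volterra_contraction s t N w : 0 <= s -> s <= t -> 0 <= N ->
  strongly_measurable `[s, t] w ->
  (forall r, s <= r <= t -> nrm (w r) <= N * expR (c * (r - s))) ->
  bochner_integrable s t (fun r => U t r (F r (w r))) /\
  nrm (volterra s t w) <= N / 2 * expR (c * (t - s)).
Proof.
move=> s0 st N0 sw wN.
pose G r := M * K * N * expR (c * r + - (c * s)).
have MKN : 0 <= M * K * N by rewrite !mulr_ge0.
apply: (@bochner_le _ _ _ _ _ G).
- by apply: (evolution_sm evU UM s0 (lexx t)); exact: perturbation_sm.
- apply: (ae_imply FK) => r h /=; rewrite in_itv/= => /andP[sr rt].
  have r0 : 0 <= r by exact: le_trans sr.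
  apply: le_trans (UM _ _) _; first by rewrite r0.
  rewrite /G -!mulrA; apply: ler_wpM2l => //; apply: le_trans (h r0 _) _.
  by apply: ler_wpM2l => //; rewrite -mulrBr; apply: wN; rewrite sr.
- by move=> r; rewrite mulr_ge0// expR_ge0.
- have -> : (\int[mu]_(r in `[s, t]) (G r)%:E)%E =
      (\int[mu]_(r in `[s, t]) ((M * K * N / c)%:E * (c * expR (c * r + - (c * s)))%:E))%E.
    apply: eq_integral => r _; rewrite -EFinM mulrA divfK//; exact: lt0r_neq0.
  rewrite ge0_integralZl_EFin//; last 3 first.
  + by move=> r _; rewrite lee_fin mulr_ge0 ?expR_ge0 ?(ltW c0).
  + apply: measurable_funTS; apply/measurable_EFinP.
    by apply: continuous_measurable_fun; exact: continuous_derive_expR_affine.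
  + by rewrite divr_ge0// ltW.
  rewrite integral_expR_affine// subrr expR0 -EFinM lee_fin -mulrBr.
  apply: (@le_trans _ _ (M * K * N / c * expR (c * (t - s)))).
    by apply: ler_wpM2l; [rewrite divr_ge0// ltW|rewrite gerBl].
  apply: ler_wpM2r; first exact: expR_ge0.
  rewrite ler_pdivrMr// /growth_rate; lra.
Qed.

Lemma cvg_geometric_half (C : R) : C / 2 ^+ n @[n --> \oo] --> (0 : R).
Proof.
rewrite -[X in _ --> X](mulr0 C); apply: cvgMr; under eq_fun do rewrite -exprVn.
by apply: cvg_expr; rewrite ger0_norm ?invr_ge0//; lra.
Qed.

Lemma le_geometric0 (C z : R) : (forall n : nat, z <= C / 2 ^+ n) -> z <= 0.
Proof.
move=> h; rewrite leNgt; apply/negP => z0.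
have /cvgrPdist_lt/(_ z z0)[n _ hn] := cvg_geometric_half C.
have := hn n (leqnn n); rewrite /= sub0r normrN => /(le_lt_trans (ler_norm _)).
by rewrite ltNge h.
Qed.

(** Each use of the equation halves the weighted bound, so [nrm (w t)] is at most
    [N / 2 ^+ n * expR (c * (t - s))] for every [n]. *)
Lemma volterra_unique s w N : 0 <= s -> 0 <= N ->
  (forall t, s <= t -> strongly_measurable `[s, t] w) ->
  (forall r, s <= r -> nrm (w r) <= N * expR (c * (r - s))) ->
  (forall t, s <= t -> w t = volterra s t w) -> forall t, s <= t -> w t = 0.
Proof.
move=> s0 N0 sw wN wE.
have iter n : forall t, s <= t -> nrm (w t) <= N / 2 ^+ n * expR (c * (t - s)).
  elim: n => [|n IH] t st; first by rewrite expr0 divr1; exact: wN.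
  rewrite {1}(wE t st) exprSr invfM mulrA.
  have Nn0 : 0 <= N / 2 ^+ n by rewrite divr_ge0// exprn_ge0.
  have [_ h] := volterra_contraction s0 st Nn0 (sw t st) (fun r hr => IH r (andP hr).1).
  exact: h.
move=> t st; apply: nrm_eq0; apply/eqP; rewrite eq_le nrm_ge0 andbT.
apply: (@le_geometric0 (N * expR (c * (t - s)))) => n.
by rewrite mulrAC; exact: iter.
Qed.

(** The properties of a candidate family that a Picard step preserves. Continuity is put
    sequentially, the form in which [cvg_volterra] delivers it. *)
Definition admissible N W : Prop :=
  [/\ forall t s x, 0 <= s <= t -> nrm (W t s x) <= N * expR (c * (t - s)) * nrm x,
      forall t s (k : R[i]) x y, 0 <= s <= t -> W t s (k *: x + y) = k *: W t s x + W t s y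
    & forall (a b : nat -> R) t s x, (forall n, 0 <= b n <= a n) -> 0 <= s <= t ->
        a n @[n --> \oo] --> t -> b n @[n --> \oo] --> s ->
        W (a n) (b n) x @[n --> \oo] --> W t s x].

Lemma admissible_sm N W s t x : admissible N W -> 0 <= s ->
  strongly_measurable `[s, t] (fun r => W r s x).
Proof.
move=> [_ _ cW] s0; pose m r : R := Num.max s r.
apply: (@strongly_measurable_ae _ _ _ (fun r => W (m r) s x)).
  by apply: aeW => r /=; rewrite in_itv/= => /andP[sr _]; rewrite /m (max_idPr sr).
apply: strongly_measurable_continuous => //; apply: seq_continuous => u r ur.
have sm' r' : s <= m r' by rewrite le_max lexx.
apply: (cW (fun n => m (u n)) (fun=> s)).
- by move=> n; rewrite s0 sm'.
- by rewrite s0 sm'.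
- have cm : continuous m.
    by move=> y; apply: (@continuous_max R R (fun=> s) id y); [exact: cvg_cst|exact: cvg_id].
  exact: (cvg_comp _ _ ur (cm r)).
- exact: cvg_cst.
Qed.

Lemma volterra_cvg N W (a b : nat -> R) t s x : 0 <= N -> admissible N W ->
  (forall n, 0 <= b n <= a n) -> 0 <= s <= t ->
  a n @[n --> \oo] --> t -> b n @[n --> \oo] --> s ->
  volterra (b n) (a n) (fun r => W r (b n) x) @[n --> \oo] -->
  volterra s t (fun r => W r s x).
Proof.
move=> N0 aW ba st ca cb; have [bW lW cW] := aW.
have [T1 hT1] := cvg_upper_bound ca; pose T := Num.max T1 t.
have [s0 st'] := andP st.
have T0 : 0 <= T by rewrite le_max (le_trans s0 st') orbT.
pose k := K * (N * expR (c * T) * nrm x).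
have k0 : 0 <= k by rewrite !mulr_ge0 ?expR_ge0 ?nrm_ge0.
have dom b' a' : 0 <= b' <= a' -> a' <= T ->
    {ae mu, forall r, b' <= r <= a' -> nrm (F r (W r b' x)) <= k}.
  move=> /andP[b0 _] aT; apply: (ae_imply FK) => r h /andP[br ra].
  have r0 : 0 <= r by exact: le_trans br.
  apply: le_trans (h r0 _) _; apply: ler_wpM2l => //.
  apply: le_trans (bW r b' x _) _; first by rewrite b0.
  apply: ler_wpM2r; first exact: nrm_ge0.
  apply: ler_wpM2l => //; rewrite ler_expR; apply: ler_wpM2l; first exact: ltW.
  by rewrite lerBlDr (le_trans ra)// (le_trans aT)// lerDl.
apply: (@cvg_volterra R X U M evU M0 UM a b t s T (fun n r => F r (W r (b n) x))
  (fun r => F r (W r s x)) (fun=> k)).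
- exact: ba.
- by move=> n; rewrite le_max hT1.
- exact: st.
- by rewrite le_max lexx orbT.
- exact: ca.
- exact: cb.
- by move=> n; have /andP[b0 _] := ba n; apply: perturbation_sm => //; exact: admissible_sm aW b0.
- by apply: perturbation_sm => //; exact: admissible_sm aW s0.
- by [].
- exact: measurable_cst.
- by rewrite integral_cst_itv// ltry.
- by move=> n; apply: dom => //; rewrite le_max hT1.
- by apply: dom => //; rewrite le_max lexx orbT.
- apply: aeW => r /andP[sr rt]; have r0 : 0 <= r by rewrite (le_trans s0)// ltW.
  have [bF _ _] := LF; apply: (blin_cvg (bF r r0)).
  have near_r : \forall n \near \oo, b n <= r.
    by apply: filterS (cvgr_lt _ cb _ sr) => n; exact: ltW.
  (* For small [n] the starting time [b n] may exceed [r]; the minimum keeps the pair of times in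
     the domain and equals [b n] eventually. *)
  have lim : W r (Num.min (b n) r) x @[n --> \oo] --> W r s x.
    apply: (cW (fun=> r)).
    + move=> n; rewrite ge_min lexx orbT andbT le_min r0 andbT.
      by have /andP[] := ba n.
    + by rewrite s0 ltW.
    + exact: cvg_cst.
    + apply: cvg_trans cb; apply: near_eq_cvg; apply: filterS near_r => n br.
      by rewrite (min_idPl br).
  apply: cvg_trans lim; apply: near_eq_cvg; apply: filterS near_r => n br.
  by rewrite (min_idPl br).
Qed.

Lemma volterra_lin s t (k : R[i]) w w' : 0 <= s ->
  bochner_integrable s t (fun r => U t r (F r (w r))) ->
  bochner_integrable s t (fun r => U t r (F r (w' r))) ->
  volterra s t (fun r => k *: w r + w' r) = k *: volterra s t w + volterra s t w'.
Proof.
move=> s0 I I'; rewrite /volterra -(bochner_lin k I I'); apply: bochner_ae; apply: aeW => r.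
rewrite in_itv/= => /andP[sr rt]; have r0 : 0 <= r by exact: le_trans sr.
have [bF _ _] := LF; have [linF _] := bF r r0.
have [linU _] := @evolution_blin _ _ _ evU t r (introT andP (conj r0 rt)).
by rewrite linF linU.
Qed.

Lemma volterraB s t w w' : 0 <= s ->
  bochner_integrable s t (fun r => U t r (F r (w r))) ->
  bochner_integrable s t (fun r => U t r (F r (w' r))) ->
  volterra s t w - volterra s t w' = volterra s t (fun r => w r - w' r).
Proof.
move=> s0 I I'; have := volterra_lin (-1) s0 I' I; rewrite scaleN1r addrC => <-.
by apply: (congr1 (volterra s t)); apply/funext => r; rewrite scaleN1r addrC.
Qed.

Lemma admissible_integrable N W s t x : 0 <= N -> admissible N W -> 0 <= s -> s <= t ->
  bochner_integrable s t (fun r => U t r (F r (W r s x))).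
Proof.
move=> N0 aW s0 st; have [bW _ _] := aW.
have [|//] := volterra_contraction s0 st (mulr_ge0 N0 (nrm_ge0 x)) (admissible_sm t x aW s0).
by move=> r /andP[sr _]; rewrite mulrAC; apply: bW; rewrite s0.
Qed.

(** The constant [2 * M] reproduces itself: the free term contributes [M], and the contraction
    halves [2 * M] to [M]. *)
Lemma admissible_step W : admissible (2 * M) W ->
  admissible (2 * M) (fun t s x => U t s x + volterra s t (fun r => W r s x)).
Proof.
move=> aW; have [bW lW cW] := aW; have N0 : 0 <= 2 * M by rewrite mulr_ge0.
have bound t s x (st : 0 <= s <= t) := volterra_contraction (andP st).1 (andP st).2
  (mulr_ge0 N0 (nrm_ge0 x)) (admissible_sm t x aW (andP st).1).
have bnd r s x : 0 <= s -> s <= r -> nrm (W r s x) <= 2 * M * nrm x * expR (c * (r - s)).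
  by move=> s0 sr; rewrite mulrAC; apply: bW; rewrite s0.
split.
- move=> t s x st; have /andP[s0 st'] := st.
  have [|_ h] := bound t s x st; first by move=> r /andP[sr _]; exact: bnd.
  apply: le_trans (nrmD _ _) (le_trans (lerD (UM x st) h) _).
  have := ler_wpM2l (mulr_ge0 M0 (nrm_ge0 x)) (expR_growth_ge1 st'); lra.
- move=> t s k x y st; have /andP[s0 st'] := st.
  have -> : volterra s t (fun r => W r s (k *: x + y)) =
      volterra s t (fun r => k *: W r s x + W r s y).
    apply: bochner_ae; apply: aeW => r; rewrite in_itv/= => /andP[sr _].
    by rewrite lW// s0.
  rewrite (volterra_lin k s0 (admissible_integrable x N0 aW s0 st')
    (admissible_integrable y N0 aW s0 st')).
  have [linU _] := evolution_blin evU st.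
  by rewrite linU scalerDr addrACA.
- move=> a b t s x ba st ca cb; have h := volterra_cvg N0 aW ba st ca cb.
  apply: cvgD; last exact: h.
  by apply: (evolution_cvg evU UM (y := fun=> x)) => //; [exact: nearW|exact: cvg_cst].
Qed.

Lemma nrm_geometric_cvg (u : nat -> X) (D : R) :
  (forall n, nrm (u n.+1 - u n) <= D / 2 ^+ n) ->
  exists2 l, u n @[n --> \oo] --> l & forall n, nrm (l - u n) <= 2 * D / 2 ^+ n.
Proof.
move=> uD.
have D0 : 0 <= D by have := uD 0%N; rewrite expr0 divr1; apply: le_trans; exact: nrm_ge0.
have tail n k : nrm (u (k + n)%N - u n) <= 2 * D / 2 ^+ n.
  (* The subtracted term is the remainder of the geometric series; with it the induction on [k]
     closes exactly. *)
  apply: (@le_trans _ _ (2 * D / 2 ^+ n - 2 * D / 2 ^+ (k + n))); last first.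
    by rewrite gerBl divr_ge0 ?exprn_ge0// mulr_ge0.
  elim: k => [|k IH]; first by rewrite add0n !subrr nrm0.
  apply: le_trans (nrm_le_sub _ (u (k + n)%N) _) _.
  apply: le_trans (lerD (uD _) IH) _.
  have -> : 2 * D / 2 ^+ (k.+1 + n) = D / 2 ^+ (k + n).
    by rewrite addSn exprS invfM mulrA [2 * D]mulrC mulfK.
  have -> : 2 * D / 2 ^+ (k + n) = D / 2 ^+ (k + n) + D / 2 ^+ (k + n).
    by rewrite -mulrA mulr_natl mulr2n.
  lra.
have [l ul] : exists l : X, u n @[n --> \oo] --> l.
  apply: nrm_cauchy_cvg => e e0.
  have e2 : 0 < e / 2 by rewrite divr_gt0.
  have /cvgrPdist_lt/(_ _ e2)[n _ hn] := cvg_geometric_half (2 * D).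
  have small : 2 * D / 2 ^+ n < e / 2.
    by have := hn n (leqnn n); rewrite /= sub0r normrN => /(le_lt_trans (ler_norm _)).
  exists n => i j ni nj; rewrite (splitr e).
  apply: le_lt_trans (nrm_le_sub _ (u n) _) _; apply: ltrD.
    by rewrite -(subnK ni); apply: le_lt_trans small; exact: tail.
  by rewrite nrmBC -(subnK nj); apply: le_lt_trans small; exact: tail.
exists l => // n.
have lim : nrm (u m - u n) @[m --> \oo] --> nrm (l - u n).
  by apply: cvg_nrm; apply: cvgB => //; exact: cvg_cst.
by apply: (cvg_le_lim (N := n) lim) => m nm; rewrite -(subnK nm); exact: tail.
Qed.

(** The partial sums of the Dyson-Phillips series for the perturbation [F]. *)
Fixpoint picard (n : nat) t s x : X :=
  if n is n'.+1 then U t s x + volterra s t (fun r => picard n' r s x) else U t s x.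

Let N0 : 0 <= 2 * M. Proof. by rewrite mulr_ge0. Qed.

Lemma picard_admissible n : admissible (2 * M) (picard n).
Proof.
elim: n => [|n IH]; last exact: admissible_step IH.
split=> /=.
- move=> t s x st; have /andP[_ st'] := st; apply: le_trans (UM x st) _.
  have := ler_wpM2l (mulr_ge0 M0 (nrm_ge0 x)) (expR_growth_ge1 st').
  have : 0 <= M * nrm x by rewrite mulr_ge0// nrm_ge0.
  lra.
- by move=> t s k x y st; have [lin _] := evolution_blin evU st; rewrite lin.
- move=> a b t s x ba st ca cb.
  by apply: (evolution_cvg evU UM (y := fun=> x)) => //; [exact: nearW|exact: cvg_cst].
Qed.

Lemma picard_diff n t s x : 0 <= s -> s <= t ->
  nrm (picard n.+1 t s x - picard n t s x) <=
  2 * M * nrm x / 2 ^+ n * expR (c * (t - s)).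
Proof.
move=> s0 st; have Nx : 0 <= 2 * M * nrm x by rewrite mulr_ge0// nrm_ge0.
elim: n t st => [|n IH] t st.
  rewrite expr0 divr1 /= [U t s x + _]addrC addrK.
  have sw := admissible_sm t x (picard_admissible 0) s0.
  have [bd _ _] := picard_admissible 0.
  have [|_ h] := volterra_contraction s0 st Nx sw.
    by move=> r /andP[sr _]; rewrite mulrAC; apply: bd; rewrite s0.
  apply: le_trans h _; apply: ler_wpM2r; first exact: expR_ge0.
  by rewrite ler_pdivrMr// mulrDr mulr1 lerDl.
(* The free term cancels, so the next difference is the Volterra operator applied to the previous
   one and is halved by the contraction. *)
have -> : picard n.+2 t s x - picard n.+1 t s x =
    volterra s t (fun r => picard n.+1 r s x - picard n r s x).
  rewrite -(volterraB s0 (admissible_integrable x N0 (picard_admissible n.+1) s0 st)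
    (admissible_integrable x N0 (picard_admissible n) s0 st)).
  rewrite -[picard n.+2 t s x]/(U t s x + volterra s t (fun r => picard n.+1 r s x)).
  rewrite -[picard n.+1 t s x]/(U t s x + volterra s t (fun r => picard n r s x)).
  by rewrite opprD addrACA subrr add0r.
have Nn : 0 <= 2 * M * nrm x / 2 ^+ n by rewrite divr_ge0// exprn_ge0.
have [|_ h] := volterra_contraction s0 st Nn (strongly_measurableB (measurable_itv _)
    (admissible_sm t x (picard_admissible n.+1) s0) (admissible_sm t x (picard_admissible n) s0)).
  by move=> r /andP[sr _]; exact: IH.
by rewrite exprSr invfM mulrA; exact: h.
Qed.

Definition perturbed t s x : X := xget 0 [set l | picard n t s x @[n --> \oo] --> l].

Lemma perturbed_cvg t s x : 0 <= s -> s <= t ->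
  picard n t s x @[n --> \oo] --> perturbed t s x /\
  forall n, nrm (perturbed t s x - picard n t s x) <=
    2 * (2 * M * nrm x * expR (c * (t - s))) / 2 ^+ n.
Proof.
move=> s0 st; have [n|l cl bl] := @nrm_geometric_cvg (fun n => picard n t s x)
    (2 * M * nrm x * expR (c * (t - s))).
  by rewrite mulrAC; exact: picard_diff.
have -> : perturbed t s x = l.
  have : [set l | picard n t s x @[n --> \oo] --> l] (perturbed t s x).
    by apply: xgetPex; exists l.
  by move=> /cvg_unique; apply.
by [].
Qed.

Lemma perturbed_admissible : admissible (2 * M) perturbed.
Proof.
split.
- move=> t s x /[dup] st /andP[s0 st'].
  have [cl _] := perturbed_cvg x s0 st'.
  apply: (cvg_le_lim (N := 0%N) (cvg_nrm cl)) => n _.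
  by have [bd _ _] := picard_admissible n; exact: bd.
- move=> t s k x y /[dup] st /andP[s0 st'].
  have [cl _] := perturbed_cvg (k *: x + y) s0 st'.
  have [cx _] := perturbed_cvg x s0 st'; have [cy _] := perturbed_cvg y s0 st'.
  have : picard n t s (k *: x + y) @[n --> \oo] --> k *: perturbed t s x + perturbed t s y.
    have -> : (fun n => picard n t s (k *: x + y)) =
        (fun n => k *: picard n t s x + picard n t s y).
      by apply/funext => n; have [_ lin _] := picard_admissible n; exact: lin.
    by apply: cvgD; [apply: cvgZr; exact: cx|exact: cy].
  by move=> h; exact: (@cvg_unique _ (@norm_hausdorff _ X) _ _ _ _ cl h).
- move=> a b t s x ba st ca cb; apply/cvg_nrmP; apply/cvgr0P; first by move=> n; exact: nrm_ge0.
  move=> e e0; have [T1 hT1] := cvg_upper_bound ca; pose T := Num.max T1 t.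
  pose D := 2 * (2 * M * nrm x * expR (c * T)).
  (* The iterates converge uniformly for times up to [T], so continuity passes to the limit by the
     usual splitting into three terms of size [e / 3]. *)
  have tail n t' s' : 0 <= s' <= t' -> t' <= T ->
      nrm (perturbed t' s' x - picard n t' s' x) <= D / 2 ^+ n.
    move=> /andP[s0 st'] tT; have [_ h] := perturbed_cvg x s0 st'.
    apply: le_trans (h n) _; apply: ler_wpM2r; first by rewrite invr_ge0 exprn_ge0.
    apply: ler_wpM2l => //; apply: ler_wpM2l; first by rewrite mulr_ge0// nrm_ge0.
    rewrite ler_expR; apply: ler_wpM2l; first exact: ltW.
    by rewrite lerBlDr (le_trans tT)// lerDl.
  have e3 : 0 < e / 3 by rewrite divr_gt0.
  have /cvgrPdist_lt/(_ _ e3)[k _ hk] := cvg_geometric_half D.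
  have small : D / 2 ^+ k < e / 3.
    by have := hk k (leqnn k); rewrite /= sub0r normrN => /(le_lt_trans (ler_norm _)).
  have [_ _ cp] := picard_admissible k.
  have /cvg_nrmP cpk := cp a b t s x ba st ca cb.
  have [n1 hn1] := (cvgr0P (fun n => nrm_ge0 _)).1 cpk _ e3.
  exists n1 => n nn.
  have anT : a n <= T by rewrite le_max hT1.
  have tT : t <= T by rewrite le_max lexx orbT.
  have h1 := tail k (a n) (b n) (ba n) anT.
  have h2 := tail k t s st tT; rewrite nrmBC in h2.
  have := nrm_le_sub (perturbed (a n) (b n) x) (picard k (a n) (b n) x) (perturbed t s x).
  have := nrm_le_sub (picard k (a n) (b n) x) (picard k t s x) (perturbed t s x).
  have := hn1 n nn; lra.
Qed.

(** The defect of the equation is the error of [picard n.+1] plus the Volterra operator applied to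
    the error of [picard n]; each is at most [D / 2 ^+ n], for every [n]. *)
Lemma perturbed_integral t s x : 0 <= s -> s <= t ->
  perturbed t s x = U t s x + volterra s t (fun r => perturbed r s x).
Proof.
move=> s0 st; apply/eqP; rewrite -subr_eq0; apply/eqP; apply: nrm_eq0.
apply/eqP; rewrite eq_le nrm_ge0 andbT.
pose D := 2 * M * nrm x * expR (c * (t - s)).
apply: (@le_geometric0 (2 * D)) => n.
have [_ h] := perturbed_cvg x s0 st.
have Nn : 0 <= 2 * (2 * M * nrm x) / 2 ^+ n.
  by rewrite divr_ge0 ?exprn_ge0// !mulr_ge0// nrm_ge0.
have [|_ hv] := volterra_contraction s0 st Nn (strongly_measurableB (measurable_itv _)
    (admissible_sm t x (picard_admissible n) s0) (admissible_sm t x perturbed_admissible s0)).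
  move=> r /andP[sr _]; have [_ hr] := perturbed_cvg x s0 sr.
  by rewrite nrmBC mulrAC -[2 * _ * expR _]mulrA; exact: hr.
have grp (a u q q' : X) : a - (u + q') = (a - (u + q)) + (q - q').
  by rewrite !opprD !addrA subrK.
have E : perturbed t s x - (U t s x + volterra s t (fun r => perturbed r s x)) =
    (perturbed t s x - picard n.+1 t s x) +
    volterra s t (fun r => picard n r s x - perturbed r s x).
  rewrite -(volterraB s0 (admissible_integrable x N0 (picard_admissible n) s0 st)
    (admissible_integrable x N0 perturbed_admissible s0 st)).
  rewrite -[picard n.+1 t s x]/(U t s x + volterra s t (fun r => picard n r s x)).
  by rewrite -grp.
rewrite E; apply: le_trans (nrmD _ _) (le_trans (lerD (h n.+1) hv) _).
rewrite exprS invfM -/D.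
have -> : 2 * (2 * M * nrm x) / 2 ^+ n / 2 * expR (c * (t - s)) = D / 2 ^+ n.
  rewrite /D; field; exact: expf_neq0.
have -> : 2 * D * (2^-1 / 2 ^+ n) = D / 2 ^+ n by field; exact: expf_neq0.
lra.
Qed.

(** The composition law comes from uniqueness. Splitting the integral at [s] shows that the orbit
    from [r] and the orbit restarted at time [s] solve the same Volterra equation on [[s, +oo)];
    their difference [w] solves the homogeneous one, hence is 0. *)
Lemma perturbed_evolution : evolution_family perturbed.
Proof.
have aP := perturbed_admissible; have [bP lP cP] := aP; have [bU eU iU cU] := evU; split.
- move=> t s st; apply: (@bounded_linearP _ _ _ _ (2 * M * expR (c * (t - s)))).
    by move=> a x y; exact: lP.
  by move=> x; exact: bP.
- move=> t s r r0 rs st x; apply/eqP; rewrite -subr_eq0; apply/eqP.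
  have s0 : 0 <= s by exact: le_trans rs.
  pose y := perturbed s r x.
  pose w q := perturbed q r x - perturbed q s y.
  have wE q : s <= q -> w q = volterra s q w.
    move=> sq; rewrite /w (perturbed_integral y s0 sq).
    rewrite (perturbed_integral x r0 (le_trans rs sq)).
    have I := admissible_integrable x N0 aP r0 (le_trans rs sq).
    rewrite /volterra (bochner_split rs sq I).
    rewrite (eU q s r r0 rs sq x) addrA.
    have J : bochner_integrable r s (fun q => F q (perturbed q r x)).
      have sm := perturbation_sm r0 (admissible_sm s x aP r0).
      pose k := K * (2 * M * expR (c * (s - r)) * nrm x).
      have [||//] := bochner_bound rs (k := k) _ sm.
        by rewrite !mulr_ge0 ?expR_ge0 ?nrm_ge0.
      apply: (ae_imply FK) => z h /=; rewrite in_itv/= => /andP[rz zs].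
      have z0 : 0 <= z by exact: le_trans rz.
      apply: le_trans (h z0 _) _; apply: ler_wpM2l => //.
      apply: le_trans (bP z r x _) _; first by rewrite r0.
      apply: ler_wpM2r; first exact: nrm_ge0.
      apply: ler_wpM2l => //; rewrite ler_expR; apply: ler_wpM2l; first exact: ltW.
      by rewrite lerD2r.
    rewrite -(evolution_bochner evU M0 UM r0 rs (lexx s) sq J).
    have linU := @evolution_blin _ _ _ evU q s (introT andP (conj s0 sq)).
    rewrite -(blinD linU) -(perturbed_integral x r0 rs) -/y.
    rewrite opprD addrACA subrr add0r.
    have I' : bochner_integrable s q (fun z => U q z (F z (perturbed z r x))).
      exact: bochner_integrable_sub I.
    exact: (volterraB s0 I' (admissible_integrable y N0 aP s0 sq)).
  (* One summand per orbit, both measured with the weight [expR (c * (q - s))] that starts at [s];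
     this is why the factor for the time from [r] to [s] appears. *)
  pose N := 2 * M * expR (c * (s - r)) * nrm x + 2 * M * nrm y.
  have Np : 0 <= N by rewrite addr_ge0// !mulr_ge0 ?expR_ge0 ?nrm_ge0.
  apply: (@volterra_unique s w N s0 Np _ _ wE t st).
  + move=> q sq; apply: strongly_measurableB => //; last exact: admissible_sm aP s0.
    apply: strongly_measurable_sub (admissible_sm q x aP r0) => z /=.
    by rewrite !in_itv/= => /andP[sz ->]; rewrite (le_trans rs sz).
  + move=> q sq; apply: le_trans (nrmD _ _) _; rewrite nrmN /N mulrDl; apply: lerD.
      apply: le_trans (bP q r x _) _; first by rewrite r0 (le_trans rs sq).
      rewrite mulrAC -!mulrA; apply: ler_wpM2l => //; apply: ler_wpM2l => //.
      rewrite mulrCA; apply: ler_wpM2l; first exact: nrm_ge0.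
      have -> : q - r = (s - r) + (q - s) by ring.
      by rewrite mulrDr expRD.
    by rewrite mulrAC; apply: bP; rewrite s0.
- move=> t t0 x; rewrite (perturbed_integral x t0 (lexx t)) iU//.
  have -> : volterra t t (fun r => perturbed r t x) = bochner t t (fun=> 0).
    apply: bochner_ae; apply: (ae_imply (ae_neq t)) => r rt; rewrite in_itv/=.
    by move=> /le_anti E; rewrite E eqxx in rt.
  by rewrite bochner0 addr0.
- move=> x; apply/subspace_continuousP => z Az; apply: seq_within_cvg => u Au cu.
  apply: cP => //.
  + exact: cvg_comp cu cvg_fst.
  + exact: cvg_comp cu cvg_snd.
Qed.

End Perturbation.

(** * Robust stability *)

Section Datko.
Context {R : realType} {X : normedModType R[i]}.
Local Notation mu := (@lebesgue_measure R).
Variable p : R.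
Hypothesis p1 : 1 <= p.
Let p0 : 0 < p. Proof. exact: lt_le_trans p1. Qed.

(** Chebyshev's inequality on an interval: a pointwise lower bound along an orbit is paid for in L^p
    norm. *)
Lemma Lp_norm_cutoff_ge (s t k q : R) (f : R -> X) : 0 <= s -> s <= t -> 0 <= k -> 0 <= q ->
  (forall r, s <= r <= t -> k <= nrm (f r)) ->
  (Lp_norm p (cutoff `[s, t] f) <= q%:E)%E -> k `^ p * (t - s) <= q `^ p.
Proof.
move=> s0 st k0 q0 kf /(Lp_norm_leP p1 _ q0) h; rewrite -lee_fin; apply: le_trans h.
rewrite -integral_cst_itv//; apply: le_integral_supp => r; rewrite ?lee_fin ?powR_ge0//=.
  move=> rst _; rewrite cutoffE//; apply: ge0_ler_powR; first exact: ltW.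
  - by rewrite nnegrE.
  - by rewrite nnegrE nrm_ge0.
  - by apply: kf; rewrite in_itv in rst.
by rewrite in_itv/= => /andP[sr _] []; exact: le_trans sr.
Qed.

Variables (W : R -> R -> X -> X) (N c Q : R).
Hypotheses (evW : evolution_family W) (N0 : 0 < N) (c0 : 0 <= c) (Q0 : 0 < Q)
  (WN : forall (t s : R) (x : X), 0 <= s <= t -> nrm (W t s x) <= N * expR (c * (t - s)) * nrm x)
  (WQ : forall (s t : R) (x : X), 0 <= s -> s <= t ->
    (Lp_norm p (cutoff `[s, t] (fun r => W r s x)) <= (Q * nrm x)%:E)%E).

(** Covers both cases of [datko_bounded]: [N * expR c] for elapsed times up to 1, and
    [N * expR c * Q] afterwards. *)
Let N1 := N * expR c * (Q + 1).
Let N10 : 0 < N1. Proof. by rewrite !mulr_gt0 ?expR_gt0// addr_gt0. Qed.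

(* [W t s x] is bounded by every [W r s x] with [t - 1 <= r <= t], hence by the L^p norm. *)
Lemma datko_bounded (t s : R) (x : X) : 0 <= s -> s <= t -> nrm (W t s x) <= N1 * nrm x.
Proof.
move=> s0 st; have [h|h] := leP t (s + 1).
  apply: le_trans (WN x _) _; first by rewrite s0.
  apply: ler_wpM2r; first exact: nrm_ge0.
  rewrite /N1 -mulrA; apply: ler_wpM2l; first exact: ltW.
  apply: (@le_trans _ _ (expR c)).
    by rewrite ler_expR -[leRHS]mulr1; apply: ler_wpM2l => //; rewrite lerBlDl.
  by rewrite ler_peMr ?expR_ge0// lerDr ltW.
have st1 : s <= t - 1 by rewrite lerBrDr ltW.
have t10 : 0 <= t - 1 by exact: le_trans st1.
have t1t : t - 1 <= t by rewrite gerBl.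
pose k := nrm (W t s x) / (N * expR c).
have Nc : 0 < N * expR c by rewrite mulr_gt0 ?expR_gt0.
have k0 : 0 <= k by rewrite divr_ge0 ?nrm_ge0// ltW.
have kW r : t - 1 <= r <= t -> k <= nrm (W r s x).
  move=> /andP[tr rt]; have [_ ev _ _] := evW.
  rewrite /k ler_pdivrMr// (ev t r s s0 (le_trans st1 tr) rt x) mulrC.
  apply: le_trans (WN _ _) _; first by rewrite (le_trans t10 tr).
  apply: ler_wpM2r; first exact: nrm_ge0.
  apply: ler_wpM2l; first exact: ltW.
  by rewrite ler_expR -[leRHS]mulr1; apply: ler_wpM2l => //; lra.
have q0 : 0 <= Q * nrm x by rewrite mulr_ge0 ?nrm_ge0// ltW.
have sub : (Lp_norm p (cutoff `[(t - 1)%R, t] (fun r => W r s x)) <= (Q * nrm x)%:E)%E.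
  apply: le_trans (WQ x s0 st); apply: Lp_norm_le => //; apply: aeW => r r0.
  have [rst|rst] := boolP (r \in `[t - 1, t]%R).
    rewrite !cutoffE//=; move: rst; rewrite !in_itv/= => /andP[h1 ->].
    by rewrite (le_trans st1 h1).
  by rewrite cutoffN ?nrm0 ?nrm_ge0//; exact/negP.
have := Lp_norm_cutoff_ge t10 t1t k0 q0 kW sub; rewrite opprB addrC subrK mulr1 => hk.
have {}hk : k <= Q * nrm x.
  rewrite leNgt; apply/negP => lt; move: hk; apply/negP; rewrite -ltNge.
  by apply: gt0_ltr_powR; rewrite ?nnegrE.
move: hk; rewrite /k ler_pdivrMr// => /le_trans; apply.
rewrite /N1 mulrC mulrA; apply: ler_wpM2r; first exact: nrm_ge0.
by apply: ler_wpM2l; [exact: ltW|rewrite lerDl].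
Qed.

Let T0 := (N1 * Q * expR 1) `^ p.
Let T00 : 0 < T0. Proof.
by apply: powR_gt0; apply: mulr_gt0; [exact: mulr_gt0|exact: expR_gt0].
Qed.

Lemma datko_contraction (s : R) (x : X) : 0 <= s ->
  nrm (W (s + T0) s x) <= expR (- 1) * nrm x.
Proof.
move=> s0; set t := s + T0; have st : s <= t by rewrite lerDl ltW.
pose k := nrm (W t s x) / N1.
have k0 : 0 <= k by rewrite divr_ge0 ?nrm_ge0// ltW.
have q0 : 0 <= Q * nrm x by rewrite mulr_ge0 ?nrm_ge0// ltW.
have kW r : s <= r <= t -> k <= nrm (W r s x).
  move=> /andP[sr rt]; have [_ ev _ _] := evW.
  rewrite /k ler_pdivrMr// (ev t r s s0 sr rt x) mulrC.
  by apply: datko_bounded => //; exact: le_trans sr.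
have := Lp_norm_cutoff_ge s0 st k0 q0 kW (WQ x s0 st).
have -> : t - s = T0 by rewrite /t addrAC subrr add0r.
have P0 : 0 <= N1 * Q * expR 1 by apply: mulr_ge0; [apply: mulr_ge0; exact: ltW|exact: expR_ge0].
rewrite /T0 -powRM// => hk.
have {}hk : k * (N1 * Q * expR 1) <= Q * nrm x.
  rewrite leNgt; apply/negP => lt; move: hk; apply/negP; rewrite -ltNge.
  by apply: gt0_ltr_powR; rewrite ?nnegrE// mulr_ge0.
have E : k * (N1 * Q * expR 1) = Q * (nrm (W t s x) * expR 1).
  by rewrite /k; field; exact: lt0r_neq0.
move: hk; rewrite E ler_pM2l// => hk.
by rewrite expRN mulrC ler_pdivlMr ?expR_gt0.
Qed.

Lemma datko : exponentially_stable W.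
Proof.
have [bW ev iW _] := evW.
have iter n (s : R) (x : X) : 0 <= s ->
    nrm (W (s + n%:R * T0) s x) <= expR (- n%:R) * nrm x.
  move=> s0; elim: n => [|n IH].
    by rewrite mul0r addr0 oppr0 expR0 mul1r iW.
  have nT : 0 <= n%:R * T0 by rewrite mulr_ge0// ltW.
  have E : s + n.+1%:R * T0 = s + n%:R * T0 + T0 by rewrite -natr1 mulrDl mul1r addrA.
  rewrite E (ev _ (s + n%:R * T0) s s0); last 2 first.
  - by rewrite lerDl.
  - by rewrite lerDl ltW.
  apply: le_trans (datko_contraction _ _) _; first by rewrite addr_ge0.
  rewrite -natr1 opprD [- n%:R - 1]addrC expRD -mulrA; apply: ler_wpM2l; first exact: expR_ge0.
  exact: IH.
(* One contraction per time [T0] gives the rate. Truncating the elapsed time to a multiple of [T0]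
   costs the factor [expR 1], and the maximum with 1 meets the demand of [exponentially_stable] on
   its constant. *)
exists (Num.max 1 (N1 * expR 1)), (- T0^-1); split.
- by rewrite le_max lexx.
- by rewrite oppr_lt0 invr_gt0.
move=> t s /andP[s0 st]; apply: opnorm_le.
  by rewrite mulr_ge0 ?expR_ge0// le_max ler01.
move=> x; pose z := (t - s) / T0; have z0 : 0 <= z by rewrite divr_ge0 ?subr_ge0// ltW.
pose n := Num.truncn z; have /andP[nz zn] : n%:R <= z < n.+1%:R by exact: truncn_itv.
have nT : 0 <= n%:R * T0 by rewrite mulr_ge0// ltW.
have sn : s + n%:R * T0 <= t by rewrite addrC -lerBrDr -ler_pdivlMr.
rewrite (ev t (s + n%:R * T0) s s0 _ sn); last by rewrite lerDl.
apply: le_trans (datko_bounded _ _ sn) _; first by rewrite addr_ge0.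
apply: le_trans (ler_wpM2l (ltW N10) (iter n s x s0)) _.
rewrite mulrA; apply: ler_wpM2r; first exact: nrm_ge0.
apply: (@le_trans _ _ (N1 * expR 1 * expR (- T0^-1 * (t - s)))); last first.
  by apply: ler_wpM2r; [exact: expR_ge0|rewrite le_max lexx orbT].
rewrite -mulrA; apply: ler_wpM2l; first exact: ltW.
rewrite -expRD ler_expR mulNr mulrC -/z; move: zn; rewrite -natr1; lra.
Qed.

End Datko.

Section LpTools.
Context {R : realType}.
Local Notation mu := (@lebesgue_measure R).
Variable p : R.
Hypothesis p1 : 1 <= p.
Let p0 : 0 < p. Proof. exact: lt_le_trans p1. Qed.

Lemma Lp_bounded_comp {V W Z : normedModType R[i]} (S : (R -> W) -> R -> Z)
    (T : (R -> V) -> R -> W) : Lp_bounded p S -> Lp_bounded p T ->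
  Lp_bounded p (fun f => S (T f)).
Proof.
move=> bS bT; have [S1 S2 S3 S4] := bS; have [T1 T2 T3 T4] := bT.
have fin (o : \bar R) : (0 <= o)%E -> (o < +oo)%E -> o = (fine o)%:E.
  by move=> o0 oy; rewrite fineK// ge0_fin_numE.
have oS := Lp_opnorm_ge0 p1 S; have oT := Lp_opnorm_ge0 p1 T.
apply: (@Lp_boundedP _ _ _ _ _ (fine (Lp_opnorm p S) * fine (Lp_opnorm p T))).
- by rewrite mulr_ge0// fine_ge0.
- by move=> f hf; have [] := S1 _ (T1 f hf).
- by move=> f g hf hg fg; apply: S2; [exact: T1|exact: T1|exact: T2].
- move=> a f g hf hg; have h1 := T3 a f g hf hg.
  have h2 := S2 _ _ (T1 _ (Lp_lin p1 a hf hg)) (Lp_lin p1 a (T1 f hf) (T1 g hg)) h1.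
  have h3 := S3 a _ _ (T1 f hf) (T1 g hg).
  by apply: (ae_imply2 h2 h3) => t e1 e2 Rt; rewrite (e1 Rt) (e2 Rt).
- move=> f hf; rewrite EFinM -muleA.
  have leS := Lp_opnormP p1 bS (o := fine (Lp_opnorm p S)) _ (T1 f hf).
  have leT := Lp_opnormP p1 bT (o := fine (Lp_opnorm p T)) _ hf.
  apply: le_trans (leS _) _; first by rewrite -fin.
  by apply: lee_wpmul2l; [rewrite lee_fin fine_ge0|apply: leT; rewrite -fin].
Qed.

Lemma Lp_bounded_support {V : normedModType R[i]} (a b k : R) (f : R -> V) : a <= b ->
  0 <= k -> strongly_measurable Rplus f -> (forall t, a <= t <= b -> nrm (f t) <= k) ->
  (forall t, ~ (a <= t <= b) -> f t = 0) -> Lp p f.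
Proof.
move=> ab k0 sf fk f0; split => //; apply/(Lp_power_lty p1).
apply: (@le_lt_trans _ _ (\int[mu]_(t in `[a, b]) (k `^ p)%:E)%E); last first.
  by rewrite integral_cst_itv// ltry.
apply: le_integral_supp => t; rewrite ?lee_fin ?powR_ge0//= => _; rewrite in_itv/=.
  move=> tab; apply: ge0_ler_powR; first exact: ltW.
  - by rewrite nnegrE nrm_ge0.
  - by rewrite nnegrE.
  - exact: fk.
by move=> tab; rewrite f0// nrm0 powR0 ?gt_eqF.
Qed.

Lemma stable_orbit_norm {X : normedModType R[i]} (U : R -> R -> X -> X) (M o : R) :
  1 <= M -> o < 0 -> (forall (t s : R) (x : X), 0 <= s <= t ->
    nrm (U t s x) <= M * expR (o * (t - s)) * nrm x) ->
  exists2 A : R, 0 <= A & forall (s T : R) (x : X), 0 <= s -> s <= T ->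
    (Lp_norm p (cutoff `[s, T] (fun t => U t s x)) <= (A * nrm x)%:E)%E.
Proof.
move=> M1 o0 Uexp; have M0 : 0 < M by exact: lt_le_trans M1.
pose c := o * p; have c0 : c < 0 by rewrite nmulr_rlt0.
have c0' : 0 < - c by rewrite oppr_gt0.
(* [a] is the L^p norm over the half-line of [expR (o * x)], whose [p]-th power decays at the rate
   [c = o * p]. *)
pose a := (- c)^-1 `^ p^-1; exists (M * a); first by rewrite mulr_ge0 ?powR_ge0// ltW.
move=> s T x s0 sT; have Ma0 : 0 <= M * a * nrm x.
  by rewrite mulr_ge0 ?nrm_ge0// mulr_ge0 ?powR_ge0// ltW.
apply/(Lp_norm_leP p1 _ Ma0).
have Mx0 : 0 <= M * nrm x by rewrite mulr_ge0 ?nrm_ge0// ltW.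
have -> : (M * a * nrm x) `^ p = (M * nrm x) `^ p / - c.
  rewrite mulrAC (powRM p Mx0 (powR_ge0 _ _)) /a -powRrM mulVf ?gt_eqF//.
  by rewrite powRr1// invr_ge0 ltW.
apply: (@le_trans _ _ (\int[mu]_(t in `[s, +oo[)
    ((M * nrm x) `^ p * expR (c * t + - (c * s)))%:E)%E); last first.
  by rewrite integral_expR_decay ?powR_ge0// subrr expR0 mulr1.
apply: le_integral_supp => t.
- by rewrite lee_fin powR_ge0.
- by rewrite lee_fin mulr_ge0 ?powR_ge0 ?expR_ge0.
- move=> _ _; rewrite lee_fin -mulrBr /c mulrAC expRM -powRM ?expR_ge0//.
  apply: ge0_ler_powR; first exact: ltW.
  + by rewrite nnegrE nrm_ge0.
  + by rewrite nnegrE mulr_ge0 ?expR_ge0.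
  have [tsT|tsT] := boolP (t \in `[s, T]%R).
    rewrite cutoffE// [leRHS]mulrAC; move: tsT; rewrite in_itv/= => /andP[st _].
    by apply: Uexp; rewrite s0.
  rewrite cutoffN; last exact/negP.
  by rewrite nrm0; apply: mulr_ge0; [exact: Mx0|exact: expR_ge0].
- move=> _; rewrite /= in_itv/= andbT => ts; rewrite cutoffN ?nrm0 ?powR0 ?gt_eqF//.
  by rewrite /= in_itv/= => /andP[st _]; exact: ts.
Qed.

End LpTools.

(** * Stability of the perturbed family when the small-gain condition holds *)

Section RobustStability.
Context {R : realType} {X V Y : completeNormedModType R[i]}.
Local Notation mu := (@lebesgue_measure R).
Variables (p : R) (U : R -> R -> X -> X) (M o : R) (B : R -> V -> X) (C : R -> X -> Y).
Hypotheses (p1 : 1 <= p) (evU : evolution_family U) (M1 : 1 <= M) (o0 : o < 0)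
  (Uexp : forall (t s : R) (x : X), 0 <= s <= t ->
    nrm (U t s x) <= M * expR (o * (t - s)) * nrm x)
  (LB : Linf_s B) (LC : Linf_s C).

Let M0 : 0 < M. Proof. exact: lt_le_trans M1. Qed.
Let UM := stable_uniform M1 o0 Uexp.

Lemma input_output_bounded : Lp_bounded p (input_output U B C).
Proof.
have h := Lp_bounded_comp p1 (GG_bounded p1 evU M1 o0 Uexp) (mult_op_bounded p1 LB).
exact: (Lp_bounded_comp p1 (mult_op_bounded p1 LC) h).
Qed.

Variables (Delta : R -> Y -> V) (r l : R).
Hypotheses (LD : Linf_s Delta) (r0 : 0 <= r) (l0 : 0 <= l) (rl : l * r < 1)
  (Dr : {ae mu, forall t, 0 <= t -> forall y, nrm (Delta t y) <= r * nrm y})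
  (Ll : forall u, Lp p u ->
    (Lp_norm p (input_output U B C u) <= l%:E * Lp_norm p u)%E).

Lemma robust_stability : exists2 UD, perturbed_family U B C Delta UD & exponentially_stable UD.
Proof.
pose F t x := B t (Delta t (C t x)).
have LF : Linf_s F by exact: Linf_s_comp LB (Linf_s_comp LD LC).
have [K K0 FK] := Linf_bound LF.
pose W := perturbed U F.
have aW := perturbed_admissible evU (ltW M0) UM LF K0 FK.
have evW := perturbed_evolution evU (ltW M0) UM LF K0 FK.
have Wint := perturbed_integral evU (ltW M0) UM LF K0 FK.
have [bW _ _] := aW.
exists W; first by split=> // x t s /andP[s0 st]; exact: Wint.
have [kB kB0 hB] := Linf_bound LB; have [kC kC0 hC] := Linf_bound LC.
have [A A0 hA] := stable_orbit_norm p1 M1 o0 Uexp.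
have rl' : 0 < 1 - l * r by rewrite subr_gt0.
(* Read from the inside: the bound on the output after absorption, then the norms of [Delta], of [B]
   and of [GG U], and finally the unperturbed orbit [A]. The [+ 1] makes [Q] positive. *)
pose Q := A + M / - o * (kB * (r * (kC * A / (1 - l * r)))) + 1.
have a0 : 0 <= M / - o by rewrite divr_ge0 ?ltW// oppr_gt0.
have q0 : 0 <= kC * A / (1 - l * r) by rewrite divr_ge0 ?mulr_ge0// ltW.
have Q0 : 0 < Q by rewrite ltr_wpDl//; apply: addr_ge0 => //; do 3![apply: mulr_ge0 => //].
apply: (@datko R X p p1 W (2 * M) (growth_rate M K) Q evW) => //.
- by rewrite mulr_gt0.
- exact/ltW/growth_rate_gt0/K0/ltW.
move=> s T x s0 sT.
have T0 : 0 <= T by exact: le_trans sT.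
have cut_sm (G : R -> X) : strongly_measurable `[s, T] G ->
    strongly_measurable Rplus (cutoff `[s, T] G).
  move=> sG; apply: strongly_measurable_cutoff => //; first exact: measurable_Rplus.
  by apply: strongly_measurable_sub sG => t [].
(* The norm of [u] has to be known to be finite before it can be absorbed: hence the
   cutoff at [T]. *)
pose u := cutoff `[s, T] (fun t => W t s x).
pose v0 := cutoff `[s, T] (fun t => U t s x).
have cutin (G : R -> X) t : s <= t <= T -> cutoff `[s, T] G t = G t.
  by move=> h; rewrite cutoffE//= in_itv.
have cutout (G : R -> X) t : ~ (s <= t <= T) -> cutoff `[s, T] G t = 0.
  by move=> h; rewrite cutoffN//= in_itv.
have hu : Lp p u.
  apply: (@Lp_bounded_support R p p1 X s T (2 * M * expR (growth_rate M K * (T - s)) * nrm x)) => //.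
  - by rewrite !mulr_ge0 ?expR_ge0 ?nrm_ge0// ltW.
  - by apply: cut_sm; exact: (admissible_sm T x aW s0).
  - move=> t stT; rewrite /u cutin//; have /andP[st tT] := stT.
    apply: le_trans (bW t s x _) _; first by rewrite s0.
    apply: ler_wpM2r; first exact: nrm_ge0.
    apply: ler_wpM2l; first by rewrite mulr_ge0// ltW.
    rewrite ler_expR; apply: ler_wpM2l; first exact/ltW/growth_rate_gt0/K0/ltW.
    by rewrite lerD2r.
  - by move=> t; exact: cutout.
have hv0 : Lp p v0.
  apply: (@Lp_bounded_support R p p1 X s T (M * nrm x)) => //.
  - by rewrite mulr_ge0 ?nrm_ge0// ltW.
  - by apply: cut_sm; exact: (admissible_sm T x (picard_admissible evU (ltW M0) UM LF K0 FK 0) s0).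
  - move=> t stT; rewrite /v0 cutin//; have /andP[st tT] := stT.
    by apply: UM; rewrite s0.
  - by move=> t; exact: cutout.
have LpC f : Lp p f -> Lp p (mult_op C f) by case: (mult_op_bounded p1 LC) => h _ _ _; exact: h.
have LpB' f : Lp p f -> Lp p (mult_op B f) by case: (mult_op_bounded p1 LB) => h _ _ _; exact: h.
have LpD' f : Lp p f -> Lp p (mult_op Delta f) by case: (mult_op_bounded p1 LD) => h _ _ _; exact: h.
pose y := mult_op C u; pose v := mult_op Delta y.
have hy : Lp p y by exact: LpC.
have hv : Lp p v by exact: LpD'.
(* The integral over [[s, t]] may start at 0 because [v] vanishes before [s], and the cutoff at [T]
   is invisible to it because only times up to [t <= T] enter. *)
have uE t : s <= t <= T -> u t = U t s x + GG U (mult_op B v) t.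
  move=> stT; have /andP[st tT] := stT; rewrite /u cutin// /W (Wint t s x s0 st).
  apply: (congr1 (fun z => U t s x + z)).
  have M20 : 0 <= 2 * M by rewrite mulr_ge0// ltW.
  have I := admissible_integrable evU (ltW M0) UM LF K0 FK x M20 aW s0 st.
  rewrite /volterra -(bochner_cutoff s0 (lexx t) I); apply: bochner_ae; apply: aeW => q.
  rewrite in_itv/= => /andP[q0' qt]; have [sq|qs] := leP s q.
    rewrite cutoffE/= ?in_itv/= ?sq//.
    by rewrite /mult_op /v /y /mult_op /u cutin ?sq ?(le_trans qt tT).
  rewrite cutoffN/= ?in_itv/=; last by rewrite leNgt qs.
  rewrite /mult_op /v /y /mult_op /u cutout; last by rewrite leNgt qs.
  have [bF _ _] := LF; rewrite -[B q _]/(F q 0) (blin0 (bF q q0')).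
  by rewrite (blin0 (@evolution_blin _ _ _ evU t q _))// q0' qt.
have bL := input_output_bounded; have bG := GG_bounded p1 evU M1 o0 Uexp.
have hLv : Lp p (input_output U B C v) by case: bL => h _ _ _; exact: h.
have hGv : Lp p (GG U (mult_op B v)) by case: bG => h _ _ _; apply: h; exact: LpB'.
have yle : {ae mu, forall t, 0 <= t ->
    nrm (y t) <= nrm (mult_op C v0 t) + nrm (input_output U B C v t)}.
  apply: aeW => t t0; have [bC _ _] := LC.
  have [/andP stT|/andP stT] := pselect (s <= t /\ t <= T).
    rewrite -[y t]/(C t (u t)) uE// (blinD (bC t t0)) /mult_op /v0 cutin//.
    exact: nrmD.
  have u0 : u t = 0 by apply: cutout; exact/negP.
  rewrite -[y t]/(C t (u t)) u0 (blin0 (bC t t0)) nrm0.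
  by rewrite addr_ge0// nrm_ge0.
have ule : {ae mu, forall t, 0 <= t -> nrm (u t) <= nrm (v0 t) + nrm (GG U (mult_op B v) t)}.
  apply: aeW => t t0; have [/andP stT|/andP stT] := pselect (s <= t /\ t <= T).
    by rewrite uE// /v0 cutin//; exact: nrmD.
  have u0 : u t = 0 by apply: cutout; exact/negP.
  by rewrite u0 nrm0 addr_ge0// nrm_ge0.
have sm (Z : normedModType R[i]) (f : R -> Z) : Lp p f -> strongly_measurable Rplus f by case.
have hv0A : (Lp_norm p v0 <= (A * nrm x)%:E)%E by exact: hA.
pose yn := fine (Lp_norm p y).
have ynE : Lp_norm p y = yn%:E.
  by rewrite fineK// ge0_fin_numE ?Lp_norm_ge0//; case: hy.
have vyn : (Lp_norm p v <= (r * yn)%:E)%E.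
  have h := mult_op_norm p1 r0 (sm _ _ hy) Dr.
  by rewrite EFinM -ynE; exact: h.
have yn0 : 0 <= yn by rewrite fine_ge0// Lp_norm_ge0.
(* The small-gain step: [yn] is at most [kC * A * nrm x + l * r * yn], and the last term is absorbed
   on the left. *)
have ynle : yn <= kC * A / (1 - l * r) * nrm x.
  have : (yn%:E <= (kC * (A * nrm x))%:E + (l * (r * yn))%:E)%E.
    rewrite -ynE; apply: le_trans (Lp_norm_leD p1 (sm _ _ (LpC _ hv0)) (sm _ _ hLv) yle) _.
    apply: leeD.
      apply: le_trans (mult_op_norm p1 kC0 (sm _ _ hv0) hC) _; rewrite EFinM.
      by apply: lee_wpmul2l => //; rewrite lee_fin.
    apply: le_trans (Ll hv) _; rewrite [leRHS]EFinM.
    by apply: lee_wpmul2l => //; rewrite lee_fin.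
  rewrite -EFinD lee_fin mulrAC ler_pdivlMr// mulrBr mulr1 => h; lra.
apply: le_trans (Lp_norm_leD p1 (sm _ _ hv0) (sm _ _ hGv) ule) _.
apply: (@le_trans _ _ ((A * nrm x)%:E +
    (M / - o * (kB * (r * (kC * A / (1 - l * r) * nrm x))))%:E)%E).
  apply: leeD; first exact: hv0A.
  apply: le_trans (GG_norm p1 evU M1 o0 Uexp (LpB' _ hv)) _; rewrite [leRHS]EFinM.
  apply: lee_wpmul2l; first by rewrite lee_fin.
  apply: le_trans (mult_op_norm p1 kB0 (sm _ _ hv) hB) _; rewrite [leRHS]EFinM.
  apply: lee_wpmul2l; first by rewrite lee_fin.
  apply: le_trans vyn _; rewrite lee_fin; exact: ler_wpM2l.
rewrite -EFinD lee_fin /Q !mulrDl mul1r !mulrA lerDl; exact: nrm_ge0.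
Qed.

End RobustStability.

(** * The lower bound for the stability radius *)

Section LowerBound.
Context {R : realType}.
Local Notation mu := (@lebesgue_measure R).

Lemma Linf_s_cst {V W : normedModType R[i]} (A : V -> W) (k : R) : 0 <= k ->
  (forall (a : R[i]) x y, A (a *: x + y) = a *: A x + A y) ->
  (forall x, nrm (A x) <= k * nrm x) ->
  Linf_s (fun _ : R => A) /\ (Linf_norm (fun _ : R => A) <= k%:E)%E.
Proof.
move=> k0 lA bA; have le : (Linf_norm (fun _ : R => A) <= k%:E)%E.
  by apply: Linf_norm_le => //; apply: aeW.
split=> //; split.
- by move=> t _; exact: bounded_linearP bA.
- by move=> v; exact: strongly_measurable_cst.
- by apply: le_lt_trans le _; rewrite ltry.
Qed.

Lemma Linf_s_id (V : normedModType R[i]) : Linf_s (fun _ : R => @id V).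
Proof.
have b1 (x : V) : nrm (id x) <= 1 * nrm x by rewrite mul1r.
by have [] := Linf_s_cst ler01 (fun _ _ _ => erefl) b1.
Qed.

Lemma Lp_opnormN {V W : normedModType R[i]} (p : R) (T : (R -> V) -> R -> W) :
  Lp_opnorm p (fun f => - T f) = Lp_opnorm p T.
Proof.
apply: (congr1 (fun A => ereal_sup A)); apply: eq_imagel => f _; exact: Lp_normN.
Qed.

(** [robust_stability] puts every [r >= 0] with [l * r < 1] below the supremum. Were the supremum
    smaller than the inverse of [l], a slightly larger [r] would still qualify. For [l = 0] every
    [r] qualifies, in accordance with the convention on the inverse of 0. *)
Lemma r_stab_ge {X V Y : completeNormedModType R[i]} (p : R) (U : R -> R -> X -> X)
    (B : R -> V -> X) (C : R -> X -> Y) : 1 <= p -> evolution_family U ->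
  exponentially_stable U -> Linf_s B -> Linf_s C ->
  ((Lp_opnorm p (input_output U B C))^-1 <= r_stab U B C)%E.
Proof.
move=> p1 evU sU LB LC; have [M [om [M1 o0 Uexp]]] := exponentially_stableP evU sU.
have bL := input_output_bounded p1 evU M1 o0 Uexp LB LC.
have [_ _ _ fL] := bL; have L0 := Lp_opnorm_ge0 p1 (input_output U B C).
pose l := fine (Lp_opnorm p (input_output U B C)).
have lE : Lp_opnorm p (input_output U B C) = l%:E by rewrite fineK// ge0_fin_numE.
have l0 : 0 <= l by rewrite fine_ge0.
have inset (r : R) : 0 <= r -> l * r < 1 -> (r%:E <= r_stab U B C)%E.
  move=> r0 lr; apply: ereal_sup_ubound; exists r => //; split => // Delta LD Dr.
  have [bD _ _] := LD; apply: (robust_stability p1 evU M1 o0 Uexp LB LC LD r0 l0 lr).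
    exact: Linf_norm_bound.
  by move=> u hu; apply: Lp_opnormP => //; rewrite lE.
have pos : (0 <= r_stab U B C)%E by apply: inset; rewrite ?mulr0.
rewrite lE leNgt; apply/negP => lt.
have fin : r_stab U B C \is a fin_num.
  by rewrite ge0_fin_numE//; apply: lt_le_trans lt _; rewrite leey.
pose s := fine (r_stab U B C); have sE : r_stab U B C = s%:E by rewrite fineK.
have s0 : 0 <= s by rewrite fine_ge0.
have ls : l * s < 1.
  move: l0; rewrite le_eqVlt => /predU1P[<-|lp]; first by rewrite mul0r.
  move: lt; rewrite sE inver gt_eqF// lte_fin => h.
  by rewrite mulrC -ltr_pdivlMr// div1r.
have l1 : 0 < l + 1 by rewrite ltr_wpDl.
(* The increase uses at most half of the gap [1 - l * s], because [l / (l + 1) <= 1]; the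
   denominator stays positive for [l = 0]. *)
pose r := s + (1 - l * s) / (2 * (l + 1)).
have sr : s < r by rewrite ltrDl divr_gt0 ?subr_gt0// mulr_gt0.
have lr : l * r < 1.
  have -> : l * r = l * s + (1 - l * s) * (l / (l + 1)) / 2.
    by rewrite /r; field; exact: lt0r_neq0.
  have q1 : l / (l + 1) <= 1 by rewrite ler_pdivrMr// mul1r lerDl.
  have d0 : 0 < 1 - l * s by rewrite subr_gt0.
  have := ler_wpM2l (ltW d0) q1; lra.
have := inset r (le_trans s0 (ltW sr)) lr.
by rewrite sE lee_fin leNgt sr.
Qed.

End LowerBound.

(** * The spectral bound *)

Section GeneratorPerturbation.
Context {R : realType} {X : completeNormedModType R[i]}.
Local Notation mu := (@lebesgue_measure R).
Variables (p : R) (U W : R -> R -> X -> X) (M N : R) (k : R[i]).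
Hypotheses (p1 : 1 <= p) (evU : evolution_family U) (evW : evolution_family W)
  (M0 : 0 <= M) (N0 : 0 <= N)
  (UM : forall (t s : R) (x : X), 0 <= s <= t -> nrm (U t s x) <= M * nrm x)
  (WN : forall (t s : R) (x : X), 0 <= s <= t -> nrm (W t s x) <= N * nrm x)
  (WU : forall (x : X) (t s : R), 0 <= s <= t ->
    W t s x = U t s x + bochner s t (fun r => U t r (k *: W r s x))).
Local Notation EU := (evolution_semigroup U).
Local Notation EW := (evolution_semigroup W).

Let K := M * (complex.Re `|k| * N).
Let K0 : 0 <= K. Proof. by rewrite !mulr_ge0// Re_norm_ge0. Qed.

Lemma perturbation_integrand_sm (t s : R) (x : X) : 0 <= s -> s <= t ->
  strongly_measurable `[s, t] (fun r => U t r (k *: W r s x)).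
Proof.
move=> s0 st; apply: (evolution_sm evU UM s0 (lexx t)).
apply: strongly_measurableZ => //.
pose m (r : R) : R := Num.max s r.
apply: (@strongly_measurable_ae _ _ _ (fun r => W (m r) s x)).
  by apply: aeW => r /=; rewrite in_itv/= => /andP[sr _]; rewrite /m (max_idPr sr).
apply: strongly_measurable_continuous => // r.
have cm : m y @[y --> r] --> m r.
  by apply: (@continuous_max R R (fun=> s) id r); [exact: cvg_cst|exact: cvg_id].
have sm' r' : s <= m r' by rewrite le_max lexx.
suff : W (m y) s x @[y --> r] --> W (m r) s x by [].
apply: (evolution_cvg evW WN (b := fun=> s) (y := fun=> x)).
- by rewrite s0 sm'.
- by apply: nearW => y; rewrite s0 sm'.
- exact: cm.
- exact: cvg_cst.
- exact: cvg_cst.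
Qed.

Lemma perturbation_difference (t s : R) (x : X) : 0 <= s -> s <= t ->
  nrm (W t s x - U t s x) <= K * (t - s) * nrm x.
Proof.
move=> s0 st; rewrite WU ?s0// [U t s x + _]addrC addrK.
have [||_ h] := bochner_bound st (k := K * nrm x) _ (perturbation_integrand_sm x s0 st).
- by rewrite mulr_ge0// nrm_ge0.
- apply: aeW => r /=; rewrite in_itv/= => /andP[sr rt]; have r0 := le_trans s0 sr.
  apply: le_trans (UM _ _) _; first by rewrite r0.
  rewrite /K -!mulrA; apply: ler_wpM2l => //; rewrite nrmZ; apply: ler_wpM2l.
    exact: Re_norm_ge0.
  by apply: WN; rewrite s0.
- by rewrite mulrAC.
Qed.

(** The difference of the two difference quotients at [f]; on each function of L^p it converges to
    multiplication by [k], which is all that separates the two generators. *)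
Definition semigroup_difference (h : R) (f : R -> X) : R -> X :=
  (h^-1)%:C%C *: (EW h f - EU h f).
Local Notation D := semigroup_difference.

Lemma semigroup_difference_sm (h : R) (f : R -> X) : 0 < h -> strongly_measurable Rplus f ->
  strongly_measurable Rplus (D h f).
Proof.
move=> h0 sf; have mR := @measurable_Rplus R; apply: strongly_measurableZ => //.
apply: strongly_measurableB => //.
  exact: (evolution_semigroup_sm evW WN (ltW h0) sf).
exact: (evolution_semigroup_sm evU UM (ltW h0) sf).
Qed.

Lemma semigroup_differenceE (h t : R) (f : R -> X) : h <= t ->
  D h f t = (h^-1)%:C%C *: (W t (t - h) (f (t - h)) - U t (t - h) (f (t - h))).
Proof. by move=> ht; rewrite /D !fctE /evolution_semigroup ht. Qed.

Lemma semigroup_difference0 (h t : R) (f : R -> X) : t < h -> D h f t = 0.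
Proof. by move=> ht; rewrite /D !fctE /evolution_semigroup leNgt ht subrr scaler0. Qed.

Lemma semigroup_difference_le (h t : R) (f : R -> X) : 0 < h -> h <= t ->
  nrm (D h f t) <= K * nrm (f (t - h)).
Proof.
move=> h0 ht; rewrite semigroup_differenceE// nrmZR ger0_norm ?invr_ge0 ?(ltW h0)//.
rewrite ler_pdivrMl//; have /andP[th tt] := evolution_between (ltW h0) ht.
by have := perturbation_difference (f (t - h)) th tt;
  rewrite opprB addrCA subrr addr0 mulrA [h * K]mulrC.
Qed.

Lemma semigroup_difference_norm (h : R) (f : R -> X) : 0 < h -> strongly_measurable Rplus f ->
  (Lp_norm p (D h f) <= K%:E * Lp_norm p f)%E.
Proof.
move=> h0 sf; apply: (Lp_norm_shift_le p1 (ltW h0) K0 sf).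
- by move=> t ht; exact: semigroup_difference_le.
- by move=> t th; exact: semigroup_difference0.
Qed.

Lemma semigroup_difference_compact (g : R -> X) : Lp p g -> compact_continuous g ->
  Lp_norm p (D h g - k *: g) @[h --> (0 : R)^'+] --> 0%E.
Proof.
move=> [sg _] cg; have [C C0 hC] := compact_continuous_bounded cg; have [cont [b hb]] := cg.
have mR := @measurable_Rplus R.
apply: (@Lp_norm_cvg_right R p p1 X (fun h => D h g - k *: g)
  (K * C + complex.Re `|k| * C) (b + 1)).
- move=> h h0 _; apply: strongly_measurableB => //; first exact: semigroup_difference_sm.
  exact: strongly_measurableZ.
- move=> h t h0 h1 t0; rewrite -[X in nrm X]/(D h g t - k *: g t).
  apply: le_trans (nrmD _ _) _; rewrite nrmN (nrmZ k (g t)); apply: lerD; last first.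
    by apply: ler_wpM2l; [exact: Re_norm_ge0|exact: hC].
  have [ht|th] := leP h t; last by rewrite semigroup_difference0// nrm0 mulr_ge0.
  apply: le_trans (semigroup_difference_le _ h0 ht) _.
  by apply: ler_wpM2l => //; exact: hC.
- move=> h t h0 h1 bt; rewrite -[LHS]/(D h g t - k *: g t).
  have bth : b <= t - h by rewrite lerBrDr (le_trans _ bt)// lerD2l.
  have -> : g t = 0 by apply: hb; apply: le_trans (ler_norm t); rewrite (le_trans bth)// gerBl ltW.
  rewrite scaler0 subr0; have [ht|th] := leP h t; last by rewrite semigroup_difference0.
  apply: nrm_eq0; apply/eqP; rewrite eq_le nrm_ge0 andbT.
  apply: le_trans (semigroup_difference_le _ h0 ht) _.
  by rewrite hb ?nrm0 ?mulr0//; exact: le_trans (ler_norm _).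
- move=> t e t0 e0.
  (* The integrand depends on the running time [r] and on the starting time [t - h]. Clamping both
     into the triangle [0 <= s <= r <= t] makes it meaningful near [(t, t)] in the plane, so that a
     single limit there controls all short windows at once. *)
  pose b1 (z : R * R) : R := Num.max 0 (Num.min z.2 t).
  pose a1 (z : R * R) : R := Num.max (b1 z) (Num.min z.1 t).
  have b10 z : 0 <= b1 z by rewrite le_max lexx.
  have ba z : b1 z <= a1 z by rewrite le_max lexx.
  have b1t z : b1 z <= t by rewrite /b1 ge_max (ltW t0) ge_min lexx orbT.
  have a1t z : a1 z <= t by rewrite /a1 ge_max b1t ge_min lexx orbT.
  have b1tt : b1 (t, t) = t by rewrite /b1/= minxx (max_idPr (ltW t0)).
  have a1tt : a1 (t, t) = t by rewrite /a1 b1tt/= minxx maxxx.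
  have cb0 : b1 z @[z --> (t, t)] --> b1 (t, t).
    apply: (@continuous_max R (R * R)%type (fun=> 0) (fun z => Num.min z.2 t) (t, t)).
      exact: cvg_cst.
    by apply: (@continuous_min R (R * R)%type snd (fun=> t) (t, t)); [exact: cvg_snd|exact: cvg_cst].
  have ca0 : a1 z @[z --> (t, t)] --> a1 (t, t).
    apply: (@continuous_max R (R * R)%type b1 (fun z => Num.min z.1 t) (t, t) cb0).
    by apply: (@continuous_min R (R * R)%type fst (fun=> t) (t, t)); [exact: cvg_fst|exact: cvg_cst].
  have cb : b1 z @[z --> (t, t)] --> t by move: cb0; rewrite b1tt.
  have ca : a1 z @[z --> (t, t)] --> t by move: ca0; rewrite a1tt.
  have lW : W (a1 z) (b1 z) (g (b1 z)) @[z --> (t, t)] --> W t t (g t).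
    apply: (evolution_cvg evW WN (a := a1) (b := b1) (y := fun z => g (b1 z))) => //.
    + by rewrite lexx ltW.
    + by apply: nearW => z; rewrite b10 ba.
    + exact: (cvg_comp _ _ cb (cont t)).
  have lU : U t (a1 z) (k *: W (a1 z) (b1 z) (g (b1 z))) @[z --> (t, t)] -->
      U t t (k *: W t t (g t)).
    apply: (evolution_cvg evU UM (a := fun=> t) (b := a1)
      (y := fun z => k *: W (a1 z) (b1 z) (g (b1 z)))) => //.
    + by rewrite lexx ltW.
    + by apply: nearW => z; rewrite a1t (le_trans (b10 z)).
    + exact: cvg_cst.
    + exact: (cvgZr lW).
  have [_ _ iU _] := evU; have [_ _ iW _] := evW; rewrite (iU t (ltW t0)) (iW t (ltW t0)) in lU.
  have /cvg_nrmP/cvgrPdist_le/(_ e e0)/nbhs_ballP[d /= d0 hd] := lU.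
  exists (Num.min (d / 2) t); first by rewrite lt_min t0 divr_gt0.
  move=> h h0; rewrite le_min => /andP[hd2 ht].
  have /andP[th tt] := evolution_between (ltW h0) ht.
  have hdd : h < d.
    by apply: le_lt_trans hd2 _; rewrite ltr_pdivrMr// mulr2n mulrDr mulr1 ltrDl.
  have hs (r : R) : t - h <= r <= t ->
      nrm (U t r (k *: W r (t - h) (g (t - h))) - k *: g t) <= e.
    move=> /andP[thr rt]; have r0 := le_trans th thr.
    have bE : b1 (r, t - h) = t - h by rewrite /b1/= (min_idPl tt) (max_idPr th).
    have aE : a1 (r, t - h) = r by rewrite /a1 bE/= (min_idPl rt) (max_idPr thr).
    have : ball (t, t) d (r, t - h).
      split; rewrite /ball/=.
        rewrite ger0_norm ?subr_ge0//; apply: le_lt_trans hdd.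
        by rewrite lerBlDr -lerBlDl.
      by rewrite opprB addrCA subrr addr0 gtr0_norm.
    by move=> /hd /=; rewrite aE bE sub0r normrN ger0_norm ?nrm_ge0.
  have := bochner_mean tt (perturbation_integrand_sm (g (t - h)) th tt) hs.
  rewrite opprB addrCA subrr addr0 => bd.
  rewrite -[X in nrm X]/(D h g t - k *: g t) semigroup_differenceE// WU ?th//.
  rewrite [U t _ _ + _]addrC addrK.
  have -> : k *: g t = (h^-1)%:C%C *: (h%:C%C *: (k *: g t)).
    by rewrite [RHS]scalerA -rmorphM/= mulVf ?gt_eqF// scale1r.
  rewrite -scalerBr nrmZR ger0_norm ?invr_ge0 ?(ltW h0)// ler_pdivrMl// mulrC; exact: bd.
Qed.

Lemma semigroup_difference_cvg (f : R -> X) : Lp p f ->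
  Lp_norm p (D h f - k *: f) @[h --> (0 : R)^'+] --> 0%E.
Proof.
have mR := @measurable_Rplus R; have k0 := Re_norm_ge0 k.
apply: (@Lp_density_cvg R p p1 X X (fun h f => D h f - k *: f) (K + complex.Re `|k|)).
- exact: addr_ge0.
- move=> h g h0 _ [sg _]; apply: strongly_measurableB => //.
    exact: semigroup_difference_sm.
  exact: strongly_measurableZ.
- move=> h g h0 _ [sg _].
  apply: le_trans (Lp_normB p1 (semigroup_difference_sm h0 sg) (strongly_measurableZ k mR sg)) _.
  rewrite EFinD ge0_muleDl ?lee_fin//; apply: leeD; first exact: semigroup_difference_norm.
  by rewrite Lp_normZ.
- move=> h f' g h0 _ _ _; apply: aeW => t _.
  have DB : D h (f' - g) = D h f' - D h g.
    rewrite /D (evolution_semigroupB evW f' g (ltW h0)) (evolution_semigroupB evU f' g (ltW h0)).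
    by rewrite -scalerBr !opprB addrACA [in RHS]addrACA (addrC (- EW h g)).
  rewrite -[LHS]/(D h (f' - g) t - k *: (f' t - g t)) DB.
  rewrite -[RHS]/((D h f' t - k *: f' t) - (D h g t - k *: g t)) scalerBr.
  rewrite -[LHS]/((D h f' t - D h g t) - (k *: f' t - k *: g t)).
  by rewrite !opprB addrACA [RHS]addrACA (addrC (- D h g t)).
- exact: semigroup_difference_compact.
Qed.

(** The difference quotients of the two semigroups at [f] differ by [semigroup_difference], which
    converges for every [f] in L^p; so if one of them converges, so does the other, with limits
    differing by [k *: f]. *)
Lemma generator_perturbation (f g : R -> X) :
  generator p EW f g <-> Lp p f /\ generator p EU f (g - k *: f).
Proof.
have mR := @measurable_Rplus R.
have alg (Z : lmodType R[i]) (a : R[i]) (e w f' g' q : Z) :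
    a *: (e - f') - (g' - q) = (a *: (w - f') - g') - (a *: (w - e) - q).
  rewrite !scalerBr !opprB; set x := a *: e; set y := a *: f'; set z := a *: w.
  rewrite -!addrA [x - z]addrC !(addrCA _ (- z)) addKr addrCA; congr (_ + _).
  by rewrite [LHS]addrA [x + q]addrC [LHS]addrC.
split=> [[hf hg cf]|[hf [_ hg' cf]]].
  have hkf := LpZ p1 k hf; have hgf := LpB p1 hg hkf; have cD := semigroup_difference_cvg hf.
  split; [exact: hf|split; [exact: hf|exact: hgf|]].
  apply: (cvge_right0_squeeze ltr01 (v := fun h =>
    (Lp_norm p ((h^-1)%:C%C *: (EW h f - f) - g)%R + Lp_norm p (D h f - k *: f)%R)%E)).
  - by move=> h; exact: Lp_norm_ge0.
  - move=> h h0 _; rewrite (alg _ _ (EU h f) (EW h f)).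
    apply: (Lp_normB p1 (difference_quotient_sm evW WN (ltW h0) hf hg)).
    have [sf _] := hf; apply: strongly_measurableB; first exact: mR.
      exact: semigroup_difference_sm.
    exact: strongly_measurableZ.
  - rewrite -[X in _ --> X](adde0 0%E).
    by apply: cvgeD; [by []|exact: cf|exact: cD].
have hkf := LpZ p1 k hf; have cD := semigroup_difference_cvg hf.
have hg : Lp p g by have := LpD p1 hg' hkf; rewrite subrK.
split; [exact: hf|exact: hg|].
apply: (cvge_right0_squeeze ltr01 (v := fun h =>
  (Lp_norm p ((h^-1)%:C%C *: (EU h f - f) - (g - k *: f))%R + Lp_norm p (D h f - k *: f)%R)%E)).
- by move=> h; exact: Lp_norm_ge0.
- move=> h h0 _.
  have -> : (h^-1)%:C%C *: (EW h f - f) - g =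
      ((h^-1)%:C%C *: (EU h f - f) - (g - k *: f)) + (D h f - k *: f).
    by rewrite (alg _ _ (EU h f) (EW h f)) subrK.
  apply: (Lp_normD p1 (difference_quotient_sm evU UM (ltW h0) hf hg')).
  have [sf _] := hf; apply: strongly_measurableB; first exact: mR.
    exact: semigroup_difference_sm.
  exact: strongly_measurableZ.
- rewrite -[X in _ --> X](adde0 0%E).
  by apply: cvgeD; [by []|exact: cf|exact: cD].
Qed.

End GeneratorPerturbation.

Lemma Re_norm_inv {R : realType} (l : R[i]) : l != 0 ->
  complex.Re `|l^-1| = (complex.Re `|l|)^-1.
Proof.
move=> l0; rewrite normfV normc_def/= ; set z := Num.sqrt _.
have z0 : z != 0.
  apply/eqP => z0; move: l0; rewrite -normr_eq0 normc_def -/z z0.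
  by rewrite eqxx.
by rewrite expr0n/= addr0; field.
Qed.

Lemma GG_scale {R : realType} {X : completeNormedModType R[i]} (p : R)
    (U : R -> R -> X -> X) (M o : R) : 1 <= p -> evolution_family U -> 1 <= M -> o < 0 ->
  (forall (t s : R) (x : X), 0 <= s <= t ->
    nrm (U t s x) <= M * expR (o * (t - s)) * nrm x) ->
  forall (a : R[i]) (f : R -> X) (t : R), Lp p f -> GG U (a *: f) t = a *: GG U f t.
Proof.
move=> p1 evU M1 o0 Uexp a f t hf.
(* [a *: f] is written as [(a - 1) *: f + f], the shape for which linearity is stated. *)
by have := GG_lin p1 evU M1 o0 Uexp (a - 1) t hf hf; rewrite !scalerBl !scale1r !subrK.
Qed.

(** * From a stable constant perturbation to a point of the resolvent set *)

Section Resolvent.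
Context {R : realType} {X : completeNormedModType R[i]}.
Local Notation mu := (@lebesgue_measure R).
Variables (p : R) (U W : R -> R -> X -> X) (M N o o' : R) (l : R[i]).
Hypotheses (p1 : 1 <= p) (l0 : l != 0)
  (evU : evolution_family U) (M1 : 1 <= M) (o0 : o < 0)
  (Uexp : forall (t s : R) (x : X), 0 <= s <= t ->
    nrm (U t s x) <= M * expR (o * (t - s)) * nrm x)
  (evW : evolution_family W) (N1 : 1 <= N) (o0' : o' < 0)
  (Wexp : forall (t s : R) (x : X), 0 <= s <= t ->
    nrm (W t s x) <= N * expR (o' * (t - s)) * nrm x).
Local Notation k := (- l^-1).
Hypothesis (WU : forall (x : X) (t s : R), 0 <= s <= t ->
    W t s x = U t s x + bochner s t (fun r => U t r (k *: W r s x))).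

Let UM := stable_uniform M1 o0 Uexp.
Let WN := stable_uniform N1 o0' Wexp.
Let M0 : 0 <= M. Proof. exact: le_trans M1. Qed.
Let N0 : 0 <= N. Proof. exact: le_trans N1. Qed.

Let gen f g := generator_perturbation p1 evU evW M0 N0 UM WN WU f g.

(** The generator of W is that of U plus [k]. It maps [- GG W g] to [g], so the generator of U maps
    [- GG W g] to [g + k *: GG W g]; inverting gives the first identity, and the same argument with
    the roles exchanged gives the second. *)
Lemma GG_perturbation (g : R -> X) : Lp p g ->
  Lp_eq (GG U (g + k *: GG W g)) (GG W g) /\ Lp_eq (GG W (g - k *: GG U g)) (GG U g).
Proof.
move=> hg; have [_ gU iU] := GG_inverse p1 evU M1 o0 Uexp.
have [_ gW iW] := GG_inverse p1 evW N1 o0' Wexp; split.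
  have [_ h] := (gen _ _).1 (gW _ hg); have := iU _ _ h.
  rewrite scalerN opprK => e; apply: (ae_imply e) => t et Rt.
  exact: oppr_inj (et Rt).
have hG := LpN p1 (GG_Lp p1 evU M1 o0 Uexp hg).
have h : generator p (evolution_semigroup W) (- GG U g) (g - k *: GG U g).
  by apply/gen; split; [exact: hG|rewrite scalerN opprK subrK; exact: gU].
have e := iW _ _ h; apply: (ae_imply e) => t et Rt; exact: oppr_inj (et Rt).
Qed.

(* The inverse of l + G = l (1 - k G), because (1 - k G)^-1 = 1 + k G_W. *)
Definition perturbed_resolvent (f : R -> X) : R -> X := l^-1 *: (f + k *: GG W f).

Lemma perturbed_resolvent_bounded : Lp_bounded p perturbed_resolvent.
Proof.
have bW := GG_bounded p1 evW N1 o0' Wexp; have [W1 W2 W3 _] := bW.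
have mR := @measurable_Rplus R.
have q0 : 0 <= N / - o' by rewrite divr_ge0// oppr_ge0 ltW.
have sm (f : R -> X) : Lp p f -> strongly_measurable Rplus (f + k *: GG W f).
  move=> hf; have [s _] := LpD p1 hf (LpZ p1 k (W1 f hf)); exact: s.
apply: (@Lp_boundedP _ _ _ _ _ (complex.Re `|l^-1| * (1 + complex.Re `|k| * (N / - o')))).
- by rewrite mulr_ge0 ?Re_norm_ge0// addr_ge0// mulr_ge0// Re_norm_ge0.
- by move=> f hf; apply: strongly_measurableZ; [exact: mR|exact: sm].
- move=> f g hf hg fg; have h := W2 f g hf hg fg.
  apply: (ae_imply2 fg h) => t e1 e2 Rt.
  rewrite -[LHS]/(l^-1 *: (f t + k *: GG W f t)) -[RHS]/(l^-1 *: (g t + k *: GG W g t)).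
  by rewrite (e1 Rt) (e2 Rt).
- move=> a f g hf hg; apply: aeW => t Rt.
  rewrite -[LHS]/(l^-1 *: ((a *: f t + g t) + k *: GG W (a *: f + g) t)).
  rewrite -[RHS]/(a *: (l^-1 *: (f t + k *: GG W f t)) + l^-1 *: (g t + k *: GG W g t)).
  rewrite (GG_lin p1 evW N1 o0' Wexp a t hf hg) scalerA [a * _]mulrC -scalerA -scalerDr.
  apply: (congr1 (fun x => l^-1 *: x)); rewrite [k *: (_ + _)]scalerDr [a *: (_ + _)]scalerDr.
  by rewrite !scalerA [k * a]mulrC addrACA.
- move=> f hf; have [sf _] := hf; have [sG _] := W1 f hf.
  rewrite /perturbed_resolvent (Lp_normZ p1 _ (sm f hf)) EFinM -muleA.
  apply: lee_wpmul2l; first by rewrite lee_fin Re_norm_ge0.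
  have kp : 0 <= complex.Re `|k| * (N / - o') by rewrite mulr_ge0// Re_norm_ge0.
  rewrite EFinD ge0_muleDl ?lee_fin// mul1e.
  apply: le_trans (Lp_normD p1 sf (strongly_measurableZ k mR sG)) _.
  apply: leeD; first exact: lexx.
  rewrite (Lp_normZ p1 _ sG) EFinM -muleA; apply: lee_wpmul2l.
    by rewrite lee_fin Re_norm_ge0.
  exact: (GG_norm p1 evW N1 o0' Wexp).
Qed.

Lemma GG_resolvent_set : Lp_resolvent_set p (fun g => - GG U g) l.
Proof.
exists perturbed_resolvent; first exact: perturbed_resolvent_bounded.
move=> f hf; have hU := GG_Lp p1 evU M1 o0 Uexp hf; have hW := GG_Lp p1 evW N1 o0' Wexp hf.
have [e1 e2] := GG_perturbation hf; split.
- apply: (ae_imply e1) => t e Rt; have {}e := e Rt.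
  have hh := LpD p1 hf (LpZ p1 k hW).
  rewrite -[LHS]/(l *: (l^-1 *: (f t + k *: GG W f t)) - - GG U (l^-1 *: (f + k *: GG W f)) t).
  rewrite opprK (GG_scale p1 evU M1 o0 Uexp _ _ hh) e scalerA (mulfV l0) scale1r.
  by rewrite scaleNr subrK.
- apply: (ae_imply e2) => t e Rt; have {}e := e Rt.
  have hh := LpB p1 hf (LpZ p1 k hU).
  have E : l *: f - - GG U f = l *: (f - k *: GG U f).
    by rewrite scalerBr scalerA mulrN (mulfV l0) scaleN1r.
  rewrite -[LHS]/(l^-1 *: ((l *: f t - - GG U f t) + k *: GG W (l *: f - - GG U f) t)).
  rewrite E (GG_scale p1 evW N1 o0' Wexp _ _ hh) e scalerA mulNr (mulVf l0) scaleN1r opprK addrK.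
  by rewrite scalerA (mulVf l0) scale1r.
Qed.

End Resolvent.

Lemma r_stab_le {R : realType} {X : completeNormedModType R[i]} (p : R)
    (U : R -> R -> X -> X) : 1 <= p -> evolution_family U -> exponentially_stable U ->
  (r_stab U (fun _ => @id X) (fun _ => @id X) <=
   (Lp_spectral_radius p (fun g => - GG U g)%R)^-1)%E.
Proof.
move=> p1 evU sU; have [M [om [M1 o0 Uexp]]] := exponentially_stableP evU sU.
have rho0 : (0 <= Lp_spectral_radius p (fun g => - GG U g)%R)%E.
  by apply: ereal_sup_ubound; left.
apply: ub_ereal_sup => _ [r [r0 hr] <-].
(* Inversion turns the claim into an upper bound [r^-1] for each spectral value; at [r = 0] this
   bound is infinite. *)
rewrite inve_pge ?inE ?lee_fin//.
move: r0; rewrite le_eqVlt => /predU1P[<-|rp]; first by rewrite inve0 leey.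
rewrite inver gt_eqF//; apply: ub_ereal_sup => _ [->|[l spec <-]].
  by rewrite lee_fin invr_ge0 ltW.
rewrite lee_fin leNgt; apply/negP => lt; apply: spec.
have nl0 : 0 < complex.Re `|l| by apply: lt_trans lt; rewrite invr_gt0.
have l0 : l != 0.
  by apply/eqP => E; move: nl0; rewrite E normr0 ltxx.
pose k := - l^-1 : R[i].
have kr : complex.Re `|k| <= r.
  (* The norm of [k] is the inverse of that of [l], so the assumption that [l] is larger than [r^-1]
     makes the perturbation [k] admissible for [r]. *)
  by rewrite normrN Re_norm_inv// invf_ple ?posrE// ltW.
have lk (a : R[i]) (x y : X) : k *: (a *: x + y) = a *: (k *: x) + k *: y.
  by rewrite scalerDr !scalerA mulrC.
have bk (x : X) : nrm (k *: x) <= complex.Re `|k| * nrm x by rewrite nrmZ.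
have [LD leD] := Linf_s_cst (Re_norm_ge0 k) lk bk.
have [|W [evW WU] sW] := hr _ LD; first by apply: le_trans leD _; rewrite lee_fin.
have [N [om' [N1 o0' Wexp]]] := exponentially_stableP evW sW.
exact: (GG_resolvent_set p1 l0 evU M1 o0 Uexp evW N1 o0' Wexp WU).
Qed.

Theorem theorem4p2 (R : realType) (X V Y : completeNormedModType R[i]) (p : R)
    (U : R -> R -> X -> X) (B : R -> V -> X) (C : R -> X -> Y)
    (p_ge1 : 1 <= p)
    (U_evol : evolution_family U) (U_stable : exponentially_stable U)
    (B_Linf : Linf_s B) (C_Linf : Linf_s C) :
  let L := input_output U B C in
  let I := fun _ : R => @id X in
  let L_I := input_output U I I in
  exists2 Gamma_inv : (R -> X) -> R -> X,
    bounded_inverse p (generator p (evolution_semigroup U)) Gamma_inv &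
    [/\ Lp_bounded p L,
        [/\ Lp_bounded p (mult_op B), Lp_bounded p (GG U)
          & Lp_bounded p (mult_op C)],
        forall u, Lp p u ->
          Lp_eq (L u) (mult_op C (GG U (mult_op B u))) /\
          Lp_eq (L u) (- mult_op C (Gamma_inv (mult_op B u))),
        ((Lp_opnorm p L)^-1 <= r_stab U B C)%E
      & [/\ forall f, Lp p f -> Lp_eq (L_I f) (- Gamma_inv f),
            ((Lp_opnorm p Gamma_inv)^-1 <= r_stab U I I)%E
          & (r_stab U I I <= (Lp_spectral_radius p Gamma_inv)^-1)%E]].
Proof.
move=> L I L_I; have [M [om [M1 o0 Uexp]]] := exponentially_stableP U_evol U_stable.
exists (fun g => - GG U g); first exact: GG_inverse p_ge1 U_evol M1 o0 Uexp.
split.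
- exact: (input_output_bounded p_ge1 U_evol M1 o0 Uexp B_Linf C_Linf).
- split; [exact: mult_op_bounded|exact: (GG_bounded p_ge1 U_evol M1 o0 Uexp)|].
  exact: mult_op_bounded.
(* The first factorisation is an unfolding of definitions; in the second the two signs cancel
   because [C t] is linear for [t >= 0]. *)
- move=> u hu; split; apply: aeW => t Rt; first exact: erefl.
  have [bC _ _] := C_Linf.
  rewrite -[RHS]/(- C t (- GG U (mult_op B u) t)) (blinN (bC t Rt)) opprK.
  exact: erefl.
- exact: r_stab_ge.
- split.
  + by move=> f hf; apply: aeW => t Rt; rewrite opprK.
  + rewrite Lp_opnormN; exact: (r_stab_ge p_ge1 U_evol U_stable (@Linf_s_id R X) (@Linf_s_id R X)).
  + exact: r_stab_le.
Qed.
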